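(* Let $q$ on $(0,b)$, $0<b\le\infty$, together with a boundary condition at $b$ where applicable, be as in one of the Cases 1–4 described in the context, and let $m(z)$ be the associated Weyl–Titchmarsh $m$-function. Then there exists a function $A(\alpha)$ for $\alpha\in[0,b)$ so that $A\in L^1((0,a))$ for all $a<b$ and, for every $0<a<b$ and every $\varepsilon>0$, $$m(-\kappa^2) = -\kappa - \int_0^a A(\alpha)e^{-2\alpha\kappa}\,d\alpha + \tilde O(e^{-2a\kappa})$$ as $|\kappa|\to\infty$ with $-\frac{\pi}{2}+\varepsilon<\arg(\kappa)<-\varepsilon<0$. Moreover, $A-q$ is continuous and $$|(A-q)(\alpha)|\le\left[\int_0^\alpha|q(x)|\,dx\right]^2\exp\left(\alpha\int_0^\alpha|q(x)|\,dx\right).$$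
   Context: Setting. $q$ is a real-valued function on $(0,b)$ and one of the following holds. Case 1: $b<\infty$, $q\in L^1((0,b))$, and a parameter $h\in\mathbb R\cup\{\infty\}$ is fixed, giving the boundary condition $u'(b_-)+hu(b_-)=0$ (with $h=\infty$ meaning $u(b_-)=0$). In Cases 2–4, $b=\infty$ and $\int_0^a|q(x)|\,dx<\infty$ for all $a<\infty$. Case 2: $\sup_{a>0}\int_a^{a+1}\max(-q(x),0)\,dx<\infty$. Case 3: the condition of Case 2 fails, but $-\frac{d^2}{dx^2}+q$ is limit point at $\infty$, i.e. for each $z$ with $\operatorname{Im}z>0$ the equation $-u''+qu=zu$ has a solution, unique up to a multiplicative constant, that is $L^2$ at $\infty$. Case 4: $-\frac{d^2}{dx^2}+q$ is limit circle at $\infty$, i.e. every solution of $-u''+qu=zu$ is $L^2$ at $\infty$ if $\operatorname{Im} z>0$; a boundary condition at infinity is picked by picking a nonzero solution $u_0$ of $-u''+qu=iu$, and a function $u$ satisfies the boundary condition if $\lim_{x\to\infty}[u_0(x)u'(x)-u_0'(x)u(x)]=0$. For $\operatorname{Im}z>0$ let $u(x,z)$ be a nonzero solution of $-u''+qu=zu$ satisfying the boundary condition at $b$ (in Cases 2, 3: square integrable near $\infty$), and define $m(z)=u'(0_+,z)/u(0_+,z)$. Notation: $f=\tilde O(g)$ as $|\kappa|\to\infty$ means that $g\to0$ and for all $\eta>0$, $(f/g)|g|^{\eta}\to0$ as $|\kappa|\to\infty$.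
   Formalization: In Case 4 the solution u_0 is also required to satisfy lim Im(u_0' conj(u_0)) >= 0 at infinity (all self-adjoint conditions qualify); for arbitrary u_0 the claim fails, e.g. q = -x^4, u_0 ~ exp(-ix^3/3)/x. As usual for L^1, q is taken Borel measurable. *)

(* Defs.v *)
From HB Require Import structures.
From mathcomp Require Import all_boot all_order all_algebra.
From mathcomp Require Import all_classical all_reals all_analysis.
From mathcomp Require Import complex.
Set Implicit Arguments.
Unset Strict Implicit.
Unset Printing Implicit Defensive.
Import Order.TTheory GRing.Theory Num.Theory.
Import numFieldNormedType.Exports.
Import ComplexField.Normc.
Import complex.
Local Open Scope classical_set_scope.
Local Open Scope complex_scope.
Local Open Scope ring_scope.

Section ComplexValued.
Context {R : realType}.
Implicit Types (f : R -> R[i]) (D : set R).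

(* The library puts a topology on R[i]^o, not on the bare type R[i]; the
   following three definitions only record this. *)
Definition ccvg {T : Type} (F : set_system T) (f : T -> R[i]) (l : R[i]) : Prop :=
  (f x : R[i]^o) @[x --> F] --> (l : R[i]^o).

Definition lim_right f (a : R) : R[i] := lim ((f x : R[i]^o) @[x --> a^'+]).

Definition lim_left f (b : R) : R[i] := lim ((f x : R[i]^o) @[x --> b^'-]).

Definition cexp (w : R[i]) : R[i] :=
  (expR (Re w) * cos (Im w)) +i* (expR (Re w) * sin (Im w)).

(* R[i] is not a normed space over R in the library, so derivatives and
   integrals of functions of a real variable are taken componentwise. *)
Definition cderivable f (x : R) : Prop :=
  derivable (fun t => Re (f t)) x 1 /\ derivable (fun t => Im (f t)) x 1.

Definition cderiv f (x : R) : R[i] :=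
  derive1 (fun t => Re (f t)) x +i* derive1 (fun t => Im (f t)) x.

Definition cintegrable D f : Prop :=
  lebesgue_measure.-integrable D (fun x => (Re (f x))%:E) /\
  lebesgue_measure.-integrable D (fun x => (Im (f x))%:E).

Definition cintegral D f : R[i] :=
  (\int[lebesgue_measure]_(x in D) Re (f x)) +i*
  (\int[lebesgue_measure]_(x in D) Im (f x)).

(* f is locally absolutely continuous on (0, b) with a.e. derivative w. *)
Definition ac_derivative (b : \bar R) f (w : R -> R[i]) : Prop :=
  forall x y : R, 0 < x -> x < y -> (y%:E < b)%E ->
    cintegrable `[x, y] w /\ f y - f x = cintegral `[x, y] w.

Definition L2_at_infinity f : Prop :=
  exists2 c : R, 0 < c &
    lebesgue_measure.-integrable `]c, +oo[ (fun x => (normc (f x) ^+ 2)%:E).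

End ComplexValued.

Section Schroedinger.
Context {R : realType}.
Implicit Types (q : R -> R) (b : \bar R) (z : R[i]) (u : R -> R[i]).

(* -u'' + q u = z u on (0, b), for a locally integrable q: u is differentiable,
   u' is locally absolutely continuous, and the equation holds a.e. *)
Definition schroedinger_solution q b z u : Prop :=
  (forall x : R, 0 < x -> (x%:E < b)%E -> cderivable u x) /\
  exists2 ddu : R -> R[i],
    ac_derivative b (cderiv u) ddu &
    {ae lebesgue_measure, forall x : R, 0 < x -> (x%:E < b)%E ->
       - ddu x + (q x)%:C * u x = z * u x}.

Definition nonzero_on b u : Prop :=
  exists x : R, [/\ 0 < x, (x%:E < b)%E & u x != 0].

Definition locally_integrable_potential q : Prop :=
  forall a : R, 0 < a ->
    lebesgue_measure.-integrable `]0, a[ (fun x => (q x)%:E).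

Definition bounded_negative_part q : Prop :=
  (ereal_sup [set \int[lebesgue_measure]_(x in `]a, (a + 1)%R[)
                    (Num.max (- q x) 0)%:E | a in [set a : R | (0 < a)%R]]
     < +oo)%E.

Definition limit_point_at_infinity q : Prop :=
  forall z, 0 < Im z ->
    exists u, [/\ schroedinger_solution q +oo%E z u, nonzero_on +oo%E u,
      L2_at_infinity u &
      forall v, schroedinger_solution q +oo%E z v -> L2_at_infinity v ->
        exists k : R[i], forall x : R, 0 < x -> v x = k * u x].

Definition limit_circle_at_infinity q : Prop :=
  forall z, 0 < Im z ->
    forall u, schroedinger_solution q +oo%E z u -> L2_at_infinity u.

(* In RegularEnd b h, the boundary parameter h is a real number, or None for
   the Dirichlet condition h = oo. *)
Inductive endpoint : Type :=
  | RegularEnd (b : R) (h : option R)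
  | BoundedNegativePart
  | LimitPoint
  | LimitCircle (u0 : R -> R[i]).

Implicit Type e : endpoint.

Definition end_of e : \bar R :=
  if e is RegularEnd b _ then b%:E else +oo%E.

(* For LimitCircle, the last clause says that u0 defines an m-function mapping
   the upper half-plane to itself. The limit exists, since Im (u0' conj(u0)) is
   nonincreasing and has derivative - |u0|^2; it is 0 exactly when the boundary
   condition is self-adjoint. Without the clause, m need not be defined for all
   large z: if q x = - x ^+ 4 and u0 is the solution behaving like
   exp(- i x^3 / 3) / x, then m has poles at E exp(i pi / 3) for every
   Dirichlet eigenvalue E of - d^2/dy^2 + y^4 on (0, oo). *)
Definition admissible q e : Prop :=
  match e with
  | RegularEnd b _ =>
      0 < b /\ lebesgue_measure.-integrable `]0, b[ (fun x => (q x)%:E)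
  | BoundedNegativePart =>
      locally_integrable_potential q /\ bounded_negative_part q
  | LimitPoint =>
      [/\ locally_integrable_potential q, ~ bounded_negative_part q &
          limit_point_at_infinity q]
  | LimitCircle u0 =>
      [/\ locally_integrable_potential q, limit_circle_at_infinity q,
          schroedinger_solution q +oo%E 'i%C u0, nonzero_on +oo%E u0 &
          exists2 l : R, 0 <= l &
            Im (cderiv u0 x * conjc (u0 x)) @[x --> +oo] --> l]
  end.

Definition boundary_condition e u : Prop :=
  match e with
  | RegularEnd b (Some h) =>
      lim_left (cderiv u) b + h%:C * lim_left u b = 0
  | RegularEnd b None => lim_left u b = 0
  | BoundedNegativePart | LimitPoint => L2_at_infinity u
  | LimitCircle u0 =>
      ccvg (+oo : set_system R) (fun x => u0 x * cderiv u x - cderiv u0 x * u x) 0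
  end.

Definition weyl_solution q e z u : Prop :=
  [/\ schroedinger_solution q (end_of e) z u, nonzero_on (end_of e) u &
      boundary_condition e u].

Definition is_m_function q e (m : R[i] -> R[i]) : Prop :=
  forall z, 0 < Im z ->
    exists2 u, weyl_solution q e z u &
      m z = lim_right (cderiv u) 0 / lim_right u 0.

End Schroedinger.

Arguments endpoint : clear implicits.

Section Asymptotics.
Context {R : realType}.

(* - pi / 2 + eps < arg kappa < - eps, by means of the polar form of kappa. *)
Definition sector (eps : R) : set R[i] :=
  [set kappa | exists r theta : R,
    [/\ 0 < r, - (pi / 2) + eps < theta, theta < - eps &
        kappa = r%:C * cexp (0 +i* theta)]].

Definition infinity_in (S : set R[i]) : set_system R[i] :=
  within S (filter_from [set: R] (fun M => [set kappa | M < normc kappa])).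

Definition tildeO (F : set_system R[i]) (f g : R[i] -> R[i]) : Prop :=
  ccvg F g 0 /\
  forall eta : R, 0 < eta ->
    ccvg F (fun kappa => f kappa / g kappa * ((normc (g kappa)) `^ eta)%:C) 0.

End Asymptotics.

(* Main.v *)
(* Let k be the Goursat kernel: d_eta d_xi k = - q (xi - eta) k (xi, eta),
   k (x, x) = 0 and d_xi k (x, 0) = - q x / 2. It comes from a Picard iteration,
   and A x := - 2 d_xi k (x, x) = q x + 2 \int_0^x q (x - y) k (x, y) dy.

   For a solution u of - u'' + q u = - kappa^2 u put
   F := exp (- kappa x) (u' + kappa u) and G := exp (- kappa x) u, so that
   F' = q G and G' = F - 2 kappa G. Integrating
   exp (- 2 kappa eta) (d_xi k F (xi - eta) + k F' (xi - eta)) over the triangle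
   0 <= eta <= xi <= a in both orders yields
     \int_0^a q G = G 0 \int_0^a A x exp (- 2 kappa x) dx
                   - 2 \int_0^a k (a, y) exp (- 2 kappa y) F (a - y) dy,
   hence m + kappa + \int_0^a A x exp (- 2 kappa x) dx is, up to the factor
   1 / u 0, equal to F a plus twice the last integral.

   It remains to bound F x by |kappa| exp (- 2 x Re kappa) |u 0|. Variation of
   constants from a down to 0 bounds u by the data at a, and Im (u' conj u) >= 0
   at a turns this into decay of u. This inequality, of Herglotz type, is where
   the condition at b enters, by a different argument in each of the four cases;
   throughout, Im (u' conj u) is nonincreasing, with derivative - Im z |u|^2. *)

Require Import Defs.
From HB Require Import structures.
From mathcomp Require Import all_boot all_order all_algebra.
From mathcomp Require Import all_classical all_reals all_analysis.
From mathcomp Require Import measurable_realfun complex ring lra.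
Set Implicit Arguments.
Unset Strict Implicit.
Unset Printing Implicit Defensive.
Import Order.TTheory GRing.Theory Num.Theory.
Import numFieldNormedType.Exports.
Import ComplexField.Normc.
Import complex.
Local Open Scope classical_set_scope.
Local Open Scope complex_scope.
Local Open Scope ring_scope.

(** * Absolutely continuous functions *)

Section AbsolutelyContinuous.
Context {R : realType}.
Notation mu := (@lebesgue_measure R).
Implicit Types (a b x y : R) (f g : R -> R).

(** The kernel and [A] are built from [q] alone, so one construction serves all [kappa] and [a]. The
    condition at [b] enters only through the sign of [Im (u' conj u)] at [a]. In the sector both
    [Re kappa] and [- Im kappa] are at least a fixed multiple of [|kappa|]: the first gives
    exponential decay, the second lets that sign bound [u' + kappa u] by [u' - kappa u] at [a]. The
    factor [|kappa|] left in the remainder is harmless, because [tildeO] gives away a small power of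
    the exponential. The sign comes about as follows. At a regular end, a real boundary condition
    makes the quantity vanish at [b]. If the negative part of [q] is bounded, a negative value keeps
    [|u| |u'|] away from 0, which makes [|u|^2] too convex where it is small for [u] to be L2. In
    the limit point case, a negative value would make all solutions proportional. In the limit
    circle case, it contradicts a Cauchy-Schwarz bound on the Wronskian of [u0] and [u]. Since [q]
    is merely integrable, all calculus is done with primitives, and continuity in [x] is obtained by
    moving [x] out of the argument of [q]. *)

Lemma half_lt x : 0 < x -> x / 2 < x.
Proof. by move=> x0; rewrite ltr_pdivrMr // ltr_pMr // ltr1n. Qed.

(** Absolute continuity in integral form. No derivative of [f] is taken, so [f'] may be changed on
    null sets, and the rules of calculus have to be proved for integrals. *)
Definition rac a b (f f' : R -> R) :=
  mu.-integrable `[a, b] (EFin \o f') /\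
  forall x, a <= x <= b -> f x = f a + \int[mu]_(t in `[a, x]) f' t.

(* The library states [measurable_itv] for the display of [R] itself, which
   does not unify with the one carried by [lebesgue_measure]. *)
Lemma mitv (i : interval R) :
  measurable ([set` i] : set (measurableTypeR R)).
Proof. exact: measurable_itv. Qed.

Lemma integrable_itvS a b x y f : mu.-integrable `[a, b] (EFin \o f) ->
  a <= x -> y <= b -> mu.-integrable `[x, y] (EFin \o f).
Proof.
move=> fi ax yb; apply: integrableS fi => //.
by apply: subset_itv; rewrite bnd_simp.
Qed.

Lemma Rintegral_itv_cat a x b f : mu.-integrable `[a, b] (EFin \o f) ->
  a <= x -> x <= b ->
  \int[mu]_(t in `[a, b]) f t =
  \int[mu]_(t in `[a, x]) f t + \int[mu]_(t in `[x, b]) f t.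
Proof.
move=> fi ax xb.
have fi' := integrable_itvS fi ax (lexx b).
rewrite -(@Rintegral_itv_obnd_cbnd _ x (BRight b)); last first.
  by apply: integrableS fi'  => //; apply: subset_itv; rewrite bnd_simp.
by rewrite -(@Rintegral_itvB _ f (BLeft a) (BRight b) x) // ?bnd_simp // addrC subrK.
Qed.

Lemma rac_sub a b f f' x y : rac a b f f' -> a <= x -> x <= y -> y <= b ->
  f y - f x = \int[mu]_(t in `[x, y]) f' t.
Proof.
move=> [fi ff] ax xy yb.
rewrite (ff y) ?(le_trans ax xy) // (ff x) ?ax ?(le_trans xy yb) //.
rewrite (@Rintegral_itv_cat a x y) //; last exact: integrable_itvS fi _ _.
by rewrite opprD addrACA subrr add0r addrAC subrr add0r.
Qed.

Lemma racW a b f f' x y : rac a b f f' -> a <= x -> y <= b -> rac x y f f'.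
Proof.
move=> h ax yb; split; first by case: h => fi _; exact: integrable_itvS fi _ _.
move=> t /andP[xt ty]; rewrite -(rac_sub h) //; first by rewrite addrC subrK.
exact: le_trans ty yb.
Qed.

Lemma rac_continuous a b f f' : a <= b -> rac a b f f' ->
  {within `[a, b], continuous f}.
Proof.
move=> ab [fi ff].
have h := parameterized_integral_continuous ab fi.
have : {within `[a, b], continuous (fun x => f a + \int[mu]_(t in `[a, x]) f' t)}.
  by move=> x; apply: cvgD; [exact: cvg_cst|exact: h].
apply: subspace_eq_continuous => x /set_mem /=; rewrite in_itv /= => xab.
exact: (esym (ff x xab)).
Qed.

Lemma rac_eq a b f f' g g' : rac a b f f' -> (forall x, a <= x <= b -> f x = g x) ->
  (forall x, a <= x <= b -> f' x = g' x) -> rac a b g g'.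
Proof.
move=> [fi ff] fg fg'; split.
  apply: eq_integrable fi => // x /set_mem /=; rewrite in_itv /= => xab.
  by rewrite /= fg'.
move=> x xab; rewrite -fg // ff //.
have ab : a <= a <= b.
  by rewrite lexx /=; case/andP: xab => h1 h2; exact: le_trans h1 h2.
congr (_ + _); first by rewrite fg.
apply: eq_Rintegral => t /set_mem /=; rewrite in_itv /= => /andP[at' tx].
by rewrite fg' // at' /= (le_trans tx) //; case/andP: xab.
Qed.

Lemma racD a b f f' g g' : rac a b f f' -> rac a b g g' ->
  rac a b (fun x => f x + g x) (fun x => f' x + g' x).
Proof.
move=> [fi ff] [gi gg]; split.
  have := integrableD (mitv _) fi gi.
  by apply: eq_integrable => // x _; rewrite /= EFinD.
move=> x xab; have /andP[ax xb] := xab; rewrite ff // gg // RintegralD //.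
- by rewrite addrACA.
- exact: integrable_itvS fi _ _.
- exact: integrable_itvS gi _ _.
Qed.

Lemma racZ a b f f' c : rac a b f f' ->
  rac a b (fun x => c * f x) (fun x => c * f' x).
Proof.
move=> [fi ff]; split.
  have := integrableZl (mitv _) c fi.
  by apply: eq_integrable => // x _; rewrite /= EFinM.
move=> x xab; have /andP[ax xb] := xab.
rewrite ff // RintegralZl //; first by rewrite mulrDr.
exact: integrable_itvS fi _ _.
Qed.

Lemma racN a b f f' : rac a b f f' -> rac a b (fun x => - f x) (fun x => - f' x).
Proof.
by move=> h; apply: (rac_eq (racZ (-1) h)) => x _; rewrite mulN1r.
Qed.

Lemma racB a b f f' g g' : rac a b f f' -> rac a b g g' ->
  rac a b (fun x => f x - g x) (fun x => f' x - g' x).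
Proof. by move=> hf /racN hg; exact: racD. Qed.

Lemma rac_cst a b c : rac a b (fun=> c) (fun=> 0).
Proof.
split=> [|x _]; first exact: integrable0.
by rewrite Rintegral_cst // mul0r addr0.
Qed.

(* Telescoping over a uniform partition: an increment estimate of higher order
   than additive forces the function to be constant. *)
Lemma small_increments_cst a b (D P : R -> R) : a <= b ->
  (forall e : R, 0 < e -> exists2 d : R, 0 < d & forall s t, a <= s -> s <= t -> t <= b ->
     t - s < d -> `|D t - D s| <= e * (P t - P s)) -> D b = D a.
Proof.
move=> ab H.
have K e : 0 < e -> `|D b - D a| <= e * (P b - P a).
  move=> e0; have [d d0 Hd] := H e e0.
  have [n nd] : exists n : nat, (b - a) / d < n%:R.
    by exists (Num.bound ((b - a) / d)); rewrite archi_boundP // divr_ge0 ?subr_ge0 // ltW.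
  have n0 : 0 < n%:R :> R by rewrite (le_lt_trans _ nd) // divr_ge0 ?subr_ge0 // ltW.
  pose t (i : nat) := a + i%:R * ((b - a) / n%:R).
  have tS i : t i.+1 - t i = (b - a) / n%:R.
    by rewrite /t -natr1; ring.
  have h0 : 0 <= (b - a) / n%:R by rewrite divr_ge0 ?subr_ge0 // ltW.
  have ta i : a <= t i by rewrite /t lerDl mulr_ge0.
  have tn : t n = b.
    by rewrite /t; field; rewrite gt_eqF.
  have tle i : t i <= t i.+1 by rewrite -subr_ge0 tS.
  have tb i : (i <= n)%N -> t i <= b.
    move=> ni; rewrite -tn /t lerD2l ler_wpM2r // ler_nat //.
  have main i : (i <= n)%N -> `|D (t i) - D a| <= e * (P (t i) - P a).
    elim: i => [_|i IH ni].
      by rewrite /t mul0r addr0 !subrr normr0 mulr0.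
    have -> : D (t i.+1) - D a = (D (t i.+1) - D (t i)) + (D (t i) - D a) by ring.
    have -> : e * (P (t i.+1) - P a) = e * (P (t i.+1) - P (t i)) + e * (P (t i) - P a) by ring.
    apply: le_trans (ler_normD _ _) _; apply: lerD; last exact: IH (ltnW ni).
    apply: Hd => //; first exact: tb.
    by rewrite tS ltr_pdivrMr // mulrC -ltr_pdivrMr.
  by have := main n (leqnn n); rewrite tn.
apply/eqP; rewrite -subr_eq0 -normr_eq0 eq_le normr_ge0 andbT.
apply/ler_addgt0Pr => e e0; rewrite add0r.
have p0 : 0 < `|P b - P a| + 1 by rewrite ltr_wpDl.
apply: le_trans (K (e / (`|P b - P a| + 1)) _) _; first exact: divr_gt0.
rewrite -mulrA -[leRHS]mulr1 ler_wpM2l ?(ltW e0) //.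
rewrite mulrC ler_pdivrMr // mul1r.
by apply: le_trans (ler_norm _) _; rewrite lerDl.
Qed.

Lemma integral_small a b f (e : R) : mu.-integrable `[a, b] (EFin \o f) -> 0 < e ->
  exists2 d : R, 0 < d & forall s t, a <= s -> s <= t -> t <= b -> t - s < d ->
    \int[mu]_(x in `[s, t]) `|f x| < e.
Proof.
move=> fi e0.
have fi' : mu.-integrable setT (EFin \o (f \_ `[a, b])).
  by rewrite -restrict_EFin; apply/integrable_restrict => //; rewrite setTI.
have [d [d0 Hd]] := integral_normr_continuous fi' e0.
exists d => // s t as' st tb std.
have mst : (mu `[s, t] < d%:E)%E.
  rewrite lebesgue_measure_itv; case: ifP => _; last by rewrite lte_fin.
  by rewrite -EFinB lte_fin.
have := Hd [set` `[s, t]] (mitv _) mst; congr (_ < _).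
apply: eq_Rintegral => x /set_mem /=; rewrite in_itv /= => /andP[sx xt].
by rewrite patchE mem_set //= in_itv /= (le_trans as') //= (le_trans xt).
Qed.

Lemma bounded_integrableM a b f g : measurable_fun `[a, b] f ->
  (exists M, forall x, a <= x <= b -> `|f x| <= M) ->
  mu.-integrable `[a, b] (EFin \o g) ->
  mu.-integrable `[a, b] (EFin \o (fun x => f x * g x)).
Proof.
move=> mf [M fM] gi.
have bf : [bounded f x | x in `[a, b]].
  exists M; split; first exact: num_real.
  move=> M' MM' x /=; rewrite in_itv /= => xab.
  exact: le_trans (fM x xab) (ltW MM').
have := integrableMr (mitv _) mf bf gi.
by apply: eq_integrable => // x _; rewrite /= EFinM.
Qed.

Lemma continuous_itv_bounded a b f : {within `[a, b], continuous f} ->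
  exists M, forall x, a <= x <= b -> `|f x| <= M.
Proof.
move=> cf.
have /compact_bounded[M [_ HM]] := continuous_compact cf (segment_compact (a:=a) (b:=b)).
exists (M + 1) => x xab; apply: (HM (M + 1)); first by rewrite ltrDl.
by exists x => //=; rewrite in_itv.
Qed.

Lemma continuous_integrableM a b f g : {within `[a, b], continuous f} ->
  mu.-integrable `[a, b] (EFin \o g) ->
  mu.-integrable `[a, b] (EFin \o (fun x => f x * g x)).
Proof.
move=> cf gi; apply: bounded_integrableM gi; last exact: continuous_itv_bounded.
by apply: subspace_continuous_measurable_fun.
Qed.

(** The product minus the integral of its expected derivative has increments over [[s, t]] bounded
    by twice the product of the integrals of [|f'|] and [|g'|]. On short intervals the second factor
    is small, so [small_increments_cst] applies with the primitive of [|f'|] as comparison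
    function. *)
Lemma racM a b f f' g g' : rac a b f f' -> rac a b g g' ->
  rac a b (fun x => f x * g x) (fun x => f' x * g x + f x * g' x).
Proof.
have [ab|ba] := leP a b; last first.
  move=> _ _; split; last by move=> x /andP[ax xb]; move: (le_trans ax xb); rewrite leNgt ba.
  by rewrite set_itv_ge ?bnd_simp -?ltNge //; exact: integrable_set0.
move=> hf hg.
have cf := rac_continuous ab hf; have cg := rac_continuous ab hg.
have i1 : mu.-integrable `[a, b] (EFin \o (fun x => f' x * g x)).
  case: hf => fi _; have := continuous_integrableM cg fi.
  by apply: eq_integrable => // x _; rewrite /= mulrC.
have i2 : mu.-integrable `[a, b] (EFin \o (fun x => f x * g' x)).
  by case: hg => gi _; exact: continuous_integrableM.
have i12 : mu.-integrable `[a, b] (EFin \o (fun x => f' x * g x + f x * g' x)).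
  have := integrableD (mitv _) i1 i2.
  by apply: eq_integrable => // x _; rewrite /= EFinD.
split => // y /andP[ay yb].
have rh : rac a y (fun x => \int[mu]_(t in `[a, x]) (f' t * g t + f t * g' t))
     (fun x => f' x * g x + f x * g' x).
  split; first exact: integrable_itvS i12 _ _.
  by move=> x _; rewrite set_itv1 Rintegral_set1 add0r.
pose D x := f x * g x - \int[mu]_(t in `[a, x]) (f' t * g t + f t * g' t).
suff : D y = D a.
  by rewrite /D set_itv1 Rintegral_set1 subr0 => /eqP; rewrite subr_eq => /eqP.
pose P x := \int[mu]_(t in `[a, x]) `|f' t|.
apply: (@small_increments_cst a y D P) => // e e0.
have [gi _] := hg; have [fi _] := hf.
have [d d0 Hd] := integral_small gi (divr_gt0 e0 (ltr0n _ 2)).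
exists d => // s t as' st ty ts.
have tb := le_trans ty yb.
have fis := integrable_itvS fi as' tb; have gis := integrable_itvS gi as' tb.
have i1s := integrable_itvS i1 as' tb; have i2s := integrable_itvS i2 as' tb.
have afi : mu.-integrable `[s, t] (EFin \o (fun x => `|f' x|)) by exact: integrable_norm.
have agi : mu.-integrable `[s, t] (EFin \o (fun x => `|g' x|)) by exact: integrable_norm.
have -> : P t - P s = \int[mu]_(x in `[s, t]) `|f' x|.
  apply: (@rac_sub a y) => //; split; first exact: integrable_norm (integrable_itvS fi _ _).
  by move=> x _; rewrite /P set_itv1 Rintegral_set1 add0r.
(* The increment of [f g] is written with the weights [g t] for [f'] and [f s] for [g']; only the
   deviations of [g] and [f] from these values remain. *)
have -> : D t - D s = \int[mu]_(x in `[s, t]) (f' x * (g t - g x)) +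
                      \int[mu]_(x in `[s, t]) ((f s - f x) * g' x).
  have e1 : \int[mu]_(x in `[s, t]) (f' x * (g t - g x)) =
      (f t - f s) * g t - \int[mu]_(x in `[s, t]) (f' x * g x).
    rewrite (rac_sub hf) // -RintegralZr // -RintegralB //; last first.
      by have := integrableZr (mitv _) (g t) fis; apply: eq_integrable => // x _; rewrite /= EFinM.
    by apply: eq_Rintegral => x _; rewrite mulrBr.
  have e2 : \int[mu]_(x in `[s, t]) ((f s - f x) * g' x) =
      f s * (g t - g s) - \int[mu]_(x in `[s, t]) (f x * g' x).
    rewrite (rac_sub hg) // -RintegralZl // -RintegralB //; last first.
      by have := integrableZl (mitv _) (f s) gis; apply: eq_integrable => // x _; rewrite /= EFinM.
    by apply: eq_Rintegral => x _; rewrite mulrBl.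
  have e3 := rac_sub rh as' st ty.
  rewrite e1 e2 /D; move: e3; rewrite [X in _ = X -> _](RintegralD _ i1s i2s) // => e3.
  have -> : f t * g t - \int[mu]_(t0 in `[a, t]) (f' t0 * g t0 + f t0 * g' t0) -
   (f s * g s - \int[mu]_(t0 in `[a, s]) (f' t0 * g t0 + f t0 * g' t0)) =
   f t * g t - f s * g s - (\int[mu]_(t0 in `[a, t]) (f' t0 * g t0 + f t0 * g' t0) -
      \int[mu]_(t0 in `[a, s]) (f' t0 * g t0 + f t0 * g' t0)) by ring.
  by rewrite e3; ring.
have Gs : \int[mu]_(x in `[s, t]) `|g' x| < e / 2 by apply: Hd.
have F0 : 0 <= \int[mu]_(x in `[s, t]) `|f' x| by apply: Rintegral_ge0.
have G0 : 0 <= \int[mu]_(x in `[s, t]) `|g' x| by apply: Rintegral_ge0.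
have incr h h' x1 x2 : rac a b h h' -> s <= x1 -> x1 <= x2 -> x2 <= t ->
    `|h x2 - h x1| <= \int[mu]_(x in `[s, t]) `|h' x|.
  move=> hh sx xx xt.
  have hi : mu.-integrable `[s, t] (EFin \o h').
    by case: hh => hi _; exact: integrable_itvS hi _ _.
  rewrite (rac_sub hh) //; [|exact: le_trans as' sx|exact: le_trans xt tb].
  apply: le_trans (le_normr_Rintegral _ _) _ => //; first exact: integrable_itvS hi _ _.
  apply: fine_le.
  - by apply: integrable_fin_num => //; apply: integrable_norm; exact: integrable_itvS hi _ _.
  - by apply: integrable_fin_num => //; apply: integrable_norm.
  - apply: ge0_subset_integral => //.
    + apply/measurable_EFinP; apply: measurableT_comp => //.
      by apply/measurable_EFinP; exact: measurable_int hi.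
    + by apply: subset_itv; rewrite bnd_simp.
apply: le_trans (ler_normD _ _) _.
have -> : e * \int[mu]_(x in `[s, t]) `|f' x| =
  (e / 2) * \int[mu]_(x in `[s, t]) `|f' x| + (e / 2) * \int[mu]_(x in `[s, t]) `|f' x|.
  by field.
have j1 : mu.-integrable `[s, t] (EFin \o (fun x => f' x * (g t - g x))).
  have := integrableB (mitv _) (integrableZl (mitv _) (g t) fis) i1s.
  apply: eq_integrable => // x _ /=; rewrite -EFinM -EFinB; congr EFin; ring.
have j2 : mu.-integrable `[s, t] (EFin \o (fun x => (f s - f x) * g' x)).
  have := integrableB (mitv _) (integrableZl (mitv _) (f s) gis) i2s.
  apply: eq_integrable => // x _ /=; rewrite -EFinM -EFinB; congr EFin; ring.
apply: lerD.
  apply: le_trans (le_normr_Rintegral _ j1) _ => //.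
  rewrite -RintegralZl //; apply: le_Rintegral => //.
  - exact: (@integrable_norm _ _ _ mu _ (fun x => f' x * (g t - g x))).
  - have := integrableZl (mitv _) (e / 2) afi.
    by apply: eq_integrable => // x _; rewrite /= EFinM.
  - move=> x /=; rewrite in_itv /= => /andP[sx xt].
    rewrite normrM mulrC ler_wpM2r //.
    exact: le_trans (incr _ _ x t hg sx xt (lexx t)) (ltW Gs).
apply: le_trans (le_normr_Rintegral _ j2) _ => //.
apply: le_trans (_ : \int[mu]_(x in `[s, t]) (\int[mu]_(x in `[s, t]) `|f' x| * `|g' x|) <= _).
  apply: le_Rintegral => //.
  - exact: (@integrable_norm _ _ _ mu _ (fun x => (f s - f x) * g' x)).
  - have := integrableZl (mitv _) (\int[mu]_(x in `[s, t]) `|f' x|) agi.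
    by apply: eq_integrable => // x _; rewrite /= EFinM.
  - move=> x /=; rewrite in_itv /= => /andP[sx xt].
    rewrite normrM ler_wpM2r // distrC.
    exact: incr hf _ _ _.
rewrite RintegralZl // mulrC ler_wpM2r //; exact: ltW.
Qed.

End AbsolutelyContinuous.

(** * Classical derivatives of absolutely continuous functions *)

Section Calculus.
Context {R : realType}.
Notation mu := (@lebesgue_measure R).
Implicit Types (a b x y : R) (f g : R -> R).

Lemma rac_derive a b f f' :
  (forall x, a <= x <= b -> is_derive x 1 f (f' x)) ->
  {within `[a, b], continuous f'} -> rac a b f f'.
Proof.
move=> df cf'; split.
  by apply: continuous_compact_integrable => //; exact: segment_compact.
move=> y /andP[ay yb].
have [->|ay'] := eqVneq y a; first by rewrite set_itv1 Rintegral_set1 addr0.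
have {ay'} ay' : a < y by rewrite lt_neqAle eq_sym ay' ay.
have dcf x : a <= x <= b -> {for x, continuous f}.
  move=> xab; have [dx _] := df x xab.
  by apply/differentiable_continuous; exact/derivable1_diffP.
rewrite /Rintegral (@continuous_FTC2 _ f' f) //.
- by rewrite -EFinB /= addrC subrK.
- apply: continuous_subspaceW cf'.
  by apply: subset_itv; rewrite bnd_simp.
- split.
  + move=> x; rewrite in_itv /= => /andP[ax xy].
    have xab : a <= x <= b by rewrite (ltW ax) (le_trans (ltW xy)).
    by have [] := df x xab.
  + by apply/cvg_at_right_filter/dcf; rewrite lexx (le_trans ay).
  + by apply/cvg_at_left_filter/dcf; rewrite ay.
- move=> x; rewrite in_itv /= => /andP[ax xy]; rewrite derive1E.
  have xab : a <= x <= b by rewrite (ltW ax) (le_trans (ltW xy)).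
  by have [] := df x xab.
Qed.

(** The way back from primitives to pointwise derivatives, in which [cderiv] is expressed. It
    applies to solutions because their first derivative is itself absolutely continuous. *)
Lemma rac_derivable a b f f' x : rac a b f f' -> a < x -> x < b ->
  {for x, continuous f'} -> is_derive x 1 f (f' x).
Proof.
move=> [fi ff] ax xb cf'.
have [d1 d2] := continuous_FTC1_closed xb fi ax cf'.
have h : is_derive x 1 (fun y => f a + \int[mu]_(t in `[a, y]) f' t) (f' x).
  have h0 : is_derive x 1 (fun y => \int[mu]_(t in `[a, y]) f' t) (f' x).
    by apply: DeriveDef; [exact: d1|rewrite -derive1E].
  by have := is_deriveD (is_derive_cst (f a) x 1) h0; rewrite add0r.
apply: (@near_eq_is_derive _ _ _ (fun y => f a + \int[mu]_(t in `[a, y]) f' t)) => //.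
near=> y; rewrite -ff //.
apply/andP; split; apply: ltW; near: y; [exact: lt_nbhsr|exact: lt_nbhsl].
Unshelve. all: by end_near. Qed.

Lemma rac_X a b f f' n : rac a b f f' ->
  rac a b (fun x => f x ^+ n.+1) (fun x => n.+1%:R * (f x ^+ n * f' x)).
Proof.
move=> hf; elim: n => [|n IH].
  apply: (rac_eq hf) => x _; first by rewrite expr1.
  by rewrite expr0 !mul1r.
apply: (rac_eq (racM hf IH)) => x _; first by rewrite [RHS]exprS.
by rewrite -[in RHS]natr1 (exprS _ n); ring.
Qed.

End Calculus.

(** * Complex-valued absolutely continuous functions and the exponential *)

Section ComplexAbsolutelyContinuous.
Context {R : realType}.
Notation mu := (@lebesgue_measure R).
Implicit Types (a b x y : R) (f g : R -> R[i]) (w z : R[i]).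

Lemma cReM w z : Re (w * z) = Re w * Re z - Im w * Im z.
Proof. by case: w; case: z. Qed.

Lemma cImM w z : Im (w * z) = Re w * Im z + Im w * Re z.
Proof. by case: w => a b; case: z => c d /=; rewrite [b * c]mulrC addrC. Qed.

Lemma cReD w z : Re (w + z) = Re w + Re z.
Proof. by case: w; case: z. Qed.

Lemma cImD w z : Im (w + z) = Im w + Im z.
Proof. by case: w; case: z. Qed.

Lemma cReN w : Re (- w) = - Re w.
Proof. by case: w. Qed.

Lemma cImN w : Im (- w) = - Im w.
Proof. by case: w. Qed.

Lemma cReC (c : R) : Re c%:C = c.
Proof. by []. Qed.

Lemma cImC (c : R) : Im c%:C = 0.
Proof. by []. Qed.

Lemma cReJ w : Re (conjc w) = Re w.
Proof. by case: w. Qed.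

Lemma cImJ w : Im (conjc w) = - Im w.
Proof. by case: w. Qed.

Definition cparts := (cReM, cImM, cReD, cImD, cReN, cImN, cReC, cImC, cReJ, cImJ).

Lemma complexP w z : Re w = Re z -> Im w = Im z -> w = z.
Proof. by case: w => a b; case: z => c d /= -> ->. Qed.

Lemma normc_sqr w : normc w ^+ 2 = Re w ^+ 2 + Im w ^+ 2.
Proof. by case: w => a b; rewrite /normc sqr_sqrtr // addr_ge0 // sqr_ge0. Qed.

Lemma normc_ge0 w : 0 <= normc w.
Proof. by case: w => a b; exact: sqrtr_ge0. Qed.

Lemma normc_ge_absRe w : `|Re w| <= normc w.
Proof.
rewrite -(ler_pXn2r (n := 2)) ?nnegrE ?normc_ge0 // normc_sqr.
by rewrite real_normK ?num_real // lerDl sqr_ge0.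
Qed.

Lemma normc_ge_absIm w : `|Im w| <= normc w.
Proof.
rewrite -(ler_pXn2r (n := 2)) ?nnegrE ?normc_ge0 // normc_sqr.
by rewrite real_normK ?num_real // lerDr sqr_ge0.
Qed.

Lemma normc_le_parts w : normc w <= `|Re w| + `|Im w|.
Proof.
rewrite -(ler_pXn2r (n := 2)) ?nnegrE ?normc_ge0 ?addr_ge0 // normc_sqr.
rewrite sqrrD !real_normK ?num_real // lerD2r lerDl.
by rewrite mulrn_wge0 // mulr_ge0.
Qed.

Lemma normcC (c : R) : normc c%:C = `|c|.
Proof. by rewrite /normc /= expr0n /= addr0 sqrtr_sqr. Qed.

Lemma normc_conjc w : normc (conjc w) = normc w.
Proof. by case: w => a b; rewrite /normc /= sqrrN. Qed.

Lemma normc_gt0 w : (0 < normc w) = (w != 0).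
Proof.
rewrite lt_neqAle normc_ge0 andbT eq_sym; congr (~~ _).
by apply/eqP/eqP => [/eq0_normc //|->]; rewrite normc0.
Qed.

Lemma le_normcB w z : normc (w - z) <= normc w + normc z.
Proof. by apply: le_trans (le_normcD _ _) _; rewrite normcN. Qed.

Lemma ler_subnormc w z : normc w - normc z <= normc (w - z).
Proof. by rewrite lerBlDr (le_trans _ (le_normcD _ _)) // subrK. Qed.

Definition cac a b f f' :=
  rac a b (fun x => Re (f x)) (fun x => Re (f' x)) /\
  rac a b (fun x => Im (f x)) (fun x => Im (f' x)).

Lemma cacW a b f f' x y : cac a b f f' -> a <= x -> y <= b -> cac x y f f'.
Proof. by move=> [h1 h2] ax yb; split; [exact: racW h1 _ _|exact: racW h2 _ _]. Qed.

Lemma cac_eq a b f f' g g' : cac a b f f' ->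
  (forall x, a <= x <= b -> f x = g x) ->
  (forall x, a <= x <= b -> f' x = g' x) -> cac a b g g'.
Proof.
by move=> [h1 h2] fg fg'; split; [apply: (rac_eq h1)|apply: (rac_eq h2)] => x xab;
  rewrite ?fg ?fg'.
Qed.

Lemma cacD a b f f' g g' : cac a b f f' -> cac a b g g' ->
  cac a b (fun x => f x + g x) (fun x => f' x + g' x).
Proof.
move=> [f1 f2] [g1 g2]; split.
  by apply: (rac_eq (racD f1 g1)) => x _; rewrite cReD.
by apply: (rac_eq (racD f2 g2)) => x _; rewrite cImD.
Qed.

Lemma cacM a b f f' g g' : cac a b f f' -> cac a b g g' ->
  cac a b (fun x => f x * g x) (fun x => f' x * g x + f x * g' x).
Proof.
move=> [f1 f2] [g1 g2]; split.
  apply: (rac_eq (racB (racM f1 g1) (racM f2 g2))) => x _; rewrite !cparts //; ring.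
apply: (rac_eq (racD (racM f1 g2) (racM f2 g1))) => x _; rewrite !cparts //; ring.
Qed.

Lemma cac_cst a b w : cac a b (fun=> w) (fun=> 0).
Proof. by split; exact: rac_cst. Qed.

Lemma cacZ a b f f' w : cac a b f f' ->
  cac a b (fun x => w * f x) (fun x => w * f' x).
Proof.
by move=> h; apply: (cac_eq (cacM (cac_cst a b w) h)) => // x _; rewrite mul0r add0r.
Qed.

Lemma cacN a b f f' : cac a b f f' ->
  cac a b (fun x => - f x) (fun x => - f' x).
Proof. by move=> h; apply: (cac_eq (cacZ (-1) h)) => x _; rewrite mulN1r. Qed.

Lemma cacB a b f f' g g' : cac a b f f' -> cac a b g g' ->
  cac a b (fun x => f x - g x) (fun x => f' x - g' x).
Proof. by move=> hf /cacN hg; exact: cacD. Qed.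

Lemma cacJ a b f f' : cac a b f f' ->
  cac a b (fun x => conjc (f x)) (fun x => conjc (f' x)).
Proof.
move=> [h1 h2]; split; first by apply: (rac_eq h1) => x _; rewrite cReJ.
by apply: (rac_eq (racN h2)) => x _; rewrite cImJ.
Qed.

Lemma cac_real a b (f f' : R -> R) : rac a b f f' ->
  cac a b (fun x => (f x)%:C) (fun x => (f' x)%:C).
Proof. by move=> h; split => //; exact: rac_cst. Qed.

Lemma cac_sub a b f f' x y : cac a b f f' -> a <= x -> x <= y -> y <= b ->
  f y - f x = cintegral `[x, y] f'.
Proof.
move=> [h1 h2] ax xy yb; apply: complexP.
  by rewrite !cparts /= (rac_sub h1).
by rewrite !cparts /= (rac_sub h2).
Qed.

Lemma cac_integrable a b f f' : cac a b f f' -> cintegrable `[a, b] f'.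
Proof. by move=> [[h1 _] [h2 _]]. Qed.

Lemma cintegrable_itvS a b x y f : cintegrable `[a, b] f ->
  a <= x -> y <= b -> cintegrable `[x, y] f.
Proof.
by move=> [h1 h2] ax yb; split; [exact: integrable_itvS h1 _ _|exact: integrable_itvS h2 _ _].
Qed.

Lemma cac_primitive a b f f' : cintegrable `[a, b] f' ->
  (forall x, a <= x <= b -> f x = f a + cintegral `[a, x] f') -> cac a b f f'.
Proof. by move=> [h1 h2] ff; split; split => // x xab; rewrite ff // !cparts. Qed.

(** The factor 2 comes from bounding the real and the imaginary part separately. It only affects
    constants that are never made sharp. *)
Lemma normc_cintegral_le D f (g : R -> R) : measurable (D : set (measurableTypeR R)) ->
  cintegrable D f -> mu.-integrable D (EFin \o g) ->
  (forall x, D x -> normc (f x) <= g x) ->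
  normc (cintegral D f) <= 2 * \int[mu]_(x in D) g x.
Proof.
move=> mD [f1 f2] gi fg.
have f1' : mu.-integrable D (EFin \o (fun x => Re (f x))) by [].
have f2' : mu.-integrable D (EFin \o (fun x => Im (f x))) by [].
apply: le_trans (normc_le_parts _) _ => /=.
rewrite mulr_natl mulr2n; apply: lerD.
  apply: le_trans (le_normr_Rintegral mD f1) _.
  apply: le_Rintegral => //; first exact: integrable_norm f1'.
  by move=> x Dx; exact: le_trans (normc_ge_absRe _) (fg x Dx).
apply: le_trans (le_normr_Rintegral mD f2) _.
apply: le_Rintegral => //; first exact: integrable_norm f2'.
by move=> x Dx; exact: le_trans (normc_ge_absIm _) (fg x Dx).
Qed.

Lemma cexpD w z : cexp (w + z) = cexp w * cexp z.
Proof.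
by rewrite /cexp cReD cImD expRD cosD sinD; apply: complexP => /=; ring.
Qed.

Lemma cexp0 : cexp 0 = 1 :> R[i].
Proof. by rewrite /cexp /= expR0 cos0 sin0 mul1r mulr0. Qed.

Lemma normc_cexp w : normc (cexp w) = expR (Re w).
Proof.
rewrite /normc /cexp !exprMn -mulrDr cos2Dsin2 mulr1 sqrtr_sqr gtr0_norm //.
exact: expR_gt0.
Qed.

Lemma cac_cexp a b w : cac a b (fun x => cexp (x%:C * w)) (fun x => w * cexp (x%:C * w)).
Proof.
have e1 x : Re (x%:C * w) = x * Re w by rewrite !cparts mul0r subr0.
have e2 x : Im (x%:C * w) = x * Im w by rewrite !cparts mul0r addr0.
have cE (h : R -> R) : continuous h -> {within `[a, b], continuous h}.
  by move=> ch; exact: continuous_subspaceT.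
have c1 (c : R) : continuous (fun x : R => x * c).
  by move=> x; apply: cvgM; [exact: cvg_id|exact: cvg_cst].
have ce : continuous (fun x => expR (x * Re w)).
  by move=> x; apply: continuous_comp; [exact: c1|exact: continuous_expR].
have cc : continuous (fun x => cos (x * Im w)).
  by move=> x; apply: continuous_comp; [exact: c1|exact: continuous_cos].
have cs : continuous (fun x => sin (x * Im w)).
  by move=> x; apply: continuous_comp; [exact: c1|exact: continuous_sin].
split; apply: rac_derive.
- move=> x _; rewrite /cexp /=.
  under eq_fun do rewrite e1 e2.
  apply: is_derive_eq; rewrite cReM /= e1 e2 /GRing.scale /=; ring.
- apply: cE; rewrite /cexp; under eq_fun do rewrite cReM /= e1 e2.
  by move=> x; apply: cvgB; apply: cvgM; try exact: cvg_cst; apply: cvgM;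
    [exact: ce|exact: cc|exact: ce|exact: cs].
- move=> x _; rewrite /cexp /=.
  under eq_fun do rewrite e1 e2.
  apply: is_derive_eq; rewrite cImM /= e1 e2 /GRing.scale /=; ring.
- apply: cE; rewrite /cexp; under eq_fun do rewrite cImM /= e1 e2.
  by move=> x; apply: cvgD; apply: cvgM; try exact: cvg_cst; apply: cvgM;
    [exact: ce|exact: cs|exact: ce|exact: cc].
Qed.

End ComplexAbsolutelyContinuous.

(** * Picard iteration *)

Section ParametricIntegral.
Context d (X : measurableType d) d' (Y : measurableType d') (R : realType).
Variable nu : {sigma_finite_measure set Y -> \bar R}.

Lemma measurable_Rintegral_param (f : X * Y -> R) : measurable_fun setT f ->
  measurable_fun setT (fun x => \int[nu]_y f (x, y)).
Proof.
move=> mf.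
have mg : measurable_fun setT (EFin \o f) by exact/measurable_EFinP.
apply: (measurableT_comp (f := fine)) => //.
have -> : (fun x => \int[nu]_y (f (x, y))%:E)%E =
   ((fun x => \int[nu]_y ((EFin \o f)^\+%E (x, y))) \-
    (fun x => \int[nu]_y ((EFin \o f)^\-%E (x, y))))%E.
  by apply/funext => x; rewrite [LHS]integralE /=; congr (_ - _)%E;
    apply: eq_integral => y _; rewrite ?funeposE ?funenegE.
apply: emeasurable_funB.
  by apply: (measurable_fun_fubini_tonelli_F (m2 := nu)) => //; exact: measurable_funepos.
by apply: (measurable_fun_fubini_tonelli_F (m2 := nu)) => //; exact: measurable_funeneg.
Qed.

End ParametricIntegral.

Section ParametricProductIntegral.
Context d (X : measurableType d) (R : realType).
Context d1 d2 (Y : measurableType d1) (Z : measurableType d2).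
Variables (m1 : {sigma_finite_measure set Y -> \bar R})
  (m2 : {sigma_finite_measure set Z -> \bar R}).

(** Tonelli turns the product integral of a nonnegative function into two iterated ones, and each of
    these is measurable in the remaining variables; the general case follows by splitting into
    positive and negative parts. *)
Lemma measurable_Rintegral_param_prod (f : X * (Y * Z) -> R) :
  measurable_fun setT f ->
  measurable_fun setT (fun x => \int[(m1 \x m2)%E]_p f (x, p)).
Proof.
move=> mf.
have mg : measurable_fun setT (EFin \o f) by exact/measurable_EFinP.
have key (h : X * (Y * Z) -> \bar R) : measurable_fun setT h -> (forall p, 0 <= h p)%E ->
    measurable_fun setT (fun x => \int[(m1 \x m2)%E]_p h (x, p))%E.
  move=> mh h0.
  have -> : (fun x => \int[(m1 \x m2)%E]_p h (x, p))%E =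
      (fun x => \int[m1]_y \int[m2]_z h (x, (y, z)))%E.
    apply/funext => x; rewrite (fubini_tonelli1 (fun p => h (x, p))) //.
    exact: (measurable_fun_pair2 _ mh).
  have m_inner : measurable_fun setT (fun xy : X * Y => \int[m2]_z h (xy.1, (xy.2, z)))%E.
    apply: (measurable_fun_fubini_tonelli_F (m2 := m2)
      (fun w : (X * Y) * Z => h (w.1.1, (w.1.2, w.2)))) => //.
    apply: (measurableT_comp mh).
    apply: measurable_fun_pair; first exact: measurableT_comp.
    by apply: measurable_fun_pair => //; exact: measurableT_comp.
  apply: (measurable_fun_fubini_tonelli_F (m2 := m1)
    (fun xy : X * Y => \int[m2]_z h (xy.1, (xy.2, z)))%E) => //.
  by move=> xy; apply: integral_ge0.
apply: (measurableT_comp (f := fine)) => //.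
have -> : (fun x => \int[(m1 \x m2)%E]_p (f (x, p))%:E)%E =
   ((fun x => \int[(m1 \x m2)%E]_p ((EFin \o f)^\+%E (x, p))) \-
    (fun x => \int[(m1 \x m2)%E]_p ((EFin \o f)^\-%E (x, p))))%E.
  by apply/funext => x; rewrite [LHS]integralE /=; congr (_ - _)%E;
    apply: eq_integral => p _; rewrite ?funeposE ?funenegE.
by apply: emeasurable_funB; apply: key => //; [exact: measurable_funepos|exact: measurable_funeneg].
Qed.

End ParametricProductIntegral.

(** * Reflections and shifts of the Lebesgue integral *)

Section AffineSubstitution.
Context {R : realType}.
Notation mu := (@lebesgue_measure R).

Lemma measurable_affine (c : R) :
  measurable_fun [set: measurableTypeR R] (fun x : measurableTypeR R => c - x : measurableTypeR R).
Proof. by apply: measurable_funB => //. Qed.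

(** By uniqueness of the measure it suffices to look at half-open intervals. Reflection moves the
    closed end to the other side but keeps the length. *)
Lemma lebesgue_measure_reflect (c : R) (A : set (measurableTypeR R)) : measurable A ->
  pushforward mu (fun x : measurableTypeR R => c - x : measurableTypeR R) A = mu A.
Proof.
move=> mA; apply/esym.
pose nu : {measure set (measurableTypeR R) -> \bar R} :=
  pushforward mu (fun x : measurableTypeR R => c - x : measurableTypeR R).
apply: (@lebesgue_measure_unique R (nu (measurable_affine c))) => //= _ [[a b]] _ <-.
have e : (fun x : R => c - x) @^-1` `]a, b] = `[c - b, c - a[%classic.
  apply/seteqP; split => x /=; rewrite !in_itv /=; lra.
rewrite /nu /pushforward /= e !lebesgue_measure_itv /= !lte_fin.
rewrite ltrD2l ltrN2; case: ifPn => // _.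
by rewrite -!EFinB; congr EFin; ring.
Qed.

Lemma ge0_integral_reflect (c : R) (f : R -> \bar R) : measurable_fun setT f ->
  (forall x, 0 <= f x)%E ->
  (\int[mu]_x f (c - x)%R = \int[mu]_x f x)%E.
Proof.
move=> mf f0.
have := @ge0_integral_pushforward _ _ _ _ R _ (measurable_affine c) mu setT f measurableT mf.
move=> /(_ (fun x _ => f0 x)); rewrite preimage_setT => <-.
apply: eq_measure_integral => [|m A mA _]; first exact: measurable_affine.
exact: lebesgue_measure_reflect.
Qed.

Lemma integral_reflect (c : R) (f : R -> \bar R) : measurable_fun setT f ->
  (\int[mu]_x f (c - x)%R = \int[mu]_x f x)%E.
Proof.
move=> mf; rewrite integralE [RHS]integralE.
have e1 : ((fun x => f (c - x)%R) ^\+ = fun x => f^\+ (c - x)%R)%E.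
  by apply/funext => x; rewrite ?funeposE ?funenegE.
have e2 : ((fun x => f (c - x)%R) ^\- = fun x => f^\- (c - x)%R)%E.
  by apply/funext => x; rewrite ?funeposE ?funenegE.
rewrite e1 e2 !ge0_integral_reflect //.
- exact: measurable_funeneg.
- exact: measurable_funepos.
Qed.

Lemma Rintegral_reflect (c : R) (f : R -> R) : measurable_fun setT f ->
  \int[mu]_x f (c - x) = \int[mu]_x f x.
Proof.
move=> mf; rewrite /Rintegral (@integral_reflect c (EFin \o f)) //.
exact/measurable_EFinP.
Qed.

(* A shift is the composition of two reflections. *)
Lemma ge0_integral_shift (c : R) (f : R -> \bar R) : measurable_fun setT f ->
  (forall x, 0 <= f x)%E ->
  (\int[mu]_x f (x - c)%R = \int[mu]_x f x)%E.
Proof.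
move=> mf f0; rewrite -(@ge0_integral_reflect 0 f) // -(@ge0_integral_reflect c (fun x => f (0 - x))) //.
  by apply: eq_integral => x _; congr f; ring.
by apply: measurableT_comp => //; exact: measurable_affine.
Qed.

End AffineSubstitution.

Lemma cvgn_sum (R : realType) (J : Type) (s : seq J) (F : J -> nat -> R) (l : J -> R) :
  (forall j, F j n @[n --> \oo] --> l j) ->
  \sum_(j <- s) F j n @[n --> \oo] --> \sum_(j <- s) l j.
Proof.
move=> Fl; elim: s => [|j s IH].
  by rewrite big_nil; under eq_fun do rewrite big_nil; exact: cvg_cst.
by rewrite big_cons; under eq_fun do rewrite big_cons; exact: cvgD.
Qed.

(** * Neumann series for a system of integral equations *)

Section Picard.
Context d (X : measurableType d) (R : realType).
Variable nu : {measure set X -> \bar R}.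
(* This follows from sigma-finiteness; but the library equips a product measure
   with a sigma-finite structure only when its factors are subprobabilities. *)
Hypothesis measurable_param : forall h : X * X -> R, measurable_fun setT h ->
  measurable_fun setT (fun x => \int[nu]_y h (x, y)).
Variable I : finType.
Variables (N : I -> I -> X * X -> R) (f0 : I -> X -> R) (M : nat -> X -> R).
Hypothesis mN : forall i j, measurable_fun setT (N i j).
Hypothesis mf0 : forall i, measurable_fun setT (f0 i).
Hypothesis mM : forall n, measurable_fun setT (M n).
Hypothesis M_ge0 : forall n x, 0 <= M n x.
Hypothesis f0M : forall i x, `|f0 i x| <= M 0 x.
Hypothesis NM : forall n i x,
  (\sum_j \int[nu]_y (`|N i j (x, y)| * M n y)%:E <= (M n.+1 x)%:E)%E.
Hypothesis M_summable : forall x, cvgn (series (fun n => M n x)).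

Let S x := limn (series (fun n => M n x)).

(** The terms of the Neumann series, not its partial sums: the [n]-th one is the integral operator
    applied [n] times to [f0]. *)
Fixpoint picard_iterate n : I -> X -> R :=
  if n is n'.+1 then
    fun i x => \sum_j \int[nu]_y (N i j (x, y) * picard_iterate n' j y)
  else f0.

Let fn := picard_iterate.

Let measurable_NM (h : X -> R) i j x : measurable_fun setT h ->
  measurable_fun setT (fun y => N i j (x, y) * h y).
Proof.
move=> mh; apply: measurable_funM => //.
exact: (measurable_fun_pair2 _ (mN i j)).
Qed.

Let mfn n i : measurable_fun setT (fn n i).
Proof.
elim: n i => [|n IH] i /=; first exact: mf0.
apply: measurable_sum => j.
apply: (@measurable_param (fun xy => N i j xy * fn n j xy.2)).
apply: measurable_funM => //.
exact: measurableT_comp (IH j) measurable_snd.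
Qed.

Let NMj n i j x : (\int[nu]_y (`|N i j (x, y)| * M n y)%:E <= (M n.+1 x)%:E)%E.
Proof.
apply: le_trans (NM n i x); rewrite (bigD1 j) //= leeDl //.
apply: sume_ge0 => k _; apply: integral_ge0 => y _.
by rewrite lee_fin mulr_ge0.
Qed.

Let mNM n i j x : measurable_fun setT (fun y => `|N i j (x, y)| * M n y).
Proof.
apply: measurable_funM => //; apply: measurableT_comp => //.
exact: (measurable_fun_pair2 _ (mN i j)).
Qed.

Let NM_integrable n i j x :
  nu.-integrable setT (fun y => (`|N i j (x, y)| * M n y)%:E).
Proof.
apply/integrableP; split; first exact/measurable_EFinP.
under eq_integral => y _ do rewrite gee0_abs ?lee_fin ?mulr_ge0 //.
exact: le_lt_trans (NMj n i j x) (ltry _).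
Qed.

Let fnM n i x : `|fn n i x| <= M n x.
Proof.
elim: n i x => [|n IH] i x /=; first exact: f0M.
rewrite -lee_fin; apply: le_trans (NM n i x).
apply: le_trans (_ : (\sum_j `|\int[nu]_y (N i j (x, y) * fn n j y)|%:E <= _)%E).
  by rewrite sumEFin lee_fin ler_norm_sum.
apply: lee_sum => j _.
have int1 : nu.-integrable setT (EFin \o (fun y => N i j (x, y) * fn n j y)).
  apply: le_integrable (NM_integrable n i j x) => //.
    by apply/measurable_EFinP; exact: measurable_NM.
  move=> y _ /=; rewrite lee_fin !normrM normr_id ler_wpM2l //.
  by rewrite (le_trans (IH j y)) // ler_norm.
rewrite EFin_normr_Rintegral //.
apply: le_trans (le_abse_integral _ _ _) _ => //; first exact: measurable_int int1.
apply: ge0_le_integral => //.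
- by apply: measurableT_comp => //; exact: measurable_int int1.
- exact/measurable_EFinP.
- by move=> y _; rewrite /= lee_fin normrM ler_wpM2l.
Qed.

Let cvg_fn i x : cvgn (series (fun n => fn n i x)).
Proof.
apply: normed_cvg; apply: (@series_le_cvg _ (fun n => `|fn n i x|) (fun n => M n x)) => //.
Qed.

Let partial_le i x n : `|series (fun n => fn n i x) n| <= S x.
Proof.
apply: le_trans (_ : series (fun n => M n x) n <= _).
  by apply: le_trans (ler_norm_sum _ _ _) _; apply: ler_sum => k _; exact: fnM.
apply: nondecreasing_cvgn_le => //.
by apply: nondecreasing_series => k _ _.
Qed.

Let mS : measurable_fun setT S.
Proof.
apply: (@measurable_fun_cvg _ _ _ _ (fun n x => series (fun n => M n x) n)).
  by move=> n; rewrite /series /=; apply: measurable_sum => k.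
by move=> x _; exact: M_summable.
Qed.

(** Termwise integration of the series [S]: the integral of the [n]-th term is at most [M n.+1 x],
    which is summable. This provides the dominating function for [picard]. *)
Let NS_integrable i j x :
  nu.-integrable setT (fun y => (`|N i j (x, y)| * S y)%:E).
Proof.
have S_ge0 y : 0 <= S y by apply: le_trans (partial_le i y 0); exact: normr_ge0.
apply/integrableP; split.
  apply/measurable_EFinP; apply: measurable_funM => //; apply: measurableT_comp => //.
  exact: (measurable_fun_pair2 _ (mN i j)).
under eq_integral => y _ do rewrite gee0_abs ?lee_fin ?mulr_ge0 //.
have -> : (fun y => (`|N i j (x, y)| * S y)%:E) =
    (fun y => \sum_(n <oo) (`|N i j (x, y)| * M n y)%:E)%E.
  apply/funext => y; apply/esym/cvg_lim => //.
  apply: cvg_trans (_ : ((`|N i j (x, y)| * series (fun n => M n y) n)%:E @[n --> \oo]) --> _).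
    apply: near_eq_cvg; near=> n; rewrite sumEFin /series /= mulr_sumr.
    by rewrite big_mkord.
  by apply: cvg_EFin; [near=> n|apply: cvgMr; exact: M_summable].
rewrite integral_nneseries //.
- apply: le_lt_trans (_ : \sum_(n <oo) (M n.+1 x)%:E < +oo)%E.
    apply: lee_nneseries => n _; last exact: NMj.
    by move=> _; apply: integral_ge0 => y _; rewrite lee_fin mulr_ge0.
  apply: le_lt_trans (ltry (S x)).
  apply: lime_le.
    by apply: is_cvg_nneseries => n _ _; rewrite lee_fin.
  near=> n; rewrite sumEFin lee_fin.
  (* The integrals have raised each index by one, so the terms of [series _ n.+1] from index 1 on
     are the ones that occur, and [M 0 x] is extra. *)
  apply: le_trans (_ : series (fun n => M n x) n.+1 <= _).
    by rewrite /series /= big_nat_recl //= lerDr.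
  apply: nondecreasing_cvgn_le => //.
  by apply: nondecreasing_series => k _ _.
- by move=> n; apply/measurable_EFinP.
- by move=> n y _; rewrite lee_fin mulr_ge0.
Unshelve. all: by end_near. Qed.

(** The solution is the sum of the Neumann series; dominated convergence, with [|N| S] as dominating
    function, carries the limit through the integrals. *)
Theorem picard : exists f : I -> X -> R,
  [/\ forall i, measurable_fun setT (f i),
      forall i x, `|f i x| <= limn (series (fun n => M n x)),
      forall i j x, nu.-integrable setT (fun y => (N i j (x, y) * f j y)%:E) &
      forall i x, f i x = f0 i x + \sum_j \int[nu]_y (N i j (x, y) * f j y)].
Proof.
pose f i x := limn (series (fun n => fn n i x)).
have fcvg i x : series (fun n => fn n i x) @ \oo --> f i x by exact: cvg_fn.
have mser i n : measurable_fun setT (fun x => series (fun n => fn n i x) n).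
  by rewrite /series /=; apply: measurable_sum => k.
have mf i : measurable_fun setT (f i).
  by apply: (@measurable_fun_cvg _ _ _ _ (fun n x => series (fun n => fn n i x) n)).
have fS i x : `|f i x| <= S x.
  have h : `|series (fun n => fn n i x) n| @[n --> \oo] --> `|f i x|.
    exact: cvg_norm.
  rewrite -(cvg_lim _ h) //; apply: limr_le; first by apply/cvg_ex; exists `|f i x|.
  by near=> n; exact: partial_le.
have Nf i j x : nu.-integrable setT (fun y => (N i j (x, y) * f j y)%:E).
  apply: le_integrable (NS_integrable i j x) => //.
    by apply/measurable_EFinP; exact: measurable_NM.
  move=> y _ /=; rewrite lee_fin !normrM normr_id ler_wpM2l //.
  by rewrite (le_trans (fS j y)) // ler_norm.
exists f; split => // i x.
have Tcvg j : \int[nu]_y (N i j (x, y) * series (fun n => fn n j y) n) @[n --> \oo]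
   --> \int[nu]_y (N i j (x, y) * f j y).
  apply: fine_cvg; rewrite fineK; last exact: integrable_fin_num (Nf i j x).
  have := @dominated_convergence _ X R nu setT measurableT
    (fun n y => (N i j (x, y) * series (fun n => fn n j y) n)%:E)
    (fun y => (N i j (x, y) * f j y)%:E) (fun y => (`|N i j (x, y)| * S y)%:E).
  case.
  - by move=> n; apply/measurable_EFinP; exact: measurable_NM.
  - by apply/measurable_EFinP; exact: measurable_NM.
  - apply: aeW => y _; apply: cvg_EFin; first by near=> n.
    by apply: cvgMr; exact: fcvg.
  - exact: NS_integrable.
  - apply: aeW => y n _; rewrite /= lee_fin normrM ler_wpM2l //.
  by [].
(* [f0] is the term of index 0, and the others are images under the integral operator. Hence one
   more term on the left than under the integral. *)
have serS n : series (fun n => fn n i x) n.+1 =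
    f0 i x + \sum_j \int[nu]_y (N i j (x, y) * series (fun n => fn n j y) n).
  rewrite /series /= big_nat_recl //; congr (_ + _).
  rewrite /= exchange_big /=; apply: eq_bigr => j _.
  have int1 k : nu.-integrable setT (EFin \o (fun y => N i j (x, y) * fn k j y)).
    apply: le_integrable (NM_integrable k i j x) => //.
      by apply/measurable_EFinP; exact: measurable_NM.
    move=> y _ /=; rewrite lee_fin !normrM normr_id ler_wpM2l //.
    by rewrite (le_trans (fnM k j y)) // ler_norm.
  elim: n => [|n IH].
    rewrite big_geq //; under eq_Rintegral do rewrite big_geq // mulr0.
    by rewrite Rintegral_cst // mul0r.
  rewrite big_nat_recr //= IH; under [RHS]eq_Rintegral do rewrite big_nat_recr //= mulrDr.
  rewrite RintegralD //.
  have : nu.-integrable setT (fun y => \sum_(0 <= k < n) (N i j (x, y) * fn k j y)%:E)%E.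
    by apply: integrable_sum => // k _; exact: int1.
  by apply: eq_integrable => // y _; rewrite /= mulr_sumr sumEFin.
have c1 : series (fun n => fn n i x) n.+1 @[n --> \oo] --> f i x.
  by have := fcvg i x; rewrite -cvg_shiftS.
have c2 : series (fun n => fn n i x) n.+1 @[n --> \oo] -->
   f0 i x + \sum_j \int[nu]_y (N i j (x, y) * f j y).
  under eq_fun do rewrite serS.
  apply: cvgD; first exact: cvg_cst.
  exact: cvgn_sum.
exact: cvg_unique c1 c2.
Unshelve. all: by end_near. Qed.

End Picard.

(** The indicator of [x <= y] as a number. It turns an integral over a domain depending on
    parameters into one over the whole line with a jointly measurable integrand, to which
    [measurable_Rintegral_param] applies. *)
Definition lei {R : realDomainType} (x y : R) : R := ((x <= y)%R)%:R.

(** * The Goursat kernel *)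

Section IndicatorMeasurability.
Context d (T : measurableType d) (R : realType).

Lemma lei_ge0 (x y : R) : 0 <= lei x y.
Proof. exact: ler0n. Qed.

Lemma leiT (x y : R) : x <= y -> lei x y = 1.
Proof. by rewrite /lei => ->. Qed.

Lemma leiF (x y : R) : y < x -> lei x y = 0.
Proof. by rewrite /lei ltNge => /negbTE ->. Qed.

Lemma lei_norm (x y : R) : `|lei x y| = lei x y.
Proof. by rewrite ger0_norm // lei_ge0. Qed.

Lemma measurable_ler_ind (f g : T -> R) :
  measurable_fun setT f -> measurable_fun setT g ->
  measurable_fun setT (fun x => lei (f x) (g x)).
Proof.
move=> mf mg.
have mb : measurable_fun setT (fun x => (f x <= g x)%R) by exact: measurable_fun_ler.
rewrite (_ : (fun x => lei _ _) = (fun x => if (f x <= g x)%R then 1 else 0)); last first.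
  by apply/funext => x; rewrite /lei; case: ifP.
exact: (measurable_fun_ifT mb (measurable_cst (1 : R)) (measurable_cst (0 : R))).
Qed.

End IndicatorMeasurability.

Section IntervalIndicator.
Context {R : realType}.
Notation mu := (@lebesgue_measure R).
Implicit Types (f : R -> R) (a b : R).

Lemma lei_patch f a b :
  (fun t => f t * (lei a t * lei t b)) = f \_ `[a, b].
Proof.
apply/funext => t; rewrite patchE.
have [tab|/negP tab] := pselect (t \in `[a, b]).
  rewrite mem_set //=; move: tab; rewrite in_itv /= => /andP[h1 h2].
  by rewrite !leiT // !mulr1.
rewrite memNset //=; last by move=> /= h; rewrite h in tab.
by move: tab; rewrite in_itv /= negb_and -!ltNge => /orP[] h;
  rewrite (leiF h) ?(mul0r, mulr0).
Qed.

Lemma integral_lei f a b :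
  (\int[mu]_t (f t * (lei a t * lei t b))%:E = \int[mu]_(t in `[a, b]) (f t)%:E)%E.
Proof.
rewrite [RHS]integral_mkcond restrict_EFin -lei_patch.
by apply: eq_integral.
Qed.

Lemma Rintegral_lei f a b :
  \int[mu]_t (f t * (lei a t * lei t b)) = \int[mu]_(t in `[a, b]) f t.
Proof. by rewrite /Rintegral integral_lei. Qed.

Lemma integrable_lei f a b : mu.-integrable `[a, b] (EFin \o f) <->
  mu.-integrable setT (fun t => (f t * (lei a t * lei t b))%:E).
Proof.
have -> : (fun t => (f t * (lei a t * lei t b))%:E) = (EFin \o f) \_ `[a, b].
  by rewrite restrict_EFin -lei_patch.
have h : measurable (`[a, b] : set (measurableTypeR R)) by exact: measurable_itv.
by have := integrable_mkcond (mu := mu) (EFin \o f) h; move=> ->.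
Qed.

End IntervalIndicator.

Section GoursatKernel.
Context {R : realType}.
Notation mu := (@lebesgue_measure R).
Notation RR := (measurableTypeR R * measurableTypeR R)%type.
Variable q : R -> R.
Hypothesis mq : measurable_fun setT q.
Hypothesis qi : forall a, mu.-integrable `[0, a] (EFin \o q).
Implicit Types (x y s t xi eta : R).

Definition absq_int x := \int[mu]_(t in `[0, x]) `|q t|.
Notation Q := absq_int.

Lemma absq_integrable x : mu.-integrable `[0, x] (EFin \o (fun t => `|q t|)).
Proof. exact: integrable_norm (qi x). Qed.

Lemma absq_int_ge0 x : 0 <= Q x.
Proof. by apply: Rintegral_ge0. Qed.

Lemma le_absq_int x y : x <= y -> Q x <= Q y.
Proof.
move=> xy; apply: fine_le.
- by apply: integrable_fin_num => //; exact: absq_integrable.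
- by apply: integrable_fin_num => //; exact: absq_integrable.
- apply: ge0_subset_integral => //.
  + by apply/measurable_EFinP; apply: measurableT_comp => //; apply: measurable_funTS.
  + by apply: subset_itv; rewrite bnd_simp.
Qed.

Lemma absq_intE x : (\int[mu]_t (`|q t| * (lei 0 t * lei t x))%:E)%E = (Q x)%:E.
Proof.
rewrite /Q /Rintegral fineK; last by apply: integrable_fin_num => //; exact: absq_integrable.
exact: integral_lei.
Qed.

Lemma measurable_absq_int : measurable_fun setT (Q : measurableTypeR R -> R).
Proof.
have -> : Q = fun x => \int[mu]_t (`|q t| * (lei 0 t * lei t x)).
  by apply/funext => x; rewrite /Rintegral absq_intE.
apply: (@measurable_Rintegral_param _ (measurableTypeR R) _ (measurableTypeR R) R mu
   (fun xt => `|q xt.2| * (lei 0 xt.2 * lei xt.2 xt.1))).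
apply: measurable_funM; first by do 2!apply: measurableT_comp => //.
by apply: measurable_funM; apply: measurable_ler_ind.
Qed.

(** With [p = (xi, eta)] and [r = (s, y)] this is the indicator of [0 <= y <= eta <= s <= xi]: the
    rectangle over which the Goursat equation is integrated, from [y = 0] in one variable and from
    the diagonal point [s = eta] in the other. *)
Definition goursat_ind (p r : RR) : R :=
  lei 0 r.2 * lei r.2 p.2 * lei p.2 r.1 * lei r.1 p.1.

Definition goursat_kernel (pr : RR * RR) : R :=
  - (q (pr.2.1 - pr.2.2) * goursat_ind pr.1 pr.2).

Definition goursat_data (p : RR) : R :=
  \int[mu]_t (- 2^-1 * (q t * (lei 0 p.2 * lei p.2 t * lei t p.1))).

(** Each iteration yields one factor [Q] from integrating [|q (x - y)|] in [x], and one more power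
    of [eta], with its factorial, from integrating in [y]. The maximum with 0 is there because [p]
    ranges over the whole plane and majorants must be nonnegative. *)
Definition goursat_majorant n (p : RR) : R :=
  2^-1 * Q p.1 ^+ n.+1 * (Num.max p.2 0 ^+ n / n`!%:R).

Lemma measurable_goursat_kernel : measurable_fun setT goursat_kernel.
Proof.
have m1 : measurable_fun setT (fun pr : RR * RR => pr.1.1) by exact: measurableT_comp.
have m2 : measurable_fun setT (fun pr : RR * RR => pr.1.2) by exact: measurableT_comp.
have m3 : measurable_fun setT (fun pr : RR * RR => pr.2.1) by exact: measurableT_comp.
have m4 : measurable_fun setT (fun pr : RR * RR => pr.2.2) by exact: measurableT_comp.
apply: measurableT_comp => //; apply: measurable_funM.
  by apply: (measurableT_comp mq); exact: measurable_funB.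
by rewrite /goursat_ind; do 3?apply: measurable_funM; apply: measurable_ler_ind.
Qed.

Lemma measurable_goursat_data : measurable_fun setT goursat_data.
Proof.
apply: (@measurable_Rintegral_param _ RR _ (measurableTypeR R) R mu
   (fun pt => - 2^-1 * (q pt.2 * (lei 0 pt.1.2 * lei pt.1.2 pt.2 * lei pt.2 pt.1.1)))).
have m1 : measurable_fun setT (fun pr : RR * measurableTypeR R => pr.1.1) by exact: measurableT_comp.
have m2 : measurable_fun setT (fun pr : RR * measurableTypeR R => pr.1.2) by exact: measurableT_comp.
have m3 : measurable_fun setT (fun pr : RR * measurableTypeR R => pr.2) by exact: measurable_snd.
apply: measurable_funM => //; apply: measurable_funM.
  exact: (measurableT_comp mq).
by do 2?apply: measurable_funM; apply: measurable_ler_ind.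
Qed.

Lemma measurable_goursat_majorant n : measurable_fun setT (goursat_majorant n).
Proof.
apply: measurable_funM.
  apply: measurable_funM => //; apply: measurable_funX.
  exact: measurableT_comp measurable_absq_int measurable_fst.
apply: measurable_funM => //; apply: measurable_funX.
exact: measurable_maxr.
Qed.

Lemma goursat_majorant_ge0 n p : 0 <= goursat_majorant n p.
Proof.
rewrite /goursat_majorant !mulr_ge0 ?invr_ge0 ?exprn_ge0 ?absq_int_ge0 //.
by rewrite le_max lexx orbT.
Qed.

Lemma goursat_data_le p : `|goursat_data p| <= goursat_majorant 0 p.
Proof.
rewrite /goursat_data /goursat_majorant expr0 fact0 divr1 mulr1 expr1.
have mi : measurable_fun setT (fun t : measurableTypeR R => lei 0 p.2 * lei p.2 t * lei t p.1 : R).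
  by do 2?apply: measurable_funM => //; apply: measurable_ler_ind.
have mf : measurable_fun setT (fun t : measurableTypeR R => - 2^-1 * (q t * (lei 0 p.2 * lei p.2 t * lei t p.1))).
  by apply: measurable_funM => //; apply: measurable_funM.
have mg : measurable_fun setT (fun t : measurableTypeR R => `|q t| * (lei 0 t * lei t p.1)).
  apply: measurable_funM; first exact: measurableT_comp.
  by apply: measurable_funM; apply: measurable_ler_ind.
have ptw t : `|- 2^-1 * (q t * (lei 0 p.2 * lei p.2 t * lei t p.1))| <=
    2^-1 * (`|q t| * (lei 0 t * lei t p.1)).
  rewrite !normrM normrN (ger0_norm (_ : 0 <= 2^-1)) ?invr_ge0 // !lei_norm.
  rewrite ler_wpM2l ?invr_ge0 // ler_wpM2l // ler_wpM2r //.
  case: (leP 0 p.2) => h0; last by rewrite (leiF h0) mul0r lei_ge0.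
  rewrite (leiT h0) mul1r; case: (leP p.2 t) => h1; last by rewrite (leiF h1) lei_ge0.
  by rewrite (leiT h1) leiT // (le_trans h0 h1).
have ig : mu.-integrable setT (fun t => (`|q t| * (lei 0 t * lei t p.1))%:E).
  apply/integrableP; split; first exact/measurable_EFinP.
  under eq_integral => t _ do rewrite gee0_abs ?lee_fin ?mulr_ge0 ?lei_ge0 //.
  by rewrite absq_intE ltry.
have ig2 : mu.-integrable setT (EFin \o (fun t => 2^-1 * (`|q t| * (lei 0 t * lei t p.1)))).
  have := integrableZl measurableT 2^-1 ig.
  by apply: eq_integrable => // t _; rewrite /= EFinM.
have if_ : mu.-integrable setT (EFin \o (fun t => - 2^-1 * (q t * (lei 0 p.2 * lei p.2 t * lei t p.1)))).
  apply: le_integrable ig2 => //; first exact/measurable_EFinP.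
  by move=> t _ /=; rewrite lee_fin (le_trans (ptw t)) // ler_norm.
apply: le_trans (le_normr_Rintegral _ if_) _ => //.
apply: le_trans (_ : \int[mu]_t (2^-1 * (`|q t| * (lei 0 t * lei t p.1))) <= _).
  apply: le_Rintegral => //.
  exact: (@integrable_norm _ _ _ mu setT (fun t => - 2^-1 * (q t * (lei 0 p.2 * lei p.2 t * lei t p.1)))).
by rewrite RintegralZl // /Rintegral absq_intE.
Qed.

Lemma integral_X n x : 0 <= x ->
  (\int[mu]_(t in `[0%R, x]) (t ^+ n)%:E)%E = (x ^+ n.+1 / n.+1%:R)%:E.
Proof.
move=> x0.
have h : rac 0 x (fun t : R => t) (fun=> 1).
  by apply: rac_derive; apply: continuous_subspaceT => t; exact: cvg_cst.
have h2 := rac_X n h.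
have [hi he] := racZ n.+1%:R^-1 h2.
have n1 : n.+1%:R != 0 :> R by rewrite pnatr_eq0.
have E : forall t : R, n.+1%:R^-1 * (n.+1%:R * (t ^+ n * 1)) = t ^+ n.
  by move=> t; rewrite mulr1 mulKf.
have hi' : mu.-integrable `[0, x] (EFin \o (fun t => t ^+ n)).
  by apply: eq_integrable hi => // t _ /=; rewrite E.
rewrite -[LHS]fineK; last exact: integrable_fin_num hi'.
congr EFin; have := he x; rewrite x0 lexx => /(_ isT).
rewrite expr0n /= mulr0 add0r mulrC => ->.
by apply: eq_Rintegral => t _; rewrite E.
Qed.

(** Tonelli with [x] integrated before [y]. On the rectangle [Q x <= Q xi], so this factor leaves
    the integral; what is left in [y] is a monomial on [[0, eta]]. *)
Lemma goursat_step n p :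
  (\int[(mu \x mu)%E]_r (`|goursat_kernel (p, r)| * goursat_majorant n r)%:E <=
   (goursat_majorant n.+1 p)%:E)%E.
Proof.
have mf : measurable_fun setT (fun r => (`|goursat_kernel (p, r)| * goursat_majorant n r)%:E).
  apply/measurable_EFinP; apply: measurable_funM; last exact: measurable_goursat_majorant.
  apply: measurableT_comp => //.
  exact: (measurable_fun_pair2 _ measurable_goursat_kernel).
rewrite fubini_tonelli2 //; last first.
  by move=> r; rewrite lee_fin mulr_ge0 // goursat_majorant_ge0.
rewrite /fubini_G.
case: p mf => xi eta mf.
pose c := 2^-1 * Q xi ^+ n.+1.
have c0 : 0 <= c by rewrite mulr_ge0 ?invr_ge0 // exprn_ge0 // absq_int_ge0.
have mind (x : R) : measurable_fun setT (fun t : measurableTypeR R => `|q t| * (lei 0 t * lei t x)).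
  apply: measurable_funM; first exact: measurableT_comp.
  by apply: measurable_funM; apply: measurable_ler_ind.
have inner y : (\int[mu]_x (`|goursat_kernel ((xi, eta), (x, y))| * goursat_majorant n (x, y))%:E <=
   (c * Q xi * (lei 0 y * lei y eta * (y ^+ n / n`!%:R)))%:E)%E.
  case: (leP 0 y) => y0; last first.
    rewrite integral0_eq => [|x _]; last first.
      by rewrite /goursat_kernel /goursat_ind /= (leiF y0) !mul0r mulr0 oppr0 normr0 mul0r.
    by rewrite (leiF y0) !mul0r mulr0.
  case: (leP y eta) => ye; last first.
    rewrite integral0_eq => [|x _]; last first.
      by rewrite /goursat_kernel /goursat_ind /= (leiF ye) mulr0 !mul0r mulr0 oppr0 normr0 mul0r.
    by rewrite (leiF ye) mulr0 mul0r mulr0.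
  rewrite !leiT //.
  rewrite !mul1r.
  pose d := c * (y ^+ n / n`!%:R).
  have d0 : 0 <= d by rewrite mulr_ge0 // mulr_ge0 ?exprn_ge0 // invr_ge0.
  (* On the rectangle [x - y] lies in [[0, xi]]. After enlarging the domain to this condition, the
     shift [t = x - y] produces exactly [Q xi]. *)
  apply: le_trans (_ : \int[mu]_x (d%:E * (`|q (x - y)| * (lei 0 (x - y) * lei (x - y) xi))%:E) <= _)%E.
    apply: ge0_le_integral => //.
    - by move=> x _; rewrite lee_fin mulr_ge0 // goursat_majorant_ge0.
    - exact: (measurable_fun_pair1 _ mf).
    - apply: emeasurable_funM => //; apply/measurable_EFinP.
      by apply: (measurableT_comp (mind xi)); exact: measurable_funB.
    move=> x _; rewrite -EFinM lee_fin /goursat_kernel /goursat_ind /= (leiT y0) (leiT ye) !mul1r.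
    rewrite normrN normrM.
    have rhs0 : 0 <= d * (`|q (x - y)| * (lei 0 (x - y) * lei (x - y) xi)).
      by rewrite mulr_ge0 // mulr_ge0 // mulr_ge0 // lei_ge0.
    case: (leP eta x) => ex; last by rewrite (leiF ex) mul0r normr0 mulr0 mul0r.
    case: (leP x xi) => xxi; last by rewrite (leiF xxi) mulr0 normr0 mulr0 mul0r.
    have h1 : 0 <= x - y by rewrite subr_ge0 (le_trans ye ex).
    have h2 : x - y <= xi by rewrite lerBlDr (le_trans xxi) // lerDl.
    rewrite !leiT // !mulr1 normr1 mulr1 mulrC ler_wpM2r // /goursat_majorant /=.
    rewrite (max_idPl y0) /d /c ler_wpM2r ?mulr_ge0 ?exprn_ge0 ?invr_ge0 //.
    rewrite ler_wpM2l ?invr_ge0 // lerXn2r ?nnegrE ?absq_int_ge0 //.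
    exact: le_absq_int.
  rewrite ge0_integralZl //; last first.
  - by move=> x _; rewrite lee_fin !mulr_ge0 // lei_ge0.
  - apply/measurable_EFinP.
    by apply: (measurableT_comp (mind xi)); exact: measurable_funB.
  rewrite (@ge0_integral_shift _ y (fun t => (`|q t| * (lei 0 t * lei t xi))%:E)); last first.
  - by move=> x; rewrite lee_fin !mulr_ge0 // lei_ge0.
  - by apply/measurable_EFinP; exact: mind.
  by rewrite absq_intE -EFinM lee_fin /d mulrAC.
apply: le_trans (_ : \int[mu]_y (c * Q xi * (lei 0 y * lei y eta * (y ^+ n / n`!%:R)))%:E <= _)%E.
  apply: ge0_le_integral => //.
  - move=> y _; apply: integral_ge0 => x _.
    by rewrite lee_fin mulr_ge0 // goursat_majorant_ge0.
  - apply: (measurable_fun_fubini_tonelli_G (m1 := mu)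
      (fun r => (`|goursat_kernel ((xi, eta), r)| * goursat_majorant n r)%:E)) => //.
    by move=> r; rewrite lee_fin mulr_ge0 // goursat_majorant_ge0.
  - apply/measurable_EFinP; apply: measurable_funM => //; apply: measurable_funM.
      by apply: measurable_funM; apply: measurable_ler_ind.
    apply: measurable_funM => //.
rewrite {mf inner}.
have eE : (fun y => (c * Q xi * (lei 0 y * lei y eta * (y ^+ n / n`!%:R)))%:E) =
   (fun y => ((c * Q xi / n`!%:R * y ^+ n) * (lei 0 y * lei y eta))%:E).
  by apply/funext => y; congr EFin; ring.
rewrite eE integral_lei.
case: (leP 0 eta) => e0; last first.
  rewrite set_itv_ge ?bnd_simp -?ltNge // integral_set0 lee_fin.
  exact: goursat_majorant_ge0.
under eq_integral do rewrite EFinM.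
rewrite ge0_integralZl //; last 3 first.
- by apply: measurable_funTS; apply/measurable_EFinP; exact: measurable_funX.
- by move=> y /=; rewrite in_itv /= => /andP[y0 _]; rewrite lee_fin exprn_ge0.
- by rewrite lee_fin divr_ge0 // mulr_ge0 // absq_int_ge0.
rewrite integral_X // -EFinM lee_fin /goursat_majorant /= (max_idPl e0) /c.
have n1 : n.+1%:R != 0 :> R by rewrite pnatr_eq0.
have n2 : n`!%:R != 0 :> R by rewrite pnatr_eq0 -lt0n fact_gt0.
rewrite factS natrM (exprSr _ n.+1) le_eqVlt; apply/orP; left; apply/eqP; field.
by rewrite n2 /= nat1r n1.
Qed.

(** The exponential series. This is the origin of the exponential in the bound for [A - q]. *)
Lemma goursat_majorant_series p :
  series (fun n => goursat_majorant n p) @ \oo -->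
  2^-1 * Q p.1 * expR (Q p.1 * Num.max p.2 0).
Proof.
have -> : series (fun n => goursat_majorant n p) =
    fun n => 2^-1 * Q p.1 * series (exp_coeff (Q p.1 * Num.max p.2 0)) n.
  apply/funext => n; rewrite /series /= mulr_sumr; apply: eq_bigr => k _.
  by rewrite /goursat_majorant /exp_coeff /= exprMn exprS; ring.
by apply: cvgMr; rewrite /expR; exact: is_cvg_series_exp_coeff.
Qed.

Lemma goursat_exists : exists k : RR -> R,
  [/\ measurable_fun setT k,
      forall p, `|k p| <= 2^-1 * Q p.1 * expR (Q p.1 * Num.max p.2 0),
      forall p, (mu \x mu)%E.-integrable setT (fun r => (goursat_kernel (p, r) * k r)%:E) &
      forall p, k p = goursat_data p + \int[(mu \x mu)%E]_r (goursat_kernel (p, r) * k r)].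
Proof.
have [] := @picard _ RR R (mu \x mu)%E _ unit (fun _ _ => goursat_kernel) (fun _ => goursat_data)
  goursat_majorant.
- by move=> h mh; exact: measurable_Rintegral_param_prod.
- by move=> _ _; exact: measurable_goursat_kernel.
- by move=> _; exact: measurable_goursat_data.
- exact: measurable_goursat_majorant.
- exact: goursat_majorant_ge0.
- by move=> _; exact: goursat_data_le.
- by move=> n _ p; rewrite (big_pred1 tt) //; exact: goursat_step.
- by move=> p; apply/cvg_ex; eexists; exact: goursat_majorant_series.
move=> f [mf fS fi fE]; exists (f tt); split => //.
- by move=> p; have := fS tt p; rewrite (cvg_lim (@Rhausdorff R) (@goursat_majorant_series p)).
- by move=> p; exact: (fi tt tt p).
- by move=> p; rewrite {1}fE (big_pred1 tt) //; case.
Qed.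

Definition goursat xi eta : R := sval (cid goursat_exists) (xi, eta).
Notation k := goursat.

(** The derivative of [k] in its first variable, given by the once integrated equation and not by
    differentiation; [rac_goursat] and [rac_goursat_dx] justify the name. *)
Definition goursat_dx xi eta : R :=
  - 2^-1 * q xi - \int[mu]_(y in `[0, eta]) (q (xi - y) * k xi y).

Definition goursat_bound a := 2^-1 * Q a * expR (Q a * a).
Notation C := goursat_bound.

Lemma measurable_goursat : measurable_fun setT (fun p : RR => k p.1 p.2).
Proof.
rewrite /k; case: cid => f [mf _ _ _] /=.
by apply: eq_measurable_fun mf => -[x y] _.
Qed.

Lemma goursat_le a xi eta : 0 <= a -> xi <= a -> eta <= a -> `|k xi eta| <= C a.
Proof.
move=> a0 xa ea; rewrite /k; case: cid => f [_ fS _ _] /=.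
apply: le_trans (fS _) _ => /=; rewrite /C.
have h := le_absq_int xa.
apply: ler_pM.
- by rewrite mulr_ge0 ?invr_ge0 ?absq_int_ge0.
- exact: expR_ge0.
- by rewrite ler_wpM2l ?invr_ge0.
- rewrite ler_expR; apply: ler_pM => //; rewrite ?absq_int_ge0 //.
    by rewrite le_max lexx orbT.
  by rewrite ge_max ea a0.
Qed.

Lemma goursat_bound_ge0 a : 0 <= C a.
Proof. by rewrite !mulr_ge0 ?invr_ge0 ?absq_int_ge0 ?expR_ge0. Qed.

Lemma measurable_reflect_q xi : measurable_fun setT (fun y : R => q (xi - y)).
Proof. by apply: (measurableT_comp mq); exact: measurable_funB. Qed.

Lemma measurable_goursat2 xi : measurable_fun setT (fun y : R => k xi y).
Proof. exact: (measurable_fun_pair2 _ measurable_goursat). Qed.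

Lemma reflect_q_le xi eta : eta <= xi ->
  (\int[mu]_(y in `[0%R, eta]) `|q (xi - y)|%:E <= (Q xi)%:E)%E.
Proof.
move=> exi; rewrite -(integral_lei (fun y => `|q (xi - y)|)) -absq_intE.
have mind (x : R) : measurable_fun setT (fun t : measurableTypeR R => `|q t| * (lei 0 t * lei t x)).
  apply: measurable_funM; first exact: measurableT_comp.
  by apply: measurable_funM; apply: measurable_ler_ind.
rewrite -(@ge0_integral_reflect _ xi (fun t => (`|q t| * (lei 0 t * lei t xi))%:E)); last 2 first.
- by apply/measurable_EFinP; exact: mind.
- by move=> t; rewrite lee_fin !mulr_ge0 // lei_ge0.
apply: ge0_le_integral => //.
- by move=> t _; rewrite lee_fin !mulr_ge0 // lei_ge0.
- apply/measurable_EFinP; apply: measurable_funM.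
    apply: measurableT_comp => //; exact: measurable_reflect_q.
  by apply: measurable_funM; apply: measurable_ler_ind.
- apply/measurable_EFinP; apply: (measurableT_comp (mind xi)); exact: measurable_funB.
move=> t _; rewrite lee_fin ler_wpM2l //.
case: (leP 0 t) => t0; last by rewrite (leiF t0) mul0r mulr_ge0 // lei_ge0.
case: (leP t eta) => te; last by rewrite (leiF te) mulr0 mulr_ge0 // lei_ge0.
by rewrite !leiT // ?subr_ge0 ?(le_trans te) // gerBl.
Qed.

Lemma reflect_q_integrable xi eta : eta <= xi ->
  mu.-integrable `[0, eta] (EFin \o (fun y => q (xi - y))).
Proof.
move=> exi; apply/integrableP; split.
  by apply/measurable_EFinP; apply: measurable_funTS; exact: measurable_reflect_q.
exact: le_lt_trans (reflect_q_le exi) (ltry _).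
Qed.

Lemma reflect_q_Rint_le xi eta : eta <= xi ->
  \int[mu]_(y in `[0, eta]) `|q (xi - y)| <= Q xi.
Proof.
move=> exi; rewrite -lee_fin /Rintegral fineK; first exact: reflect_q_le.
by apply: integrable_fin_num => //; exact: integrable_norm (reflect_q_integrable exi).
Qed.

Lemma qk_integrable xi eta : eta <= xi ->
  mu.-integrable `[0, eta] (EFin \o (fun y => q (xi - y) * k xi y)).
Proof.
move=> exi; case: (leP 0 eta) => e0; last first.
  rewrite set_itv_ge ?bnd_simp -?ltNge //; exact: integrable_set0.
have x0 := le_trans e0 exi.
have := @bounded_integrableM R 0 eta (fun y => k xi y) (fun y => q (xi - y)).
move=> /(_ _ _ (reflect_q_integrable exi)) => h.
have : mu.-integrable `[0, eta] (EFin \o (fun y => k xi y * q (xi - y))).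
  apply: h; first by apply: measurable_funTS; exact: measurable_goursat2.
  exists (C xi) => y /andP[y0 ye]; apply: goursat_le => //; exact: le_trans ye exi.
by apply: eq_integrable => // y _; rewrite /= mulrC.
Qed.

Lemma qk_int_le a xi eta : 0 <= eta -> eta <= xi -> xi <= a ->
  `|\int[mu]_(y in `[0, eta]) (q (xi - y) * k xi y)| <= C a * Q a.
Proof.
move=> e0 exi xia.
have a0 := le_trans (le_trans e0 exi) xia.
apply: le_trans (le_normr_Rintegral _ (qk_integrable exi)) _ => //.
have ni := integrable_norm (reflect_q_integrable exi).
apply: le_trans (_ : \int[mu]_(y in `[0, eta]) (C a * `|q (xi - y)|) <= _).
  apply: le_Rintegral => //.
  - exact: integrable_norm (qk_integrable exi).
  - have := integrableZl (mitv _) (C a) ni.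
    by apply: eq_integrable => // y _; rewrite /= EFinM.
  - move=> y /=; rewrite in_itv /= => /andP[y0 ye].
    rewrite normrM mulrC ler_wpM2r //; apply: goursat_le => //.
    exact: le_trans ye (le_trans exi xia).
rewrite RintegralZl // ler_wpM2l ?goursat_bound_ge0 //.
exact: le_trans (reflect_q_Rint_le exi) (le_absq_int xia).
Qed.

Lemma goursat_dx_le a xi eta : 0 <= eta -> eta <= xi -> xi <= a ->
  `|goursat_dx xi eta| <= 2^-1 * `|q xi| + C a * Q a.
Proof.
move=> e0 exi xia; apply: le_trans (ler_normB _ _) _; apply: lerD.
  by rewrite normrM normrN (ger0_norm (_ : 0 <= 2^-1)) ?invr_ge0.
exact: qk_int_le.
Qed.

Lemma measurable_goursat_dx : measurable_fun setT (fun p : RR => goursat_dx p.1 p.2).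
Proof.
have -> : (fun p : RR => goursat_dx p.1 p.2) = fun p =>
   - 2^-1 * q p.1 - \int[mu]_y (q (p.1 - y) * k p.1 y * (lei 0 y * lei y p.2)).
  by apply/funext => p; rewrite Rintegral_lei.
apply: measurable_funB.
  by apply: measurable_funM => //; exact: (measurableT_comp mq).
apply: (@measurable_Rintegral_param _ RR _ (measurableTypeR R) R mu
   (fun py => q (py.1.1 - py.2) * k py.1.1 py.2 * (lei 0 py.2 * lei py.2 py.1.2))).
have m1 : measurable_fun setT (fun pr : RR * measurableTypeR R => pr.1.1) by exact: measurableT_comp.
have m2 : measurable_fun setT (fun pr : RR * measurableTypeR R => pr.1.2) by exact: measurableT_comp.
have m3 : measurable_fun setT (fun pr : RR * measurableTypeR R => pr.2) by exact: measurable_snd.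
apply: measurable_funM; last by apply: measurable_funM; apply: measurable_ler_ind.
apply: measurable_funM.
  by apply: (measurableT_comp mq); exact: measurable_funB.
apply: (measurableT_comp measurable_goursat (g := fun py : RR * measurableTypeR R => (py.1.1, py.2))).
exact: measurable_fun_pair.
Qed.

(** The Goursat equation itself, read along lines of constant [xi]. Together with [rac_goursat],
    which works along lines of constant [eta], this is the regularity of [k] on which the identity
    for [A] rests. *)
Lemma rac_goursat_dx xi : rac 0 xi (goursat_dx xi) (fun eta => - (q (xi - eta) * k xi eta)).
Proof.
have h := qk_integrable (lexx xi).
split.
  have := integrableN h.
  by apply: eq_integrable.
move=> eta /andP[e0 exi]; rewrite /goursat_dx set_itv1 Rintegral_set1 subr0; congr (_ + _).
have h' := integrable_itvS h (lexx 0) exi.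
under [RHS]eq_Rintegral do rewrite -mulN1r.
by rewrite RintegralZl // mulN1r.
Qed.

(** Fubini rewrites the double integral of the Picard equation with the inner integral in [y]. In
    this form [k] is visibly a primitive in its first variable. *)
Lemma goursatE eta a : 0 <= eta ->
  mu.-integrable `[eta, a] (EFin \o (fun xi => goursat_dx xi eta)) /\
  k a eta = \int[mu]_(s in `[eta, a]) goursat_dx s eta.
Proof.
move=> e0.
pose h s := - \int[mu]_(y in `[0, eta]) (q (s - y) * k s y).
have inner xi s : (\int[mu]_y (goursat_kernel ((xi, eta), (s, y)) * k s y)%:E =
    (h s * (lei eta s * lei s xi))%:E)%E.
  have e1 y : goursat_kernel ((xi, eta), (s, y)) * k s y =
     - (lei eta s * lei s xi) * (q (s - y) * k s y * (lei 0 y * lei y eta)).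
    by rewrite /goursat_kernel /goursat_ind /=; ring.
  under eq_integral do rewrite e1.
  case: (leP eta s) => es; last first.
    rewrite integral0_eq => [|y _]; last by rewrite (leiF es) mul0r oppr0 mul0r.
    by rewrite (leiF es) mul0r mulr0.
  have hi := qk_integrable es.
  have := (integrable_lei _ _ _).1 hi => hi'.
  under eq_integral do rewrite EFinM.
  rewrite integralZl // integral_lei.
  rewrite -[X in (_ * X)%E]fineK; last exact: integrable_fin_num hi.
  by rewrite -EFinM /h /Rintegral; congr EFin; ring.
have prodE xi : mu.-integrable `[eta, xi] (EFin \o h) /\
   \int[(mu \x mu)%E]_r (goursat_kernel ((xi, eta), r) * k r.1 r.2) =
   \int[mu]_(s in `[eta, xi]) h s.
  have fi : (mu \x mu)%E.-integrable setT (fun r => (goursat_kernel ((xi, eta), r) * k r.1 r.2)%:E).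
    rewrite /k; case: cid => f [_ _ fi _] /=.
    by apply: eq_integrable (fi (xi, eta)) => // -[x y] _.
  have FE : fubini_F mu (fun r => (goursat_kernel ((xi, eta), r) * k r.1 r.2)%:E) =
     fun s => (h s * (lei eta s * lei s xi))%:E.
    by apply/funext => s; rewrite /fubini_F /= inner.
  split.
    by apply/integrable_lei; have := integrable_fubini_F fi; rewrite FE.
  rewrite /Rintegral -(integral12_prod_meas1 fi) FE.
  by congr fine; exact: integral_lei.
have [hi he] := prodE a.
have qi' : mu.-integrable `[eta, a] (EFin \o q) by exact: integrable_itvS (qi a) e0 (lexx _).
have qi2 : mu.-integrable `[eta, a] (EFin \o (fun t => - 2^-1 * q t)).
  have := integrableZl (mitv _) (- 2^-1) qi'.
  by apply: eq_integrable => // t _; rewrite /= EFinM.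
split.
  have := integrableD (mitv _) qi2 hi.
  by apply: eq_integrable => // t _; rewrite /= -EFinD.
have -> : k a eta = goursat_data (a, eta) + \int[(mu \x mu)%E]_r (goursat_kernel ((a, eta), r) * k r.1 r.2).
  rewrite /k; case: cid => f [_ _ _ fE] /=; rewrite {1}fE; congr (_ + _).
  by apply: eq_Rintegral => -[x y] _.
rewrite he /goursat_data /=.
have -> : \int[mu]_t (- 2^-1 * (q t * (lei 0 eta * lei eta t * lei t a))) =
   \int[mu]_(t in `[eta, a]) (- 2^-1 * q t).
  rewrite -Rintegral_lei; apply: eq_Rintegral => t _.
  by rewrite (leiT e0); ring.
by rewrite -RintegralD.
Qed.

Lemma rac_goursat eta a : 0 <= eta ->
  rac eta a (fun xi => k xi eta) (fun xi => goursat_dx xi eta).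
Proof.
move=> e0; split; first by have [] := goursatE a e0.
move=> xi _; have [_ ->] := goursatE xi e0; have [_ ->] := goursatE eta e0.
by rewrite set_itv1 Rintegral_set1 add0r.
Qed.

Lemma goursat_diag xi : 0 <= xi -> k xi xi = 0.
Proof.
by move=> x0; have [_ ->] := goursatE xi x0; rewrite set_itv1 Rintegral_set1.
Qed.

End GoursatKernel.

(** * The amplitude *)

Section IntervalSubstitution.
Context {R : realType}.
Notation mu := (@lebesgue_measure R).
Implicit Types (f : R -> R) (a b c x y : R).

Let measurable_patch f x y : measurable_fun `[x, y] f ->
  measurable_fun setT (fun s => f s * (lei x s * lei s y)).
Proof.
move=> mf; rewrite lei_patch.
by apply/(measurable_restrictT f); [exact: measurable_itv|].
Qed.

Let lei_reflect f c x y : (fun t => f (c - t) * (lei x t * lei t y)) =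
  (fun t => (fun s => f s * (lei (c - y) s * lei s (c - x))) (c - t)).
Proof.
apply/funext => t /=; rewrite [X in _ = _ * X]mulrC; congr (_ * (_ * _)); congr ((nat_of_bool _)%:R);
  by apply/idP/idP; lra.
Qed.

Lemma integrable_itv_reflect f c x y :
  mu.-integrable `[c - y, c - x] (EFin \o f) ->
  mu.-integrable `[x, y] (EFin \o (fun t => f (c - t))).
Proof.
move=> fi; have mf : measurable_fun `[c - y, c - x] f.
  by apply/measurable_EFinP; exact: measurable_int fi.
have mg := measurable_patch mf.
apply/(integrable_lei (fun t => f (c - t))).
rewrite (_ : (fun t => (f (c - t) * (lei x t * lei t y))%:E) =
   EFin \o (fun t => f (c - t) * (lei x t * lei t y))) // lei_reflect.
apply/integrableP; split.
  apply/measurable_EFinP; apply: (measurableT_comp mg); exact: measurable_funB.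
rewrite [X in (X < _)%E](@ge0_integral_reflect _ c
  (fun s => `|(f s * (lei (c - y) s * lei s (c - x)))%:E|%E)) //.
  by have /integrableP[] := (integrable_lei _ _ _).1 fi.
by apply: measurableT_comp => //; exact/measurable_EFinP.
Qed.

Lemma Rintegral_itv_reflect f c x y : measurable_fun `[c - y, c - x] f ->
  \int[mu]_(t in `[x, y]) f (c - t) = \int[mu]_(t in `[c - y, c - x]) f t.
Proof.
move=> mf; have mg := measurable_patch mf.
rewrite -(Rintegral_lei (fun t => f (c - t))) lei_reflect.
by rewrite (@Rintegral_reflect _ c (fun s => f s * (lei (c - y) s * lei s (c - x)))) // Rintegral_lei.
Qed.

Lemma rac_reflect c a b f f' : rac (c - b) (c - a) f f' ->
  rac a b (fun t => f (c - t)) (fun t => - f' (c - t)).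
Proof.
move=> h; have [fi ff] := h.
have fi' := integrable_itv_reflect fi.
split.
  have := integrableN fi'.
  by apply: eq_integrable.
move=> x /andP[ax xb].
have mf : measurable_fun `[c - x, c - a] f'.
  apply/measurable_EFinP; have : mu.-integrable `[c - x, c - a] (EFin \o f').
    by apply: integrable_itvS fi _ _; lra.
  exact: measurable_int.
have h1 : f (c - a) - f (c - x) = \int[mu]_(t in `[c - x, c - a]) f' t.
  by apply: (rac_sub h); lra.
have -> : \int[mu]_(t in `[a, x]) - f' (c - t) = - \int[mu]_(t in `[a, x]) f' (c - t).
  under eq_Rintegral do rewrite -mulN1r.
  rewrite RintegralZl ?mulN1r //; exact: integrable_itvS fi' _ _.
by rewrite Rintegral_itv_reflect // -h1; ring.
Qed.

Lemma rac_shift c a b f f' : rac (a - c) (b - c) f f' ->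
  rac a b (fun t => f (t - c)) (fun t => f' (t - c)).
Proof.
move=> h.
have h1 : rac (c - b) (c - a) (fun t => f (0 - t)) (fun t => - f' (0 - t)).
  by apply: rac_reflect; rewrite !sub0r !opprB.
apply: (rac_eq (rac_reflect h1)) => t _; first by congr f; ring.
by rewrite opprK; congr f'; ring.
Qed.

Lemma cac_reflect c a b (f f' : R -> R[i]) : cac (c - b) (c - a) f f' ->
  cac a b (fun t => f (c - t)) (fun t => - f' (c - t)).
Proof.
move=> [h1 h2]; split.
  by apply: (rac_eq (rac_reflect h1)) => // t _; rewrite cReN.
by apply: (rac_eq (rac_reflect h2)) => // t _; rewrite cImN.
Qed.

Lemma cac_shift c a b (f f' : R -> R[i]) : cac (a - c) (b - c) f f' ->
  cac a b (fun t => f (t - c)) (fun t => f' (t - c)).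
Proof.
move=> [h1 h2]; split.
  exact: (rac_shift h1).
exact: (rac_shift h2).
Qed.

End IntervalSubstitution.

Lemma Rintegral_itv_cst (R : realType) (c x y : R) : x <= y ->
  \int[@lebesgue_measure R]_(_ in `[x, y]) c = c * (y - x).
Proof.
move=> xy.
have h : rac x y (fun t : R => t) (fun=> 1).
  by apply: rac_derive; apply: continuous_subspaceT => t; exact: cvg_cst.
have := rac_sub (racZ c h) (lexx _) xy (lexx _); rewrite -mulrBr => ->.
by apply: eq_Rintegral => t _; rewrite mulr1.
Qed.

(** * Exchange of integrals over a triangle *)

Section TriangleFubini.
Context {R : realType}.
Notation mu := (@lebesgue_measure R).
Notation RR := (measurableTypeR R * measurableTypeR R)%type.
Variable q : R -> R.
Hypothesis mq : measurable_fun setT q.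
Hypothesis qi : forall a, mu.-integrable `[0, a] (EFin \o q).

(** The shape of the bound on [h] fits the integrand of the identity below: [goursat_dx] contributes
    a function of [xi] alone, and the term with [q (xi - eta)] integrates over [eta] in [[0, xi]] to
    at most [Q a]. So the double integral of [|h|] is finite although [h] need not be bounded. *)
Lemma fubini_triangle (a b2 : R) (b1 : R -> R) (h : R -> R -> R) :
  0 <= a -> 0 <= b2 -> (forall x, 0 <= b1 x) ->
  mu.-integrable `[0, a] (EFin \o b1) ->
  measurable_fun setT (fun p : RR => h p.1 p.2) ->
  (forall xi eta, 0 <= eta -> eta <= xi -> xi <= a ->
     `|h xi eta| <= b1 xi + b2 * `|q (xi - eta)|) ->
  (forall eta, 0 <= eta <= a -> mu.-integrable `[eta, a] (EFin \o (fun xi => h xi eta))) ->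
  (forall xi, 0 <= xi <= a -> mu.-integrable `[0, xi] (EFin \o h xi)) ->
  \int[mu]_(eta in `[0, a]) \int[mu]_(xi in `[eta, a]) h xi eta =
  \int[mu]_(xi in `[0, a]) \int[mu]_(eta in `[0, xi]) h xi eta.
Proof.
move=> a0 b20 b10 b1i mh hb hi1 hi2.
pose H (p : RR) := h p.1 p.2 * (lei 0 p.2 * lei p.2 p.1 * lei p.1 a).
have m1 : measurable_fun setT (fun p : RR => p.1) by exact: measurable_fst.
have m2 : measurable_fun setT (fun p : RR => p.2) by exact: measurable_snd.
have mH : measurable_fun setT H.
  apply: measurable_funM => //.
  by do 2?apply: measurable_funM; apply: measurable_ler_ind.
have in1 xi : (\int[mu]_eta (H (xi, eta))%:E =
    ((\int[mu]_(eta in `[0, xi]) h xi eta)%R * (lei 0 xi * lei xi a))%:E)%E.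
  case: (leP 0 xi) => x0; last first.
    rewrite (leiF x0) mul0r mulr0; apply: integral0_eq => eta _.
    rewrite /H /=; case: (leP 0 eta) => e0; last by rewrite (leiF e0) !mul0r mulr0.
    by rewrite (leiF (lt_le_trans x0 e0)) mulr0 mul0r mulr0.
  case: (leP xi a) => xa; last first.
    rewrite (leiF xa) !mulr0; apply: integral0_eq => eta _.
    by rewrite /H /= (leiF xa) !mulr0.
  rewrite !leiT // !mulr1.
  rewrite -Rintegral_lei /Rintegral fineK; last first.
    by apply: integrable_fin_num => //; apply/integrable_lei; apply: hi2; rewrite x0.
  by apply: eq_integral => eta _; rewrite /H /= (leiT xa) mulr1.
have in2 eta : (\int[mu]_xi (H (xi, eta))%:E =
    ((\int[mu]_(xi in `[eta, a]) h xi eta)%R * (lei 0 eta * lei eta a))%:E)%E.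
  case: (leP 0 eta) => e0; last first.
    rewrite (leiF e0) mul0r mulr0; apply: integral0_eq => xi _.
    by rewrite /H /= (leiF e0) !mul0r mulr0.
  case: (leP eta a) => ea; last first.
    rewrite (leiF ea) !mulr0; apply: integral0_eq => xi _.
    rewrite /H /=; case: (leP eta xi) => ex; last by rewrite (leiF ex) mulr0 mul0r mulr0.
    by rewrite (leiF (lt_le_trans ea ex)) !mulr0.
  rewrite !leiT // !mulr1.
  rewrite -(Rintegral_lei (fun xi => h xi eta)) /Rintegral fineK; last first.
    apply: integrable_fin_num => //.
    by apply/(integrable_lei (fun xi => h xi eta)); apply: hi1; rewrite e0.
  by apply: eq_integral => xi _; rewrite /H /= (leiT e0) mul1r.
have Hi : (mu \x mu)%E.-integrable setT (EFin \o H).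
  apply/integrable12ltyP; first exact/measurable_EFinP.
  have Q0 := absq_int_ge0 q a.
  have cQ : mu.-integrable `[0, a] (EFin \o (fun=> b2 * absq_int q a)).
    apply: continuous_compact_integrable; first exact: segment_compact.
    by apply: continuous_subspaceT => x; exact: cvg_cst.
  have i1 : mu.-integrable `[0, a] (EFin \o (fun xi => a * b1 xi + b2 * absq_int q a)).
    have := integrableD (mitv _) (integrableZl (mitv _) a b1i) cQ.
    by apply: eq_integrable => // x _; rewrite /= -EFinM -EFinD.
  have i2 := (integrable_lei _ _ _).1 i1.
  apply: le_lt_trans (_ : \int[mu]_xi
    (((a * b1 xi + b2 * absq_int q a) * (lei 0 xi * lei xi a))%:E) < +oo)%E; last first.
    by rewrite ltey_eq; apply/orP; left; exact: integrable_fin_num.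
  apply: ge0_le_integral => //.
  - by move=> xi _; apply: integral_ge0.
  - apply: (measurable_fun_fubini_tonelli_F (m2 := mu) (fun p => `|(H p)%:E|%E)) => //.
    by apply: measurableT_comp => //; exact/measurable_EFinP.
  - exact: measurable_int i2.
  move=> xi _.
  case: (leP 0 xi) => x0; last first.
    rewrite (leiF x0) mul0r mulr0 integral0_eq // => eta _.
    rewrite /H /=; case: (leP 0 eta) => e0; last by rewrite (leiF e0) !mul0r mulr0 normr0.
    by rewrite (leiF (lt_le_trans x0 e0)) mulr0 mul0r mulr0 normr0.
  case: (leP xi a) => xa; last first.
    by rewrite (leiF xa) !mulr0 integral0_eq // => eta _; rewrite /H /= (leiF xa) !mulr0 normr0.
  rewrite [X in (_ <= (_ * X)%:E)%E](_ : _ = 1); last by rewrite !leiT // mulr1.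
  rewrite mulr1.
  have hxi : mu.-integrable `[0, xi] (EFin \o h xi) by apply: hi2; rewrite x0.
  have -> : (\int[mu]_eta `|(H (xi, eta))%:E| = \int[mu]_(eta in `[0%R, xi]) `|h xi eta|%:E)%E.
    rewrite -(integral_lei (fun eta => `|h xi eta|)); apply: eq_integral => eta _.
    by rewrite /H /= (leiT xa) mulr1 normrM normrM !lei_norm.
  have qr := reflect_q_integrable mq qi (lexx xi).
  have i3 : mu.-integrable `[0, xi] (EFin \o (fun eta => b2 * `|q (xi - eta)|)).
    have := integrableZl (mitv _) b2 (integrable_norm qr).
    by apply: eq_integrable => // x _; rewrite /= EFinM.
  have i4 : mu.-integrable `[0, xi] (EFin \o (fun=> b1 xi)).
    apply: continuous_compact_integrable; first exact: segment_compact.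
    by apply: continuous_subspaceT => x; exact: cvg_cst.
  have i5 : mu.-integrable `[0, xi] (EFin \o (fun eta => b1 xi + b2 * `|q (xi - eta)|)).
    have := integrableD (mitv _) i4 i3.
    by apply: eq_integrable => // x _; rewrite /= EFinD.
  apply: le_trans (_ : \int[mu]_(eta in `[0%R, xi]) (b1 xi + b2 * `|q (xi - eta)|)%:E <= _)%E.
    apply: ge0_le_integral => //.
    - by apply: measurable_int (integrable_norm hxi).
    - exact: measurable_int i5.
    - by move=> eta /=; rewrite in_itv /= => /andP[e0 ex]; rewrite lee_fin hb.
  rewrite -[X in (X <= _)%E]fineK; last exact: integrable_fin_num i5.
  rewrite lee_fin.
  change (\int[mu]_(eta in `[0, xi]) (b1 xi + b2 * `|q (xi - eta)|) <= a * b1 xi + b2 * absq_int q a).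
  rewrite RintegralD //.
  apply: lerD.
    by rewrite Rintegral_itv_cst // subr0 mulrC ler_wpM2r.
  rewrite RintegralZl //; last exact: integrable_norm qr.
  rewrite ler_wpM2l //; apply: le_trans (reflect_q_Rint_le mq qi (lexx xi)) _.
  exact: le_absq_int.
have l : \int[mu]_(eta in `[0, a]) \int[mu]_(xi in `[eta, a]) h xi eta =
   fine (\int[mu]_eta \int[mu]_xi (H (xi, eta))%:E)%E.
  under eq_integral do rewrite in2.
  by rewrite integral_lei.
have r : \int[mu]_(xi in `[0, a]) \int[mu]_(eta in `[0, xi]) h xi eta =
   fine (\int[mu]_xi \int[mu]_eta (H (xi, eta))%:E)%E.
  under eq_integral do rewrite in1.
  by rewrite integral_lei.
have F : (\int[mu]_xi \int[mu]_eta (H (xi, eta))%:E =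
    \int[mu]_eta \int[mu]_xi (H (xi, eta))%:E)%E.
  exact: Fubini Hi.
exact: (etrans l (etrans (congr1 fine (esym F)) (esym r))).
Qed.

End TriangleFubini.

(** * Linearity and integrability for complex integrals *)

Section ComplexIntegral.
Context {R : realType}.
Notation mu := (@lebesgue_measure R).
Implicit Types (D : set (measurableTypeR R)) (f g : R -> R[i]).

Lemma cintegrableD D f g : measurable D -> cintegrable D f -> cintegrable D g ->
  cintegrable D (fun x => f x + g x).
Proof.
move=> mD [f1 f2] [g1 g2]; split.
  have := integrableD mD f1 g1; apply: eq_integrable => // x _.
  by rewrite /= cReD EFinD.
have := integrableD mD f2 g2; apply: eq_integrable => // x _.
by rewrite /= cImD EFinD.
Qed.

Lemma cintegralD D f g : measurable D -> cintegrable D f -> cintegrable D g ->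
  cintegral D (fun x => f x + g x) = cintegral D f + cintegral D g.
Proof.
move=> mD [f1 f2] [g1 g2]; apply: complexP; rewrite ?cReD ?cImD /=.
  by rewrite -RintegralD //; apply: eq_Rintegral => x _; rewrite cReD.
by rewrite -RintegralD //; apply: eq_Rintegral => x _; rewrite cImD.
Qed.

Lemma cintegrableZ D w f : measurable D -> cintegrable D f ->
  cintegrable D (fun x => w * f x).
Proof.
move=> mD [f1 f2]; split.
  have := integrableB mD (integrableZl mD (Re w) f1) (integrableZl mD (Im w) f2).
  by apply: eq_integrable => // x _; rewrite /= cReM -!EFinM -EFinB.
have := integrableD mD (integrableZl mD (Re w) f2) (integrableZl mD (Im w) f1).
by apply: eq_integrable => // x _; rewrite /= cImM -!EFinM -EFinD.
Qed.

Lemma cintegralZ D w f : measurable D -> cintegrable D f ->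
  cintegral D (fun x => w * f x) = w * cintegral D f.
Proof.
move=> mD [f1' f2'].
have f1 : mu.-integrable D (EFin \o (fun x => Re (f x))) by [].
have f2 : mu.-integrable D (EFin \o (fun x => Im (f x))) by [].
have z1 c : mu.-integrable D (EFin \o (fun x => c * Re (f x))).
  have := integrableZl mD c f1.
  by apply: eq_integrable => // x _; rewrite /= EFinM.
have z2 c : mu.-integrable D (EFin \o (fun x => c * Im (f x))).
  have := integrableZl mD c f2.
  by apply: eq_integrable => // x _; rewrite /= EFinM.
apply: complexP; rewrite [RHS](cReM, cImM) /=.
  rewrite -(RintegralZl _ mD f1) -(RintegralZl _ mD f2) -RintegralB //.
  by apply: eq_Rintegral => x _; rewrite cReM.
rewrite -(RintegralZl _ mD f1) -(RintegralZl _ mD f2) -RintegralD //.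
by apply: eq_Rintegral => x _; rewrite cImM.
Qed.

Lemma cintegral_lin D w z f g : measurable D -> cintegrable D f -> cintegrable D g ->
  cintegral D (fun x => w * f x + z * g x) = w * cintegral D f + z * cintegral D g.
Proof.
move=> mD fi gi; rewrite (cintegralD mD (cintegrableZ w mD fi) (cintegrableZ z mD gi)).
by rewrite !cintegralZ.
Qed.

Lemma eq_cintegral D f g : {in D, f =1 g} -> cintegral D f = cintegral D g.
Proof.
by move=> fg; apply: complexP => /=; apply: eq_Rintegral => x xD; rewrite fg.
Qed.

Lemma eq_cintegrable D f g : measurable D -> {in D, f =1 g} ->
  cintegrable D f -> cintegrable D g.
Proof.
move=> mD fg [h1 h2]; split.
  by apply: eq_integrable h1 => // x xD; rewrite fg.
by apply: eq_integrable h2 => // x xD; rewrite fg.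
Qed.

Lemma cintegrable_real D (f : R -> R) : mu.-integrable D (EFin \o f) ->
  cintegrable D (fun x => (f x)%:C).
Proof. by move=> fi; split => //; exact: integrable0. Qed.

Lemma cac_continuous a b f f' : a <= b -> cac a b f f' ->
  {within `[a, b], continuous (fun x => Re (f x))} /\
  {within `[a, b], continuous (fun x => Im (f x))}.
Proof. by move=> ab [h1 h2]; split; [exact: rac_continuous h1|exact: rac_continuous h2]. Qed.

Lemma cac_bounded a b f f' : cac a b f f' ->
  exists2 M : R, 0 <= M & forall x, a <= x <= b -> normc (f x) <= M.
Proof.
move=> h; case: (leP a b) => ab; last first.
  by exists 0 => // x /andP[ax xb]; move: (le_trans ax xb); rewrite leNgt ab.
have [c1 c2] := cac_continuous ab h.
have [M1 H1] := continuous_itv_bounded c1; have [M2 H2] := continuous_itv_bounded c2.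
have aab : a <= a <= b by rewrite lexx.
exists (M1 + M2).
  by apply: addr_ge0; [exact: le_trans (H1 a aab)|exact: le_trans (H2 a aab)].
by move=> x xab; apply: le_trans (normc_le_parts _) _; apply: lerD; [exact: H1|exact: H2].
Qed.

Lemma cac_integrableM a b f f' g : cac a b f f' -> cintegrable `[a, b] g ->
  cintegrable `[a, b] (fun x => f x * g x).
Proof.
move=> h gi; case: (leP a b) => ab; last first.
  rewrite /cintegrable set_itv_ge ?bnd_simp -?ltNge //.
  by split; exact: integrable_set0.
have [c1 c2] := cac_continuous ab h; have [g1 g2] := gi.
have i11 := continuous_integrableM c1 g1; have i22 := continuous_integrableM c2 g2.
have i12 := continuous_integrableM c1 g2; have i21 := continuous_integrableM c2 g1.
split.
  have := integrableB (mitv _) i11 i22; apply: eq_integrable => // x _.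
  by rewrite /= cReM EFinB.
have := integrableD (mitv _) i12 i21; apply: eq_integrable => // x _.
by rewrite /= cImM EFinD.
Qed.

End ComplexIntegral.

(** * The amplitude and its integral identity *)

Section KeyIdentity.
Context {R : realType}.
Notation mu := (@lebesgue_measure R).
Notation RR := (measurableTypeR R * measurableTypeR R)%type.
Variable q : R -> R.
Hypothesis mq : measurable_fun setT q.
Hypothesis qi : forall a, mu.-integrable `[0, a] (EFin \o q).
Notation k := (goursat mq qi).
Notation dk := (goursat_dx mq qi).

Definition amplitude_corr x := 2 * \int[mu]_(y in `[0, x]) (q (x - y) * k x y).

Definition amplitude x := q x + amplitude_corr x.

Lemma amplitudeE x : amplitude x = - 2 * dk x x.
Proof. by rewrite /amplitude /amplitude_corr /goursat_dx; field. Qed.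

Lemma measurable_amplitude : measurable_fun setT amplitude.
Proof.
have -> : amplitude = fun x => - 2 * dk x x by apply/funext => x; rewrite amplitudeE.
apply: measurable_funM => //.
apply: (measurableT_comp (measurable_goursat_dx mq qi) (g := fun x : measurableTypeR R => (x, x))).
by apply: measurable_fun_pair.
Qed.

Lemma amplitude_corr_le a x : 0 <= x -> x <= a ->
  `|amplitude_corr x| <= 2 * (goursat_bound q a * absq_int q a).
Proof.
move=> x0 xa; rewrite /amplitude_corr normrM ger0_norm // ler_wpM2l //.
exact: qk_int_le.
Qed.

Lemma cst_integrable (c a b : R) : mu.-integrable `[a, b] (EFin \o (fun=> c)).
Proof.
apply: continuous_compact_integrable; first exact: segment_compact.
by apply: continuous_subspaceT => x; exact: cvg_cst.
Qed.

Lemma amplitude_integrable a : mu.-integrable `[0, a] (EFin \o amplitude).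
Proof.
pose c := 2 * (goursat_bound q a * absq_int q a).
have c0 : 0 <= c by rewrite !mulr_ge0 ?goursat_bound_ge0 ?absq_int_ge0.
have h := integrableD (mitv _) (absq_integrable qi a) (cst_integrable c 0 a).
apply: le_integrable h => //.
  by apply/measurable_EFinP; apply: measurable_funTS; exact: measurable_amplitude.
move=> x /=; rewrite in_itv /= => /andP[x0 xa].
rewrite lee_fin (ger0_norm (_ : 0 <= `|q x| + c)) ?addr_ge0 //.
by apply: le_trans (ler_normD _ _) _; rewrite lerD2l; exact: amplitude_corr_le.
Qed.

Lemma cexp_scale (kap : R[i]) x : cexp (- (2 * x)%:C * kap) = cexp (x%:C * (- 2 * kap)).
Proof. by congr cexp; apply: complexP; rewrite !cparts /=; ring. Qed.

Lemma cac_scaled_cexp a b (kap : R[i]) :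
  cac a b (fun x => cexp (- (2 * x)%:C * kap)) (fun x => - 2 * kap * cexp (- (2 * x)%:C * kap)).
Proof.
by apply: (cac_eq (cac_cexp a b (- 2 * kap))) => x _; rewrite cexp_scale.
Qed.

Let measurable_comb d (T : measurableType d) (e f g h i j : T -> R) :
  measurable_fun setT e -> measurable_fun setT f -> measurable_fun setT g ->
  measurable_fun setT h -> measurable_fun setT i -> measurable_fun setT j ->
  measurable_fun setT (fun x => e x * (f x * g x + h x * (i x * j x))).
Proof.
move=> me mf mg mh mi mj; apply: measurable_funM => //; apply: measurable_funD.
  exact: measurable_funM.
by apply: measurable_funM => //; exact: measurable_funM.
Qed.

(** Fubini needs [F] and [G] measurable on the whole line; these extra hypotheses are discharged in
    [amplitude_identity]. *)
Let identity_measurable (a : R) (kap : R[i]) (F G : R -> R[i]) : 0 <= a ->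
  measurable_fun setT (fun x => Re (F x)) -> measurable_fun setT (fun x => Im (F x)) ->
  measurable_fun setT (fun x => Re (G x)) -> measurable_fun setT (fun x => Im (G x)) ->
  cac 0 a F (fun x => (q x)%:C * G x) ->
  cac 0 a G (fun x => F x - 2 * kap * G x) ->
  cintegral `[0, a] (fun x => (q x)%:C * G x) =
  G 0 * cintegral `[0, a] (fun x => (amplitude x)%:C * cexp (- (2 * x)%:C * kap)) -
  2 * cintegral `[0, a] (fun y => (k a y)%:C * cexp (- (2 * y)%:C * kap) * F (a - y)).
Proof.
move=> a0 mF1 mF2 mG1 mG2 hF hG.
pose E x := cexp (- (2 * x)%:C * kap).
(* [H] is a derivative in each variable: in [xi] of [E eta * k * F (xi - eta)], and in [eta] of
   [- dk * E eta * G (xi - eta)]. In the second case the [2 kap G] from [G'] cancels the derivative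
   of [E], which is why [E] carries the factor 2 in the exponent. *)
pose H xi eta := E eta * ((dk xi eta)%:C * F (xi - eta) + (k xi eta)%:C * ((q (xi - eta))%:C * G (xi - eta))).
have s1 eta : 0 <= eta <= a -> cintegrable `[eta, a] (fun xi => H xi eta) /\
    (k a eta)%:C * E eta * F (a - eta) = cintegral `[eta, a] (fun xi => H xi eta).
  move=> /andP[e0 ea].
  have hFs : cac eta a (fun t => F (t - eta)) (fun t => (q (t - eta))%:C * G (t - eta)).
    by apply: (@cac_shift _ eta eta a F (fun x => (q x)%:C * G x)); apply: cacW hF _ _; lra.
  have h := cacZ (E eta) (cacM (cac_real (rac_goursat mq qi a e0)) hFs).
  split; first exact: cac_integrable h.
  by rewrite -(cac_sub h (lexx _) ea (lexx _)) goursat_diag // mul0r mulr0 subr0; ring.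
pose c : R[i] := (2^-1 : R)%:C.
have s2 xi : 0 <= xi <= a -> cintegrable `[0, xi] (H xi) /\
    cintegral `[0, xi] (H xi) =
    c * G 0 * ((amplitude xi)%:C * E xi) + - c * ((q xi)%:C * G xi).
  move=> /andP[x0 xa].
  have hGr : cac 0 xi (fun t => G (xi - t)) (fun t => - (F (xi - t) - 2 * kap * G (xi - t))).
    by apply: (@cac_reflect _ xi 0 xi G (fun x => F x - 2 * kap * G x)); apply: cacW hG _ _; lra.
  have h := cacN (cacM (cac_real (rac_goursat_dx mq qi xi)) (cacM (cac_scaled_cexp 0 xi kap) hGr)).
  have h' : cac 0 xi (fun t => - ((dk xi t)%:C * (E t * G (xi - t)))) (H xi).
    apply: (cac_eq h) => // t _.
    by rewrite /H -/(E t) !rmorphN !rmorphM /=; ring.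
  split; first exact: cac_integrable h'.
  rewrite -(cac_sub h' (lexx _) x0 (lexx _)) subrr subr0.
  (* The end [eta = xi] of the integration produces the term with [A], the end [eta = 0] the term
     with [q]. *)
  have -> : dk xi xi = - 2^-1 * amplitude xi by rewrite amplitudeE; field.
  have -> : dk xi 0 = - 2^-1 * q xi by rewrite /goursat_dx set_itv1 Rintegral_set1 subr0.
  rewrite [E 0](_ : _ = 1); last by rewrite /E mulr0 oppr0 mul0r cexp0.
  by rewrite mulNr mulNr !rmorphN !rmorphM /= -/c; ring.
have [ME ME0 hE] := cac_bounded (cac_scaled_cexp 0 a kap).
have [MF MF0 hFb] := cac_bounded hF.
have [MG MG0 hGb] := cac_bounded hG.
have C0 := goursat_bound_ge0 q a; have Q0 := absq_int_ge0 q a.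
pose b1 xi := ME * ((2^-1 * `|q xi| + goursat_bound q a * absq_int q a) * MF).
pose b2 := ME * (goursat_bound q a * MG).
have b20 : 0 <= b2 by rewrite !mulr_ge0.
have b10 x : 0 <= b1 x.
  by rewrite mulr_ge0 // mulr_ge0 // addr_ge0 // mulr_ge0 // invr_ge0.
have b1i : mu.-integrable `[0, a] (EFin \o b1).
  have h1 := integrableZl (mitv _) (ME * MF * 2^-1) (absq_integrable qi a).
  have := integrableD (mitv _) h1 (cst_integrable (ME * MF * (goursat_bound q a * absq_int q a)) 0 a).
  apply: eq_integrable => // x _; rewrite /= -EFinM -EFinD /b1; congr EFin; ring.
have Hb xi eta : 0 <= eta -> eta <= xi -> xi <= a ->
    normc (H xi eta) <= b1 xi + b2 * `|q (xi - eta)|.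
  move=> e0 ex xa; rewrite /H normcM /b1 /b2.
  have d0 : 0 <= xi - eta <= a by rewrite subr_ge0 ex /=; lra.
  have -> : ME * ((2^-1 * `|q xi| + goursat_bound q a * absq_int q a) * MF) +
      ME * (goursat_bound q a * MG) * `|q (xi - eta)| =
    ME * ((2^-1 * `|q xi| + goursat_bound q a * absq_int q a) * MF +
      goursat_bound q a * (`|q (xi - eta)| * MG)) by ring.
  apply: ler_pM; rewrite ?normc_ge0 //.
    by apply: hE; rewrite e0 (le_trans ex).
  apply: le_trans (le_normcD _ _) _; rewrite !normcM !normcC; apply: lerD.
    apply: ler_pM; rewrite ?normc_ge0 //; last exact: hFb.
    exact: goursat_dx_le.
  apply: ler_pM; rewrite ?mulr_ge0 ?normc_ge0 //.
    by apply: goursat_le => //; exact: le_trans ex xa.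
  by rewrite ler_wpM2l // hGb.
have c1 (d : R) : continuous (fun x : R => x * d).
  by move=> x; apply: cvgM; [exact: cvg_id|exact: cvg_cst].
have mE1 : measurable_fun setT (fun x => Re (E x)).
  have -> : (fun x => Re (E x)) = fun x => expR (x * Re (- 2 * kap)) * cos (x * Im (- 2 * kap)).
    by apply/funext => x; rewrite /E cexp_scale /cexp /= (cReM x%:C) (cImM x%:C) cReC cImC !mul0r subr0 addr0.
  by apply: measurable_funM; apply: continuous_measurable_fun => x; apply: continuous_comp;
    [exact: c1|exact: continuous_expR|exact: c1|exact: continuous_cos].
have mE2 : measurable_fun setT (fun x => Im (E x)).
  have -> : (fun x => Im (E x)) = fun x => expR (x * Re (- 2 * kap)) * sin (x * Im (- 2 * kap)).
    by apply/funext => x; rewrite /E cexp_scale /cexp /= (cReM x%:C) (cImM x%:C) cReC cImC !mul0r subr0 addr0.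
  by apply: measurable_funM; apply: continuous_measurable_fun => x; apply: continuous_comp;
    [exact: c1|exact: continuous_expR|exact: c1|exact: continuous_sin].
have p1 : measurable_fun setT (fun p : RR => p.1) by exact: measurable_fst.
have p2 : measurable_fun setT (fun p : RR => p.2) by exact: measurable_snd.
have p12 : measurable_fun setT (fun p : RR => p.1 - p.2 : R) by exact: measurable_funB.
have mq' : measurable_fun setT (fun p : RR => q (p.1 - p.2)) by exact: (measurableT_comp mq).
have mk : measurable_fun setT (fun p : RR => k p.1 p.2) by exact: measurable_goursat.
have mdk : measurable_fun setT (fun p : RR => dk p.1 p.2) by exact: measurable_goursat_dx.
have mE1' : measurable_fun setT (fun p : RR => Re (E p.2)) by exact: (measurableT_comp mE1).
have mE2' : measurable_fun setT (fun p : RR => Im (E p.2)) by exact: (measurableT_comp mE2).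
have mF1' : measurable_fun setT (fun p : RR => Re (F (p.1 - p.2))) by exact: (measurableT_comp mF1).
have mF2' : measurable_fun setT (fun p : RR => Im (F (p.1 - p.2))) by exact: (measurableT_comp mF2).
have mG1' : measurable_fun setT (fun p : RR => Re (G (p.1 - p.2))) by exact: (measurableT_comp mG1).
have mG2' : measurable_fun setT (fun p : RR => Im (G (p.1 - p.2))) by exact: (measurableT_comp mG2).
have s3 : cintegral `[0, a] (fun eta => cintegral `[eta, a] (fun xi => H xi eta)) =
    cintegral `[0, a] (fun xi => cintegral `[0, xi] (H xi)).
  apply: complexP => /=; apply: (fubini_triangle mq qi a0 b20 b10 b1i).
  - have -> : (fun p : RR => Re (H p.1 p.2)) = (fun p =>
      Re (E p.2) * (dk p.1 p.2 * Re (F (p.1 - p.2)) + k p.1 p.2 * (q (p.1 - p.2) * Re (G (p.1 - p.2)))) -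
      Im (E p.2) * (dk p.1 p.2 * Im (F (p.1 - p.2)) + k p.1 p.2 * (q (p.1 - p.2) * Im (G (p.1 - p.2))))).
      by apply/funext => p; rewrite /H (cReM (E _)) cReD cImD !(cReM _%:C) !(cImM _%:C) !cReC !cImC; ring.
    by apply: measurable_funB; apply: measurable_comb.
  - by move=> xi eta e0 ex xa; apply: le_trans (normc_ge_absRe _) (Hb _ _ _ _ _).
  - by move=> eta h; have [[]] := s1 eta h.
  - by move=> xi h; have [[]] := s2 xi h.
  - have -> : (fun p : RR => Im (H p.1 p.2)) = (fun p =>
      Re (E p.2) * (dk p.1 p.2 * Im (F (p.1 - p.2)) + k p.1 p.2 * (q (p.1 - p.2) * Im (G (p.1 - p.2)))) +
      Im (E p.2) * (dk p.1 p.2 * Re (F (p.1 - p.2)) + k p.1 p.2 * (q (p.1 - p.2) * Re (G (p.1 - p.2))))).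
      by apply/funext => p; rewrite /H (cImM (E _)) cReD cImD !(cReM _%:C) !(cImM _%:C) !cReC !cImC; ring.
    by apply: measurable_funD; apply: measurable_comb.
  - by move=> xi eta e0 ex xa; apply: le_trans (normc_ge_absIm _) (Hb _ _ _ _ _).
  - by move=> eta h; have [[]] := s1 eta h.
  - by move=> xi h; have [[]] := s2 xi h.
have iA : cintegrable `[0, a] (fun x => (amplitude x)%:C * E x).
  have := cac_integrableM (cac_scaled_cexp 0 a kap) (cintegrable_real (amplitude_integrable a)).
  apply: eq_cintegrable; first exact: mitv.
  by move=> x _; exact: mulrC.
have iG : cintegrable `[0, a] (fun x => (q x)%:C * G x) by exact: cac_integrable hF.
have l : cintegral `[0, a] (fun y => (k a y)%:C * E y * F (a - y)) =
    c * G 0 * cintegral `[0, a] (fun x => (amplitude x)%:C * E x) +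
    - c * cintegral `[0, a] (fun x => (q x)%:C * G x).
  rewrite (eq_cintegral (g := fun eta => cintegral `[eta, a] (fun xi => H xi eta))); last first.
    by move=> eta /set_mem /=; rewrite in_itv /= => h; have [] := s1 eta h.
  rewrite s3 (eq_cintegral (g := fun xi =>
     c * G 0 * ((amplitude xi)%:C * E xi) + - c * ((q xi)%:C * G xi))); last first.
    by move=> xi /set_mem /=; rewrite in_itv /= => h; have [] := s2 xi h.
  exact: (cintegral_lin _ _ (mitv _) iA iG).
have c2 : 2 * c = 1.
  by apply: complexP; rewrite /c !cparts /=; field.
rewrite l mulrDr !mulrA c2 mul1r mulrN c2 mulN1r; ring.
Qed.

(** Multiplying [F] and [G] by the indicator of [[0, a]] makes them measurable everywhere. The
    hypotheses and the conclusion see them on [[0, a]] only, as [a - y] stays in this interval. *)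
Lemma amplitude_identity (a : R) (kap : R[i]) (F G : R -> R[i]) : 0 <= a ->
  cac 0 a F (fun x => (q x)%:C * G x) ->
  cac 0 a G (fun x => F x - 2 * kap * G x) ->
  cintegral `[0, a] (fun x => (q x)%:C * G x) =
  G 0 * cintegral `[0, a] (fun x => (amplitude x)%:C * cexp (- (2 * x)%:C * kap)) -
  2 * cintegral `[0, a] (fun y => (k a y)%:C * cexp (- (2 * y)%:C * kap) * F (a - y)).
Proof.
move=> a0 hF hG.
pose i x : R[i] := (lei 0 x * lei x a)%:C.
have i1 x : 0 <= x <= a -> i x = 1.
  by move=> /andP[x0 xa]; rewrite /i !leiT // mulr1.
have mpatch (h : R -> R) : {within `[0, a], continuous h} ->
    measurable_fun setT (fun x => h x * (lei 0 x * lei x a)).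
  move=> ch; rewrite lei_patch; apply/(measurable_restrictT h); first exact: measurable_itv.
  by apply: subspace_continuous_measurable_fun.
have [cF1 cF2] := cac_continuous a0 hF; have [cG1 cG2] := cac_continuous a0 hG.
have Rei (h : R -> R[i]) : (fun x => Re (i x * h x)) = (fun x => Re (h x) * (lei 0 x * lei x a)).
  by apply/funext => x; rewrite /i cReM cReC cImC mul0r subr0 mulrC.
have Imi (h : R -> R[i]) : (fun x => Im (i x * h x)) = (fun x => Im (h x) * (lei 0 x * lei x a)).
  by apply/funext => x; rewrite /i cImM cReC cImC mul0r addr0 mulrC.
have := @identity_measurable a kap (fun x => i x * F x) (fun x => i x * G x) a0.
rewrite !Rei !Imi => /(_ (mpatch _ cF1) (mpatch _ cF2) (mpatch _ cG1) (mpatch _ cG2)).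
have h1 : cac 0 a (fun x => i x * F x) (fun x => (q x)%:C * (i x * G x)).
  by apply: (cac_eq hF) => x xa; rewrite i1 // mul1r.
have h2 : cac 0 a (fun x => i x * G x) (fun x => i x * F x - 2 * kap * (i x * G x)).
  by apply: (cac_eq hG) => x xa; rewrite i1 // !mul1r.
move=> /(_ h1 h2); rewrite (i1 0) ?lexx // mul1r.
rewrite (eq_cintegral (g := fun x => (q x)%:C * G x)); last first.
  by move=> x /set_mem /=; rewrite in_itv /= => xa; rewrite i1 // mul1r.
move=> ->; congr (_ - 2 * _); apply: eq_cintegral => x /set_mem /=.
rewrite in_itv /= => /andP[x0 xa]; rewrite i1 ?mul1r //.
by rewrite subr_ge0 xa /= gerBl.
Qed.

End KeyIdentity.

(** * Size and continuity of [A - q] *)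

Section AmplitudeContinuity.
Context {R : realType}.
Notation mu := (@lebesgue_measure R).
Variable q : R -> R.
Hypothesis mq : measurable_fun setT q.
Hypothesis qi : forall a, mu.-integrable `[0, a] (EFin \o q).
Notation k := (goursat mq qi).
Notation dk := (goursat_dx mq qi).
Notation C := (goursat_bound q).
Notation Q := (absq_int q).

(** Twice [Q x] times the bound [2^-1 * Q x * expR (Q x * x)] of the kernel. *)
Lemma amplitude_corr_bound x : 0 <= x ->
  `|amplitude_corr mq qi x| <= Q x ^+ 2 * expR (x * Q x).
Proof.
move=> x0; apply: le_trans (amplitude_corr_le mq qi x0 (lexx x)) _.
by rewrite /goursat_bound [x * _]mulrC le_eqVlt; apply/orP; left; apply/eqP; field.
Qed.

(** Up to sign, [goursat_dx] without its term in [q]. It is bounded, so its integrals are small in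
    proportion to the length; the integral of the [q] term is only absolutely continuous and is
    estimated apart. *)
Let J s eta := \int[mu]_(y in `[0, eta]) (q (s - y) * k s y).

Let goursatJ a eta xi : 0 <= eta -> xi <= a ->
  mu.-integrable `[eta, a] (EFin \o (fun s => J s eta)) /\
  k xi eta = - 2^-1 * (\int[mu]_(s in `[eta, xi]) q s) - \int[mu]_(s in `[eta, xi]) J s eta.
Proof.
move=> e0 xa.
have qe : mu.-integrable `[eta, a] (EFin \o (fun s => - 2^-1 * q s)).
  have := integrableZl (mitv _) (- 2^-1) (integrable_itvS (qi a) e0 (lexx a)).
  by apply: eq_integrable => // s _; rewrite /= EFinM.
have [di _] := goursatE mq qi a e0.
have Ji : mu.-integrable `[eta, a] (EFin \o (fun s => J s eta)).
  have := integrableB (mitv _) qe di; apply: eq_integrable => // s _.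
  by rewrite /= -EFinB /goursat_dx /J; congr EFin; ring.
split => //; have [_ ->] := goursatE mq qi xi e0.
rewrite -RintegralZl //; last exact: integrable_itvS (qi a) e0 xa.
rewrite -RintegralB //; first exact: integrable_itvS qe (lexx _) xa.
exact: integrable_itvS Ji (lexx _) xa.
Qed.

Let J_int_le a eta x y : 0 <= eta -> eta <= x -> x <= y -> y <= a ->
  `|\int[mu]_(s in `[x, y]) J s eta| <= C a * Q a * (y - x).
Proof.
move=> e0 ex xy ya.
have [Ji _] := goursatJ e0 (lexx a).
have Ji' : mu.-integrable `[x, y] (EFin \o (fun s => J s eta)).
  exact: integrable_itvS Ji ex ya.
apply: le_trans (le_normr_Rintegral (mitv _) Ji') _.
rewrite -Rintegral_itv_cst //; apply: le_Rintegral => //.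
- exact: integrable_norm Ji'.
- exact: cst_integrable.
- move=> s /=; rewrite in_itv /= => /andP[xs sy].
  by apply: qk_int_le => //; [exact: le_trans ex xs|exact: le_trans sy ya].
Qed.

Let small_q a (e : R) : 0 < e -> exists2 d : R, 0 < d &
  forall s t, 0 <= s -> s <= t -> t <= a -> t - s < d ->
    \int[mu]_(x in `[s, t]) `|q x| < e.
Proof. exact: integral_small. Qed.

Let J_eta_le a (e d : R) s eta1 eta2 :
  (forall s t, 0 <= s -> s <= t -> t <= a -> t - s < d ->
    \int[mu]_(x in `[s, t]) `|q x| < e) ->
  0 <= eta1 -> eta1 <= eta2 -> eta2 <= s -> s <= a -> eta2 - eta1 < d ->
  `|J s eta2 - J s eta1| <= C a * e.
Proof.
move=> hd e0 e12 e2s sa ed.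
have a0 : 0 <= a by lra.
have qk := qk_integrable mq qi e2s.
rewrite /J (Rintegral_itv_cat qk e0 e12) addrAC subrr add0r.
have qk' := integrable_itvS qk e0 (lexx _).
have qr := integrable_itvS (reflect_q_integrable mq qi e2s) e0 (lexx eta2).
apply: le_trans (le_normr_Rintegral (mitv _) qk') _.
apply: le_trans (_ : \int[mu]_(y in `[eta1, eta2]) (C a * `|q (s - y)|) <= _).
  apply: le_Rintegral => //.
  - exact: integrable_norm qk'.
  - have := integrableZl (mitv _) (C a) (integrable_norm qr).
    by apply: eq_integrable => // y _; rewrite /= EFinM.
  - move=> y /=; rewrite in_itv /= => /andP[y1 y2].
    by rewrite normrM mulrC ler_wpM2r //; apply: goursat_le => //; lra.
rewrite RintegralZl //; last exact: integrable_norm qr.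
rewrite ler_wpM2l ?goursat_bound_ge0 //.
rewrite (@Rintegral_itv_reflect _ (fun t => `|q t|)); last first.
  by apply: measurable_funTS; exact: measurableT_comp.
by apply: ltW; apply: hd; lra.
Qed.

(* Stated on variables: [lra] would compare integrals up to conversion. *)
Let cut4 (A B D E F : R) : E = A + B -> E = D + F -> B - D = F - A.
Proof. by lra. Qed.

Let half_le (A B : R) : A <= 2 * B -> 2^-1 * A <= B.
Proof. by rewrite ler_pdivrMl. Qed.

Let cut6 (A B D E : R) : - 2^-1 * A - B - (- 2^-1 * D - E) = - 2^-1 * (A - D) - (B - E).
Proof. by ring. Qed.

Let cut5 (A B D F G H I : R) : B = G + F -> D = A + H -> I = G - H ->
  B - D = I + F - A.
Proof. by lra. Qed.

(** Both values of [k] are integrals over windows of length [y], displaced by [x2 - x1]. The term in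
    [q] contributes [e], the two end pieces of the [J] integrals [2 * e], and the change of [eta]
    inside [J], over an overlap of length at most [a], contributes [C a * a * e]. *)
Let goursat_diff_le a (e d : R) x1 x2 y : 0 < e ->
  (forall s t, 0 <= s -> s <= t -> t <= a -> t - s < d ->
    \int[mu]_(x in `[s, t]) `|q x| < e) ->
  C a * Q a * d <= e ->
  0 <= y -> y <= x1 -> x1 <= x2 -> x2 <= a -> x2 - x1 < d ->
  `|k x2 (x2 - y) - k x1 (x1 - y)| <= (3 + C a * a) * e.
Proof.
move=> e0 hd CQ y0 yx1 x12 x2a xd.
have a0 : 0 <= a by lra.
have CQ0 : 0 <= C a * Q a by rewrite mulr_ge0 ?goursat_bound_ge0 ?absq_int_ge0.
have CQx (t : R) : t <= d -> C a * Q a * t <= e.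
  by move=> td; apply: le_trans CQ; rewrite ler_wpM2l.
have [n1 n1E] : exists n1, n1 = x1 - y by exists (x1 - y).
have [n2 n2E] : exists n2, n2 = x2 - y by exists (x2 - y).
have n10 : 0 <= n1 by lra.
have n12 : n1 <= n2 by lra.
have n20 : 0 <= n2 by lra.
have nd : n2 - n1 < d by lra.
have n1x1 : n1 <= x1 by lra.
have n2x2 : n2 <= x2 by lra.
have n1x2 : n1 <= x2 by lra.
have x1a : x1 <= a by lra.
have x10 : 0 <= x1 by lra.
have n2a : n2 <= a by lra.
have x1n2a : x1 - n2 <= a by lra.
have yd : x1 < n2 -> x2 - n2 <= d /\ x1 - n1 <= d by move=> h; split; lra.
have [J2i k2] := goursatJ n20 x2a.
have [J1i k1] := goursatJ n10 (le_trans x12 x2a).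
have qn s t : 0 <= s -> s <= t -> t <= a -> t - s < d -> `|\int[mu]_(x in `[s, t]) q x| <= e.
  move=> s0 st ta std; apply: ltW; apply: le_lt_trans (hd s t s0 st ta std).
  by apply: le_normr_Rintegral => //; exact: integrable_itvS (qi a) s0 ta.
have qd : `|\int[mu]_(s in `[n2, x2]) q s - \int[mu]_(s in `[n1, x1]) q s| <= 2 * e.
  have c1 : \int[mu]_(s in `[n1, x2]) q s = \int[mu]_(s in `[n1, n2]) q s + \int[mu]_(s in `[n2, x2]) q s.
    exact: (Rintegral_itv_cat (integrable_itvS (qi a) n10 x2a) n12 n2x2).
  have c2 : \int[mu]_(s in `[n1, x2]) q s = \int[mu]_(s in `[n1, x1]) q s + \int[mu]_(s in `[x1, x2]) q s.
    exact: (Rintegral_itv_cat (integrable_itvS (qi a) n10 x2a) n1x1 x12).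
  have -> : \int[mu]_(s in `[n2, x2]) q s - \int[mu]_(s in `[n1, x1]) q s =
     \int[mu]_(s in `[x1, x2]) q s - \int[mu]_(s in `[n1, n2]) q s by exact: (cut4 c1 c2).
  rewrite mulr_natl mulr2n; apply: le_trans (ler_normB _ _) _.
  by apply: lerD; apply: qn.
have Jd : `|\int[mu]_(s in `[n2, x2]) J s n2 - \int[mu]_(s in `[n1, x1]) J s n1| <= (2 + C a * a) * e.
  (* Overlapping windows are compared on the overlap. If they are disjoint, their common length [y]
     is at most [d], and both integrals are small by themselves. *)
  case: (leP n2 x1) => nx.
    have c1 : \int[mu]_(s in `[n2, x2]) J s n2 = \int[mu]_(s in `[n2, x1]) J s n2 + \int[mu]_(s in `[x1, x2]) J s n2.
      exact: (Rintegral_itv_cat (integrable_itvS J2i (lexx _) x2a) nx x12).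
    have c2 : \int[mu]_(s in `[n1, x1]) J s n1 = \int[mu]_(s in `[n1, n2]) J s n1 + \int[mu]_(s in `[n2, x1]) J s n1.
      exact: (Rintegral_itv_cat (integrable_itvS J1i (lexx _) x1a) n12 nx).
    have i2 : mu.-integrable `[n2, x1] (EFin \o (fun s => J s n2)).
      exact: (integrable_itvS J2i (lexx _) x1a).
    have i1 : mu.-integrable `[n2, x1] (EFin \o (fun s => J s n1)).
      exact: (integrable_itvS J1i n12 x1a).
    have c3 : \int[mu]_(s in `[n2, x1]) (J s n2 - J s n1) =
       \int[mu]_(s in `[n2, x1]) J s n2 - \int[mu]_(s in `[n2, x1]) J s n1.
      exact: RintegralB.
    have b1 : `|\int[mu]_(s in `[x1, x2]) J s n2| <= e.
      by apply: le_trans (J_int_le n20 nx x12 x2a) _; apply: CQx; exact: ltW.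
    have b2 : `|\int[mu]_(s in `[n1, n2]) J s n1| <= e.
      by apply: le_trans (J_int_le n10 (lexx _) n12 n2a) _; apply: CQx; exact: ltW.
    have b3 : `|\int[mu]_(s in `[n2, x1]) (J s n2 - J s n1)| <= C a * a * e.
      have id : mu.-integrable `[n2, x1] (EFin \o (fun s => J s n2 - J s n1)).
        have := integrableB (mitv _) i2 i1; by apply: eq_integrable.
      apply: le_trans (le_normr_Rintegral (mitv _) id) _.
      apply: le_trans (_ : C a * e * (x1 - n2) <= _).
        rewrite -Rintegral_itv_cst //; apply: le_Rintegral => //.
        - exact: integrable_norm id.
        - exact: cst_integrable.
        - move=> s /=; rewrite in_itv /= => /andP[s1 s2].
          exact: (J_eta_le hd n10 n12 s1 (le_trans s2 x1a) nd).
      by rewrite mulrAC ler_wpM2r ?(ltW e0) // ler_wpM2l ?goursat_bound_ge0.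
    have -> : \int[mu]_(s in `[n2, x2]) J s n2 - \int[mu]_(s in `[n1, x1]) J s n1 =
      \int[mu]_(s in `[n2, x1]) (J s n2 - J s n1) + \int[mu]_(s in `[x1, x2]) J s n2 - \int[mu]_(s in `[n1, n2]) J s n1.
      exact: (cut5 c1 c2 c3).
    rewrite (_ : (2 + C a * a) * e = C a * a * e + e + e); last by ring.
    apply: le_trans (ler_normB _ _) _.
    exact: lerD (le_trans (ler_normD _ _) (lerD b3 b1)) b2.
  have [yd2 yd1] := yd nx.
  have b1 : `|\int[mu]_(s in `[n2, x2]) J s n2| <= e.
    by apply: le_trans (J_int_le n20 (lexx _) n2x2 x2a) _; exact: CQx.
  have b2 : `|\int[mu]_(s in `[n1, x1]) J s n1| <= e.
    by apply: le_trans (J_int_le n10 (lexx _) n1x1 x1a) _; exact: CQx.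
  apply: le_trans (ler_normB _ _) _.
  apply: le_trans (lerD b1 b2) _.
  rewrite mulrDl mulr_natl mulr2n lerDl.
  by rewrite mulr_ge0 ?(ltW e0) // mulr_ge0 ?goursat_bound_ge0.
rewrite -n1E -n2E k1 k2.
rewrite cut6.
apply: le_trans (ler_normB _ _) _.
rewrite (_ : (3 + C a * a) * e = e + (2 + C a * a) * e); last by ring.
apply: lerD => //; rewrite normrM normrN [X in X * _](@ger0_norm _ 2^-1) ?invr_ge0 //.
exact: half_le.
Qed.

(** The reflection [y -> x - y] frees the argument of [q] from [x]. Since [q] is merely integrable,
    continuity in [x] has to come from [k] and from the range of integration. *)
Let corrE x : amplitude_corr mq qi x = 2 * \int[mu]_(y in `[0, x]) (q y * k x (x - y)).
Proof.
rewrite /amplitude_corr; congr (2 * _).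
have m1 : measurable_fun setT (fun y : R => q y * k x (x - y)).
  apply: measurable_funM => //; apply: (measurableT_comp (measurable_goursat2 mq qi x)).
  exact: measurable_funB.
have := @Rintegral_itv_reflect R (fun y => q y * k x (x - y)) x 0 x.
rewrite subrr subr0 => <-; last exact: measurable_funTS.
by apply: eq_Rintegral => y _; rewrite subKr.
Qed.

Let corr_integrable x a : 0 <= x -> x <= a ->
  mu.-integrable `[0, x] (EFin \o (fun y => q y * k x (x - y))).
Proof.
move=> x0 xa.
have h : mu.-integrable `[0, x] (EFin \o (fun y => k x (x - y) * q y)).
  apply: bounded_integrableM => //.
    apply: measurable_funTS; apply: (measurableT_comp (measurable_goursat2 mq qi x)).
    exact: measurable_funB.
  by exists (C a) => y /andP[y0 yx]; apply: goursat_le => //; lra.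
by apply: eq_integrable h => // y _; rewrite /= mulrC.
Qed.

Lemma amplitude_corr_unif_continuous a (e : R) : 0 <= a -> 0 < e ->
  exists2 d : R, 0 < d & forall x1 x2, 0 <= x1 -> x1 <= x2 -> x2 <= a ->
    x2 - x1 < d -> `|amplitude_corr mq qi x2 - amplitude_corr mq qi x1| < e.
Proof.
move=> a0 e0.
have C0 := goursat_bound_ge0 q a; have Q0 := absq_int_ge0 q a.
have CQ0 : 0 <= C a * Q a by rewrite mulr_ge0.
(* The first summand accounts for the change of [k] on [[0, x1]], the second for the additional
   piece [[x1, x2]]. *)
pose K := 2 * (Q a * (3 + C a * a) + C a).
have K0 : 0 <= K by rewrite mulr_ge0 // addr_ge0 // mulr_ge0 // addr_ge0 // mulr_ge0.
pose e' := e / (K + 1).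
have e'0 : 0 < e' by rewrite divr_gt0 // ltr_wpDl.
have [d1 d10 hd1] := small_q a e'0.
(* The second bound gives [C a * Q a * d <= e']; adding 1 to the denominator avoids division by
   0. *)
pose d := Num.min d1 (e' / (C a * Q a + 1)).
have d0 : 0 < d by rewrite lt_min d10 divr_gt0 // ltr_wpDl.
have hd s t : 0 <= s -> s <= t -> t <= a -> t - s < d -> \int[mu]_(x in `[s, t]) `|q x| < e'.
  move=> s0 st ta std; apply: hd1 => //; apply: lt_le_trans std _.
  by rewrite /d ge_min lexx.
have hC : C a * Q a * d <= e'.
  apply: le_trans (_ : C a * Q a * (e' / (C a * Q a + 1)) <= _).
    by rewrite ler_wpM2l // /d ge_min lexx orbT.
  rewrite mulrCA -[leRHS]mulr1 ler_wpM2l ?(ltW e'0) //.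
  by rewrite ler_pdivrMr ?ltr_wpDl // mul1r lerDl.
exists d => // x1 x2 x10 x12 x2a xd.
rewrite !corrE -mulrBr normrM ger0_norm //.
have x20 : 0 <= x2 by lra.
have x1a : x1 <= a by lra.
have i2 := corr_integrable x20 x2a.
have i2' := integrable_itvS i2 (lexx 0) x12.
have i2'' := integrable_itvS i2 x10 (lexx x2).
have i1 := corr_integrable x10 x1a.
rewrite (Rintegral_itv_cat i2 x10 x12) addrAC -RintegralB //.
have q1 : mu.-integrable `[0, x1] (EFin \o (fun y => `|q y|)) by exact: absq_integrable.
have b1 : `|\int[mu]_(y in `[0, x1]) (q y * k x2 (x2 - y) - q y * k x1 (x1 - y))| <=
    Q a * ((3 + C a * a) * e').
  have id : mu.-integrable `[0, x1] (EFin \o (fun y => q y * k x2 (x2 - y) - q y * k x1 (x1 - y))).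
    have := integrableB (mitv _) i2' i1; by apply: eq_integrable.
  apply: le_trans (le_normr_Rintegral (mitv _) id) _.
  apply: le_trans (_ : \int[mu]_(y in `[0, x1]) ((3 + C a * a) * e' * `|q y|) <= _).
    apply: le_Rintegral => //.
    - exact: integrable_norm id.
    - have := integrableZl (mitv _) ((3 + C a * a) * e') q1.
      by apply: eq_integrable => // s _; rewrite /= EFinM.
    - move=> y /=; rewrite in_itv /= => /andP[y0 yx1].
      rewrite -mulrBr normrM mulrC ler_wpM2r //.
      exact: (goursat_diff_le e'0 hd hC).
  rewrite RintegralZl // mulrC ler_wpM2r //.
    by rewrite mulr_ge0 ?(ltW e'0) // addr_ge0 // mulr_ge0.
  exact: le_absq_int.
have b2 : `|\int[mu]_(y in `[x1, x2]) (q y * k x2 (x2 - y))| <= C a * e'.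
  apply: le_trans (le_normr_Rintegral (mitv _) i2'') _.
  have q2 : mu.-integrable `[x1, x2] (EFin \o (fun y => `|q y|)).
    exact: integrable_itvS (absq_integrable qi a) x10 x2a.
  apply: le_trans (_ : \int[mu]_(y in `[x1, x2]) (C a * `|q y|) <= _).
    apply: le_Rintegral => //.
    - exact: integrable_norm i2''.
    - have := integrableZl (mitv _) (C a) q2.
      by apply: eq_integrable => // s _; rewrite /= EFinM.
    - move=> y /=; rewrite in_itv /= => /andP[y0 yx1].
      rewrite normrM mulrC ler_wpM2r //.
      by apply: goursat_le => //; lra.
  rewrite RintegralZl // ler_wpM2l //.
  by apply: ltW; exact: hd.
apply: le_lt_trans (_ : K * e' < _).
  rewrite /K -mulrA ler_wpM2l //.
  apply: le_trans (ler_normD _ _) _.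
  rewrite (_ : (Q a * (3 + C a * a) + C a) * e' = Q a * ((3 + C a * a) * e') + C a * e'); last by ring.
  exact: lerD b1 b2.
rewrite /e' mulrCA -[ltRHS]mulr1 ltr_pM2l // ltr_pdivrMr ?ltr_wpDl //.
by rewrite mul1r ltrDl.
Qed.

End AmplitudeContinuity.

(** * Solutions of the differential equation *)

Section ComplexLimits.
Context {R : realType}.
Implicit Types (f g : R -> R[i]) (l : R[i]).

(** A positive element of [R[i]] has zero imaginary part, so the radii of its topology are real
    numbers. *)
Lemma ccvgP {T : Type} (F : set_system T) {FF : Filter F} (f : T -> R[i]) l :
  ccvg F f l <-> forall e : R, 0 < e -> \forall x \near F, normc (l - f x) < e.
Proof.
split.
  move=> /cvgrPdist_lt h e e0.
  have e0' : (0 : R[i]^o) < e%:C by rewrite ltcR.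
  have := h _ e0'; apply: filterS => x; rewrite normc_def -/(normc _).
  by case: (l - f x) => a b /=; rewrite ltcR.
move=> h; apply/cvgrPdist_lt => -[er ei] /=; rewrite ltcE /= => /andP[/eqP -> e0].
have := h er e0; apply: filterS => x; rewrite normc_def ltcE /= eqxx /=.
by case: (l - f x).
Qed.

Lemma ccvg_parts {T : Type} (F : set_system T) {FF : Filter F} (f : T -> R[i]) l :
  Re (f x) @[x --> F] --> Re l -> Im (f x) @[x --> F] --> Im l -> ccvg F f l.
Proof.
move=> /cvgrPdist_lt h1 /cvgrPdist_lt h2; apply/ccvgP => e e0.
have e2 : 0 < e / 2 by rewrite divr_gt0.
near=> x; apply: le_lt_trans (normc_le_parts _) _.
rewrite cReD cReN cImD cImN [e]splitr; apply: ltrD; near: x; [exact: h1|exact: h2].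
Unshelve. all: by end_near. Qed.

Lemma lim_rightE f a l : ccvg a^'+ f l -> lim_right f a = l.
Proof. by move=> h; exact: cvg_lim h. Qed.

Lemma lim_leftE f a l : ccvg a^'- f l -> lim_left f a = l.
Proof. by move=> h; exact: cvg_lim h. Qed.

End ComplexLimits.

Section Primitive0.
Context {R : realType}.
Notation mu := (@lebesgue_measure R).
Implicit Types (f : R -> R) (a b x y : R).

Lemma rac_extend0 a f f' : 0 < a -> (forall x, 0 < x -> x <= a -> rac x a f f') ->
  mu.-integrable `[0, a] (EFin \o f') ->
  exists l : R, f x @[x --> 0^'+] --> l /\
    rac 0 a (fun x => if x == 0 then l else f x) f'.
Proof.
move=> a0 h fi.
pose l := f a - \int[mu]_(t in `[0, a]) f' t.
have fE x : 0 < x -> x <= a -> f x = l + \int[mu]_(t in `[0, x]) f' t.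
  move=> x0 xa; have e1 := rac_sub (h x x0 xa) (lexx _) xa (lexx _).
  have e2 := Rintegral_itv_cat fi (ltW x0) xa.
  by rewrite /l e2 -e1; ring.
exists l; split.
  have c := parameterized_integral_continuous (ltW a0) fi.
  have [_ c0 _] := (continuous_within_itvP _ a0).1 c.
  have c1 : (l + \int[mu]_(t in `[0, x]) f' t) @[x --> 0^'+] --> l + \int[mu]_(t in `[0, 0]) f' t.
    by apply: cvgD; [exact: cvg_cst|exact: c0].
  rewrite set_itv1 Rintegral_set1 addr0 in c1.
  apply: cvg_trans c1; apply: near_eq_cvg; near=> x; rewrite fE //.
  by apply: ltW; near: x; exact: nbhs_right_lt.
split => // x /andP[x0 xa]; rewrite eqxx.
have [->|xn0] := eqVneq x 0; first by rewrite set_itv1 Rintegral_set1 addr0.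
by rewrite fE // lt_neqAle eq_sym xn0.
Unshelve. all: by end_near. Qed.

Lemma integrable_itv_oc a b f : mu.-integrable `]a, b] (EFin \o f) ->
  mu.-integrable `[a, b] (EFin \o f).
Proof.
move=> /integrableP[mf fi]; apply/integrableP; split.
  exact/emeasurable_fun_itv_obnd_cbndP.
by rewrite -integral_itv_obnd_cbnd //; exact: measurableT_comp.
Qed.

Lemma rac_eq_oc a b f f' g g' : rac a b f f' ->
  (forall x, a <= x <= b -> f x = g x) -> (forall x, a < x <= b -> f' x = g' x) ->
  rac a b g g'.
Proof.
move=> [fi fE] fg fg'; split.
  have fi' : mu.-integrable `]a, b] (EFin \o f').
    by apply: integrableS fi => //; exact: subset_itv_oc_cc.
  apply: integrable_itv_oc; apply: eq_integrable fi' => //.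
  by move=> x; rewrite inE /= in_itv /= => xab; rewrite fg'.
move=> x /andP[ax xb]; rewrite -fg ?ax // -fg ?lexx ?(le_trans ax) //.
rewrite fE ?ax //; congr (_ + _).
have fi' := integrable_itvS fi (lexx a) xb.
have fi'' : mu.-integrable `]a, x] (EFin \o f').
  by apply: integrableS fi' => //; exact: subset_itv_oc_cc.
have gi : mu.-integrable `]a, x] (EFin \o g').
  apply: eq_integrable fi'' => // t; rewrite inE /= in_itv /= => /andP[at1 tx].
  by rewrite fg' // at1 (le_trans tx).
rewrite -(Rintegral_itv_obnd_cbnd fi'') -(Rintegral_itv_obnd_cbnd gi).
apply: eq_Rintegral => t; rewrite inE /= in_itv /= => /andP[at1 tx].
by rewrite fg' // at1 (le_trans tx).
Qed.

Lemma measurable_fun_itv_oc a f : (forall x, 0 < x -> x <= a -> measurable_fun `[x, a] f) ->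
  measurable_fun `[0, a] f.
Proof.
move=> h; case: (leP a 0) => a0.
  have [->|an0] := eqVneq a 0; first by rewrite set_itv1; exact: measurable_fun_set1.
  by rewrite set_itv_ge ?bnd_simp -?ltNge ?lt_neqAle ?an0 //; exact: measurable_fun_set0.
have -> : [set` `[0, a]] = [set 0] `|` \bigcup_n [set` `[a / n.+1%:R, a]].
  apply/seteqP; split => x /=; rewrite in_itv /=.
    move=> /andP[x0 xa]; have [->|xn0] := eqVneq x 0; [by left|right].
    have {xn0}x0 : 0 < x by rewrite lt_neqAle eq_sym xn0.
    exists (Num.bound (a / x)) => //=; rewrite in_itv /= xa andbT.
    rewrite ler_pdivrMr // mulrC -ler_pdivrMr //.
    apply: ltW; apply: lt_le_trans (archi_boundP _) _; first by rewrite divr_ge0 // ltW.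
    by rewrite ler_nat.
  move=> [->|[n _ /=]]; first by rewrite lexx ltW.
  by rewrite in_itv /= => /andP[nx ->]; rewrite (le_trans _ nx) // divr_ge0 // ltW.
apply/measurable_funU.
- exact: measurable_set1.
- by apply: bigcup_measurable => n _; exact: measurable_itv.
split; first exact: measurable_fun_set1.
apply/measurable_fun_bigcup; first by move=> n; exact: measurable_itv.
move=> n; apply: h; first exact: divr_gt0.
by rewrite ler_pdivrMr // ler_peMr ?(ltW a0) // ler1n.
Qed.

End Primitive0.

(** * The equation as a first-order system *)

Section Solutions.
Context {R : realType}.
Notation mu := (@lebesgue_measure R).
Implicit Types (q : R -> R) (z : R[i]) (u du v dv : R -> R[i]) (a b c x y : R).

(** The derivative is a separate function [du], not [cderiv u], so that an interval may include an
    endpoint such as 0, where both functions take one-sided limits as values. *)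
Definition sol q z a b u du :=
  cac a b u du /\ cac a b du (fun x => ((q x)%:C - z) * u x).

Lemma solW q z a b u du x y : sol q z a b u du -> a <= x -> y <= b -> sol q z x y u du.
Proof. by move=> [h1 h2] ax yb; split; [exact: cacW h1 _ _|exact: cacW h2 _ _]. Qed.

(** Up to the factor [2 i], the Wronskian of [conjc u] and [u]. *)
Definition wronsk (u du : R -> R[i]) x : R := Im (du x * conjc (u x)).

Lemma rac_wronsk q z a b u du : sol q z a b u du ->
  rac a b (wronsk u du) (fun x => - (Im z * normc (u x) ^+ 2)).
Proof.
move=> [h1 h2]; have [_ h] := cacM h2 (cacJ h1).
apply: (rac_eq h) => // x _; rewrite normc_sqr !cparts; ring.
Qed.

Lemma rac_normc_sqr q z a b u du : sol q z a b u du ->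
  rac a b (fun x => normc (u x) ^+ 2) (fun x => 2 * Re (du x * conjc (u x))).
Proof.
move=> [h1 h2]; have [h _] := cacM h1 (cacJ h1).
by apply: (rac_eq h) => x _; rewrite ?normc_sqr !cparts; ring.
Qed.

Lemma normc_sqr_integrable q z a b u du : sol q z a b u du ->
  mu.-integrable `[a, b] (EFin \o (fun x => normc (u x) ^+ 2)).
Proof.
move=> h; case: (leP a b) => ab; last first.
  by rewrite set_itv_ge ?bnd_simp -?ltNge //; exact: integrable_set0.
apply: continuous_compact_integrable; first exact: segment_compact.
exact: rac_continuous (rac_normc_sqr h).
Qed.

Lemma wronsk_sub q z a b u du x y : sol q z a b u du -> a <= x -> x <= y -> y <= b ->
  wronsk u du x - wronsk u du y = Im z * \int[mu]_(t in `[x, y]) normc (u t) ^+ 2.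
Proof.
move=> h ax xy yb; have := rac_sub (rac_wronsk h) ax xy yb.
rewrite -(opprB (wronsk u du y)) => ->.
have hi := integrable_itvS (normc_sqr_integrable h) ax yb.
have -> : \int[mu]_(t in `[x, y]) - (Im z * normc (u t) ^+ 2) =
   \int[mu]_(t in `[x, y]) ((- Im z) * normc (u t) ^+ 2).
  by apply: eq_Rintegral => t _; rewrite mulNr.
by rewrite RintegralZl // mulNr opprK.
Qed.

Lemma wronsk_noninc q z a b u du x y : 0 <= Im z -> sol q z a b u du ->
  a <= x -> x <= y -> y <= b -> wronsk u du y <= wronsk u du x.
Proof.
move=> z0 h ax xy yb; rewrite -subr_ge0 (wronsk_sub h) // mulr_ge0 //.
by apply: Rintegral_ge0 => t _; exact: sqr_ge0.
Qed.

(** Bounds the coefficients of the system: 1 for [u' = du], the rest for [du' = (q - z) u]. *)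
Definition ode_size q z x : R := 1 + (`|q x| + normc z).

Lemma ode_size_integrable q z a b : mu.-integrable `[a, b] (EFin \o q) ->
  mu.-integrable `[a, b] (EFin \o ode_size q z).
Proof.
move=> qi; have h := integrableD (mitv _) (integrable_norm qi) (cst_integrable (normc z) a b).
have := integrableD (mitv _) (cst_integrable 1 a b) h.
by apply: eq_integrable => // x _; rewrite /= /ode_size !EFinD.
Qed.

Lemma cac_increment_le x y (f f' : R -> R[i]) (w : R -> R) k d e :
  cac x y f f' -> x <= d -> d <= e -> e <= y ->
  mu.-integrable `[x, y] (EFin \o w) -> (forall t, 0 <= w t) -> 0 <= k ->
  (forall t, d <= t <= e -> normc (f' t) <= k * w t) ->
  normc (f e - f d) <= 2 * (k * \int[mu]_(t in `[x, y]) w t).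
Proof.
move=> hv xd de ey wi w0 k0 vw; rewrite (cac_sub hv xd de ey).
have wi' := integrable_itvS wi xd ey.
have vi := cintegrable_itvS (cac_integrable hv) xd ey.
have swi : mu.-integrable `[d, e] (EFin \o (fun t => k * w t)).
  have := integrableZl (mitv _) k wi'.
  by apply: eq_integrable => // t _; rewrite /= EFinM.
apply: le_trans (normc_cintegral_le (mitv _) vi swi _) _.
  by move=> t /=; rewrite in_itv /= => tde; exact: vw.
rewrite ler_wpM2l // RintegralZl // ler_wpM2l //.
apply: fine_le; [exact: integrable_fin_num wi'|exact: integrable_fin_num wi|].
apply: ge0_subset_integral => //; first exact: measurable_int wi.
  by move=> t _; rewrite lee_fin.
by apply: subset_itv; rewrite bnd_simp.
Qed.

Let half_le (S T : R) : S <= T + 2^-1 * S -> S <= 2 * T.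
Proof. by lra. Qed.

(* Where [ode_size] has small integral, the solution map is a contraction, so
   all values of the pair [(u, du)] are comparable. *)
Lemma sol_small_interval q z x y c u du s : sol q z x y u du ->
  mu.-integrable `[x, y] (EFin \o q) ->
  \int[mu]_(t in `[x, y]) ode_size q z t <= 4^-1 ->
  x <= c <= y -> x <= s <= y ->
  normc (u s) + normc (du s) <= 2 * (normc (u c) + normc (du c)).
Proof.
move=> h qi small cxy sxy; have [h1 h2] := h.
have oi := ode_size_integrable z qi.
have [M1 M10 b1] := cac_bounded h1; have [M2 M20 b2] := cac_bounded h2.
pose g t := normc (u t) + normc (du t).
pose A := [set g t | t in `[x, y]].
have As : has_sup A.
  split; first by exists (g s), s => //=; rewrite in_itv.
  exists (M1 + M2) => _ [t /= + <-]; rewrite in_itv /= => txy.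
  by apply: lerD; [exact: b1|exact: b2].
have gS t : x <= t <= y -> g t <= sup A.
  by move=> txy; apply: sup_upper_bound => //; exists t => //=; rewrite in_itv.
have S0 : 0 <= sup A by apply: le_trans (gS s sxy); rewrite addr_ge0 ?normc_ge0.
have stepN v v' (w : R -> R) d e : cac x y v v' -> x <= d <= y -> x <= e <= y ->
    mu.-integrable `[x, y] (EFin \o w) -> (forall t, 0 <= w t) ->
    (forall t, x <= t <= y -> normc (v' t) <= sup A * w t) ->
    normc (v e) <= normc (v d) + 2 * (sup A * \int[mu]_(t in `[x, y]) w t).
  move=> hv /andP[xd dy] /andP[xe ey] wi w0 vw; rewrite -lerBlDl.
  apply: le_trans (ler_subnormc _ _) _.
  case: (leP d e) => de.
    apply: (cac_increment_le hv xd de ey wi w0 S0) => t /andP[dt te].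
    by apply: vw; rewrite (le_trans xd dt) (le_trans te ey).
  rewrite -normcN opprB; apply: (cac_increment_le hv xe (ltW de) dy wi w0 S0) => t /andP[dt te].
  by apply: vw; rewrite (le_trans xe dt) (le_trans te dy).
have i1 := cst_integrable 1 x y.
have i2 : mu.-integrable `[x, y] (EFin \o (fun t => `|q t| + normc z)).
  have := integrableD (mitv _) (integrable_norm qi) (cst_integrable (normc z) x y).
  by apply: eq_integrable => // t _; rewrite /= EFinD.
have gle t : x <= t <= y -> g t <= g c + 2^-1 * sup A.
  move=> txy.
  have e1 := stepN u du (fun=> 1) c t h1 cxy txy i1 (fun=> ler01).
  have e2 := stepN du _ (fun t => `|q t| + normc z) c t h2 cxy txy i2.
  have {e1} e1 : normc (u t) <= normc (u c) + 2 * (sup A * \int[mu]_(t in `[x, y]) 1).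
    apply: e1 => r rxy; rewrite mulr1; apply: le_trans (gS r rxy).
    by rewrite lerDr normc_ge0.
  have {e2} e2 : normc (du t) <= normc (du c) + 2 * (sup A * \int[mu]_(t in `[x, y]) (`|q t| + normc z)).
    apply: e2 => [r|r rxy]; first by rewrite addr_ge0 ?normc_ge0.
    rewrite normcM mulrC; apply: ler_pM; rewrite ?normc_ge0 //.
      by apply: le_trans (gS r rxy); rewrite lerDl normc_ge0.
    by apply: le_trans (le_normcB _ _) _; rewrite normcC.
  (* The factor 2 of [normc_cintegral_le] times the bound [4^-1] leaves half of the supremum, which
     is then absorbed on the left. *)
  have small' : 2 * (sup A * \int[mu]_(t in `[x, y]) 1) +
     2 * (sup A * \int[mu]_(t in `[x, y]) (`|q t| + normc z)) <= 2^-1 * sup A.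
    rewrite -mulrDr -mulrDr -RintegralD //.
    rewrite mulrCA [leRHS]mulrC ler_wpM2l //.
    rewrite -ler_pdivlMl //; apply: le_trans small _.
    by rewrite -invfM -natrM.
  rewrite /g; apply: le_trans (lerD e1 e2) _.
  by rewrite addrACA lerD2l.
have : sup A <= g c + 2^-1 * sup A.
  apply: sup_le_ub; first by case: As.
  by move=> _ [t /= + <-]; rewrite in_itv /= => txy; exact: gle.
by move=> /half_le; exact: le_trans (gS s sxy).
Qed.

(** The integral of [ode_size] over [[x, c]] is small uniformly in [x], so [sol_small_interval]
    bounds [u] and [du] on []0, c]] by their size at [c]. Then [du] and [(q - z) u] are integrable
    up to 0, and the limits exist. *)
Lemma sol_extend0 q z a u du : 0 < a -> mu.-integrable `[0, a] (EFin \o q) ->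
  (forall x, 0 < x -> x <= a -> sol q z x a u du) ->
  exists l l' : R[i], [/\ ccvg (0 : R)^'+ u l, ccvg (0 : R)^'+ du l' &
    sol q z 0 a (fun x => if x == 0 then l else u x) (fun x => if x == 0 then l' else du x)].
Proof.
move=> a0 qi h.
have oi := ode_size_integrable z qi.
have e4 : (0 : R) < 4^-1 by rewrite invr_gt0.
have [d d0 hd] := integral_small oi e4.
have o0 t : 0 <= ode_size q z t by rewrite /ode_size !addr_ge0 ?normc_ge0.
pose c := Num.min a (d / 2).
have c0 : 0 < c by rewrite lt_min a0 divr_gt0.
have ca : c <= a by rewrite /c ge_min lexx.
have cd : c < d by rewrite /c gt_min; apply/orP; right; rewrite ltr_pdivrMr // ltr_pMr // ltr1n.
pose B0 := 2 * (normc (u c) + normc (du c)).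
have near0 x : 0 < x -> x <= c -> normc (u x) + normc (du x) <= B0.
  move=> x0 xc; apply: (@sol_small_interval q z x c c u du x).
  - exact: solW (h x x0 (le_trans xc ca)) (lexx _) ca.
  - exact: integrable_itvS qi (ltW x0) ca.
  - apply: le_trans (ltW (hd x c (ltW x0) xc ca _)); last by apply: le_lt_trans cd; rewrite gerBl ltW.
    rewrite le_eqVlt; apply/orP; left; apply/eqP; apply: eq_Rintegral => t _.
    by rewrite ger0_norm.
  - by rewrite xc lexx.
  - by rewrite lexx xc.
have [hc1 hc2] := h c c0 ca.
have [M1 M10 b1] := cac_bounded hc1; have [M2 M20 b2] := cac_bounded hc2.
have B00 : 0 <= B0 by rewrite mulr_ge0 // addr_ge0 ?normc_ge0.
(* [u 0] and [du 0] are arbitrary values of the given functions; with their norms added, the bound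
   holds on the closed interval. *)
pose M := B0 + M1 + M2 + normc (u 0) + normc (du 0).
have bd x : 0 <= x <= a -> normc (u x) <= M /\ normc (du x) <= M.
  move=> /andP[x0 xa]; have p1 := normc_ge0 (u 0); have p2 := normc_ge0 (du 0).
  have [->|xn0] := eqVneq x 0; first by rewrite /M; split; lra.
  have {xn0}x0 : 0 < x by rewrite lt_neqAle eq_sym xn0.
  have p3 := normc_ge0 (u x); have p4 := normc_ge0 (du x).
  case: (leP x c) => xc; first by have := near0 x x0 xc; rewrite /M; split; lra.
  have cxa : c <= x <= a by rewrite (ltW xc).
  by have := b1 x cxa; have := b2 x cxa; rewrite /M; split; lra.
have mpart (f : R -> R) f' : (forall x, 0 < x -> x <= a -> rac x a f f') -> measurable_fun `[0, a] f.
  move=> hf; apply: measurable_fun_itv_oc => x x0 xa.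
  by apply: subspace_continuous_measurable_fun => //; exact: rac_continuous (hf x x0 xa).
have hu1 x : 0 < x -> x <= a -> rac x a (fun t => Re (u t)) (fun t => Re (du t)).
  by move=> x0 xa; have [[]] := h x x0 xa.
have hu2 x : 0 < x -> x <= a -> rac x a (fun t => Im (u t)) (fun t => Im (du t)).
  by move=> x0 xa; have [[]] := h x x0 xa.
have hv1 x : 0 < x -> x <= a -> rac x a (fun t => Re (du t)) (fun t => Re (((q t)%:C - z) * u t)).
  by move=> x0 xa; have [_ []] := h x x0 xa.
have hv2 x : 0 < x -> x <= a -> rac x a (fun t => Im (du t)) (fun t => Im (((q t)%:C - z) * u t)).
  by move=> x0 xa; have [_ []] := h x x0 xa.
have bi (f : R -> R) : measurable_fun `[0, a] f -> (forall x, 0 <= x <= a -> `|f x| <= M) ->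
    mu.-integrable `[0, a] (EFin \o f).
  move=> mf fM; have := bounded_integrableM mf (ex_intro _ M fM) (cst_integrable 1 0 a).
  by apply: eq_integrable => // x _; rewrite /= mulr1.
have i1 : mu.-integrable `[0, a] (EFin \o (fun t => Re (du t))).
  apply: bi; first exact: mpart hv1.
  by move=> x xa; apply: le_trans (normc_ge_absRe _) _; have [] := bd x xa.
have i2 : mu.-integrable `[0, a] (EFin \o (fun t => Im (du t))).
  apply: bi; first exact: mpart hv2.
  by move=> x xa; apply: le_trans (normc_ge_absIm _) _; have [] := bd x xa.
have uM1 x : 0 <= x <= a -> `|Re (u x)| <= M.
  by move=> xa; apply: le_trans (normc_ge_absRe _) _; have [] := bd x xa.
have uM2 x : 0 <= x <= a -> `|Im (u x)| <= M.
  by move=> xa; apply: le_trans (normc_ge_absIm _) _; have [] := bd x xa.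
have j1 := bounded_integrableM (mpart _ _ hu1) (ex_intro _ M uM1) qi.
have j2 := bounded_integrableM (mpart _ _ hu2) (ex_intro _ M uM2) qi.
have k1 := bi _ (mpart _ _ hu1) uM1.
have k2 := bi _ (mpart _ _ hu2) uM2.
have i3 : mu.-integrable `[0, a] (EFin \o (fun t => Re (((q t)%:C - z) * u t))).
  have := integrableD (mitv _) j1 (integrableD
     (mitv _) (integrableZl (mitv _) (- Re z) k1) (integrableZl (mitv _) (Im z) k2)).
  apply: eq_integrable => // t _; rewrite /= !cparts -!EFinM -!EFinD; congr EFin; ring.
have i4 : mu.-integrable `[0, a] (EFin \o (fun t => Im (((q t)%:C - z) * u t))).
  have := integrableD (mitv _) j2 (integrableD
     (mitv _) (integrableZl (mitv _) (- Re z) k2) (integrableZl (mitv _) (- Im z) k1)).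
  apply: eq_integrable => // t _; rewrite /= !cparts -!EFinM -!EFinD; congr EFin; ring.
have [l1 [cl1 r1]] := rac_extend0 a0 hu1 i1.
have [l2 [cl2 r2]] := rac_extend0 a0 hu2 i2.
have [l3 [cl3 r3]] := rac_extend0 a0 hv1 i3.
have [l4 [cl4 r4]] := rac_extend0 a0 hv2 i4.
have ne0 (T : Type) (s t : T) x : 0 < x <= a -> s = (if x == 0 then t else s).
  by move=> /andP[x0 _]; rewrite gt_eqF.
exists (l1 +i* l2), (l3 +i* l4); split.
- exact: ccvg_parts.
- exact: ccvg_parts.
split; split.
- by apply: (rac_eq_oc r1) => x xa; [case: ifP|rewrite -(ne0 _ _ _ _ xa)].
- by apply: (rac_eq_oc r2) => x xa; [case: ifP|rewrite -(ne0 _ _ _ _ xa)].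
- by apply: (rac_eq_oc r3) => x xa; [case: ifP|rewrite -(ne0 _ _ _ _ xa)].
- by apply: (rac_eq_oc r4) => x xa; [case: ifP|rewrite -(ne0 _ _ _ _ xa)].
Qed.

End Solutions.

Section Regularity.
Context {R : realType}.
Notation mu := (@lebesgue_measure R).

Lemma rac_ae a b (f f' g' : R -> R) : rac a b f f' ->
  mu.-integrable `[a, b] (EFin \o g') ->
  {ae mu, forall x, a <= x <= b -> f' x = g' x} -> rac a b f g'.
Proof.
move=> [fi fE] gi fg; split => // x /[dup] xab /andP[ax xb]; rewrite fE //; congr (_ + _).
have fi' := integrable_itvS fi (lexx a) xb.
have gi' := integrable_itvS gi (lexx a) xb.
rewrite /Rintegral; congr fine; apply: ae_eq_integral.
- exact: mitv.
- exact: measurable_int fi'.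
- exact: measurable_int gi'.
move: fg; apply: filterS; first exact: (ae_filter_ringOfSetsType mu).
move=> t ft /=; rewrite in_itv /= => /andP[a_t tx].
by rewrite ft // a_t (le_trans tx).
Qed.

(** The derivative of [u] is continuous, hence [u] is its primitive; the a.e. equation allows the
    given second derivative to be replaced by [(q - z) u]. *)
Lemma schroedinger_sol (q : R -> R) (b : \bar R) z u x y :
  schroedinger_solution q b z u ->
  (forall s t : R, 0 < s -> (t%:E < b)%E -> mu.-integrable `[s, t] (EFin \o q)) ->
  0 < x -> x <= y -> (y%:E < b)%E -> sol q z x y u (cderiv u).
Proof.
move=> [ud [ddu uac ude]] qi x0 xy yb.
(* [ac_derivative] speaks of [x < y] only; on a longer interval [x = y] is covered as well. *)
have [y2 [yy2 y2b]] : exists y2 : R, y < y2 /\ (y2%:E < b)%E.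
  move: b yb {ud uac ude qi} => [r yr|_|]; last by [].
    exists ((y + r) / 2); rewrite !lte_fin in yr *.
    by rewrite ltr_pdivlMr // ltr_pdivrMr //; split; lra.
  by exists (y + 1); rewrite ltrDl; split => //; rewrite ltry.
suff h : sol q z x y2 u (cderiv u) by exact: solW h (lexx _) (ltW yy2).
have xy2 := le_lt_trans xy yy2.
have [di _] := uac x y2 x0 xy2 y2b.
have dac : cac x y2 (cderiv u) ddu.
  apply: cac_primitive => // t /andP[xt ty2].
  have [->|xnt] := eqVneq x t.
    by rewrite set_itv1 /cintegral !Rintegral_set1 addr0.
  have xt' : x < t by rewrite lt_neqAle xnt.
  have tb : (t%:E < b)%E by apply: le_lt_trans y2b; rewrite lee_fin.
  by have [_ <-] := uac x t x0 xt' tb; rewrite addrC subrK.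
have [d1 d2] := dac.
have tb t : x <= t <= y2 -> cderivable u t.
  move=> /andP[xt ty2]; apply: ud; first exact: lt_le_trans xt.
  by apply: le_lt_trans y2b; rewrite lee_fin.
have u1 : cac x y2 u (cderiv u).
  split; apply: rac_derive.
  - by move=> t /tb[+ _] => /derivableP; rewrite -derive1E.
  - exact: rac_continuous (ltW xy2) d1.
  - by move=> t /tb[_ +] => /derivableP; rewrite -derive1E.
  - exact: rac_continuous (ltW xy2) d2.
split => //.
have ri : cintegrable `[x, y2] (fun t => u t * ((q t)%:C - z)).
  apply: cac_integrableM u1 _; apply: cintegrableD; first exact: mitv.
    by apply: cintegrable_real; exact: qi.
  by split; exact: cst_integrable.
have [ri1 ri2] := ri.
have e t : x <= t <= y2 -> (0 < t -> (t%:E < b)%E -> - ddu t + (q t)%:C * u t = z * u t) ->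
    ddu t = u t * ((q t)%:C - z).
  move=> /andP[xt ty2] /(_ (lt_le_trans x0 xt)) H.
  have {}H := H (le_lt_trans _ y2b); rewrite ?lee_fin // in H.
  have {}H := H ty2.
  have -> : ddu t = (q t)%:C * u t - (- ddu t + (q t)%:C * u t) by ring.
  by rewrite H; ring.
have h : cac x y2 (cderiv u) (fun t => u t * ((q t)%:C - z)).
  split.
    apply: rac_ae d1 ri1 _.
    by move: ude; apply: filterS; [exact: (ae_filter_ringOfSetsType mu)|move=> t H /e/(_ H) ->].
  apply: rac_ae d2 ri2 _.
  by move: ude; apply: filterS; [exact: (ae_filter_ringOfSetsType mu)|move=> t H /e/(_ H) ->].
by apply: cac_eq h _ _ => // t _; rewrite mulrC.
Qed.

End Regularity.

(** * The remainder *)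

Section Remainder.
Context {R : realType}.
Notation mu := (@lebesgue_measure R).

Lemma exists_sup (a b : R) (g : R -> R) M : a <= b -> (forall x, a <= x <= b -> g x <= M) ->
  exists N, (forall x, a <= x <= b -> g x <= N) /\
    forall B, (forall x, a <= x <= b -> g x <= B) -> N <= B.
Proof.
move=> ab gM; pose A := [set g t | t in `[a, b]].
have A0 : A !=set0 by exists (g a), a => //=; rewrite in_itv /= lexx.
exists (sup A); split.
  move=> x xab; apply: sup_upper_bound; last by exists x => //=; rewrite in_itv.
  by split => //; exists M => _ [t /= + <-]; rewrite in_itv /= => /gM.
by move=> B gB; apply: sup_le_ub => // _ [t /= + <-]; rewrite in_itv /= => /gB.
Qed.

Variables (q : R -> R).
Hypothesis (mq : measurable_fun setT q).
Hypothesis (qi : forall a, mu.-integrable `[0, a] (EFin \o q)).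
Local Notation Q := (absq_int q).

(** The coefficients of variation of constants: for [q = 0] both are constant, equal up to sign to
    [2 * kap] times the coefficients of the two exponentials in [u]. In general their derivatives
    are [q u] times an exponential, so their increments are controlled by [Q]. *)
Let fwd (kap : R[i]) (u du : R -> R[i]) x := cexp (x%:C * - kap) * (du x + kap * u x).
Let bwd (kap : R[i]) (u du : R -> R[i]) x := cexp (x%:C * kap) * (du x - kap * u x).

Let cac_fwd kap a u du : sol q (- kap ^+ 2) 0 a u du ->
  cac 0 a (fwd kap u du) (fun x => (q x)%:C * (cexp (x%:C * - kap) * u x)).
Proof.
move=> [h1 h2].
have h := cacM (cac_cexp 0 a (- kap)) (cacD h2 (cacZ kap h1)).
by apply: (cac_eq h) => // x _; ring.
Qed.

Let cac_bwd kap a u du : sol q (- kap ^+ 2) 0 a u du ->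
  cac 0 a (bwd kap u du) (fun x => (q x)%:C * (cexp (x%:C * kap) * u x)).
Proof.
move=> [h1 h2].
have h := cacM (cac_cexp 0 a kap) (cacB h2 (cacZ kap h1)).
by apply: (cac_eq h) => // x _; ring.
Qed.

Let fwd_bwd kap u du x :
  2 * kap * u x = cexp (x%:C * kap) * fwd kap u du x - cexp (x%:C * - kap) * bwd kap u du x.
Proof.
have e : cexp (x%:C * kap) * cexp (x%:C * - kap) = 1.
  by rewrite -cexpD mulrN subrr cexp0.
rewrite /fwd /bwd.
transitivity (cexp (x%:C * kap) * cexp (x%:C * - kap) * (2 * kap * u x)); last by ring.
by rewrite e mul1r.
Qed.

Let norm_e (kap : R[i]) (x : R) : normc (cexp (x%:C * kap)) = expR (x * Re kap).
Proof. by rewrite normc_cexp cReM cReC cImC mul0r subr0. Qed.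

Let norm_eN (kap : R[i]) (x : R) : normc (cexp (x%:C * - kap)) = expR (- (x * Re kap)).
Proof. by rewrite norm_e cReN mulrN. Qed.

Let increment a (f g : R -> R[i]) k x : cac 0 a f (fun t => (q t)%:C * g t) ->
  0 <= x -> x <= a -> 0 <= k -> (forall t, x <= t <= a -> normc (g t) <= k) ->
  normc (f a - f x) <= 2 * (k * Q a).
Proof.
move=> h x0 xa k0 gk.
apply: (cac_increment_le h x0 xa (lexx a) (absq_integrable qi a) _ k0) => // t tx.
by rewrite normcM normcC mulrC; apply: ler_wpM2r => //; exact: gk.
Qed.

Let fwd_increment kap a u du N x : sol q (- kap ^+ 2) 0 a u du ->
  0 <= Re kap -> 0 <= x -> x <= a -> 0 <= N ->
  (forall t, 0 <= t <= a -> normc (u t) * expR (- ((a - t) * Re kap)) <= N) ->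
  normc (fwd kap u du a - fwd kap u du x) <= 2 * (expR ((a - 2 * x) * Re kap) * N * Q a).
Proof.
move=> h r0 x0 xa N0 uN; apply: (increment (cac_fwd h)) => //.
  by rewrite mulr_ge0 // expR_ge0.
move=> t /andP[xt ta]; rewrite normcM norm_eN.
have -> : expR (- (t * Re kap)) * normc (u t) =
    expR ((a - 2 * t) * Re kap) * (normc (u t) * expR (- ((a - t) * Re kap))).
  rewrite [RHS]mulrCA mulrC; congr (_ * _).
  by rewrite -expRD; congr expR; ring.
apply: ler_pM; rewrite ?expR_ge0 ?mulr_ge0 ?normc_ge0 ?expR_ge0 //.
  by rewrite ler_expR ler_wpM2r //; lra.
by apply: uN; rewrite (le_trans x0).
Qed.

Let bwd_increment kap a u du N x : sol q (- kap ^+ 2) 0 a u du ->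
  0 <= x -> x <= a -> 0 <= N ->
  (forall t, 0 <= t <= a -> normc (u t) * expR (- ((a - t) * Re kap)) <= N) ->
  normc (bwd kap u du a - bwd kap u du x) <= 2 * (expR (a * Re kap) * N * Q a).
Proof.
move=> h x0 xa N0 uN; apply: (increment (cac_bwd h)) => //.
  by rewrite mulr_ge0 // expR_ge0.
move=> t /andP[xt ta]; rewrite normcM norm_e.
have -> : expR (t * Re kap) * normc (u t) =
    expR (a * Re kap) * (normc (u t) * expR (- ((a - t) * Re kap))).
  rewrite [RHS]mulrCA mulrC; congr (_ * _).
  by rewrite -expRD; congr expR; ring.
by rewrite ler_wpM2l ?expR_ge0 //; apply: uN; rewrite (le_trans x0).
Qed.

Let fwd_le kap a u du N x : sol q (- kap ^+ 2) 0 a u du ->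
  0 <= Re kap -> 0 <= x -> x <= a -> 0 <= N ->
  (forall t, 0 <= t <= a -> normc (u t) * expR (- ((a - t) * Re kap)) <= N) ->
  normc (fwd kap u du x) <= expR (- (a * Re kap)) * normc (du a + kap * u a) +
    2 * (expR ((a - 2 * x) * Re kap) * N * Q a).
Proof.
move=> h r0 x0 xa N0 uN.
have <- : normc (fwd kap u du a) = expR (- (a * Re kap)) * normc (du a + kap * u a).
  by rewrite normcM norm_eN.
rewrite addrC -lerBlDr; apply: le_trans (fwd_increment h r0 x0 xa N0 uN).
by apply: le_trans (ler_subnormc _ _) _; rewrite -normcN opprB.
Qed.

Let bwd_le kap a u du N x : sol q (- kap ^+ 2) 0 a u du ->
  0 <= x -> x <= a -> 0 <= N ->
  (forall t, 0 <= t <= a -> normc (u t) * expR (- ((a - t) * Re kap)) <= N) ->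
  normc (bwd kap u du x) <= expR (a * Re kap) * normc (du a - kap * u a) +
    2 * (expR (a * Re kap) * N * Q a).
Proof.
move=> h x0 xa N0 uN.
have <- : normc (bwd kap u du a) = expR (a * Re kap) * normc (du a - kap * u a).
  by rewrite normcM norm_e.
rewrite addrC -lerBlDr; apply: le_trans (bwd_increment h x0 xa N0 uN).
by apply: le_trans (ler_subnormc _ _) _; rewrite -normcN opprB.
Qed.

Let normc2 : normc (2 : R[i]) = 2.
Proof.
have -> : (2 : R[i]) = (2 : R)%:C by rewrite rmorph_nat.
by rewrite normcC ger0_norm.
Qed.

Let arith0 (q1 k n p m : R) : n * (2 * k) <= p + m + 4 * (n * q1) -> 4 * q1 * n <= k * n ->
  k * n <= p + m.
Proof. by lra. Qed.

(** [N] is the supremum of [|u|] freed from its possible growth from [a] down to 0. Expressing [u]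
    by [fwd] and [bwd], and these by their values at [a], bounds [2 |kap| N] by the data at [a] plus
    [4 N Q a]; for [|kap| >= 4 Q a] the last term is absorbed. *)
Let sup_bound kap a u du : 0 <= a -> sol q (- kap ^+ 2) 0 a u du ->
  0 <= Re kap -> 4 * Q a <= normc kap ->
  exists N, [/\ 0 <= N,
    forall t, 0 <= t <= a -> normc (u t) * expR (- ((a - t) * Re kap)) <= N &
    normc kap * N <= normc (du a + kap * u a) + normc (du a - kap * u a)].
Proof.
move=> a0 h r0 kQ; have [h1 _] := h; have [M M0 uM] := cac_bounded h1.
have [|N [uN Nle]] := @exists_sup 0 a (fun t => normc (u t) * expR (- ((a - t) * Re kap))) M a0.
  move=> x /[dup] xa /andP[_ xa2]; apply: le_trans (uM x xa).
  rewrite ler_piMr ?normc_ge0 // -expR0 ler_expR oppr_le0 mulr_ge0 // subr_ge0 //.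
have N0 : 0 <= N.
  apply: le_trans (uN 0 _); last by rewrite lexx.
  by rewrite mulr_ge0 ?normc_ge0 ?expR_ge0.
exists N; split => //.
have [k0|kn0] := eqVneq (normc kap) 0.
  by rewrite k0 mul0r addr_ge0 ?normc_ge0.
have k0 : 0 < normc kap by rewrite lt_neqAle eq_sym kn0 normc_ge0.
set P := normc (du a + _); set M' := normc (du a - _).
have P0 : 0 <= P := normc_ge0 _.
have M'0 : 0 <= M' := normc_ge0 _.
have Q0 := absq_int_ge0 q a.
have step x : 0 <= x <= a ->
    2 * normc kap * (normc (u x) * expR (- ((a - x) * Re kap))) <= P + M' + 4 * (N * Q a).
  move=> /andP[x0 xa].
  have e1 : 2 * normc kap * normc (u x) <=
      expR (x * Re kap) * normc (fwd kap u du x) + expR (- (x * Re kap)) * normc (bwd kap u du x).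
    have -> : 2 * normc kap * normc (u x) = normc (2 * kap * u x) by rewrite !normcM normc2.
    rewrite (fwd_bwd kap u du); apply: le_trans (le_normcB _ _) _.
    by rewrite !normcM norm_e norm_eN.
  have f1 := fwd_le h r0 x0 xa N0 uN.
  have f2 := bwd_le h x0 xa N0 uN.
  have e2 : expR (x * Re kap) * normc (fwd kap u du x) <=
     expR ((a - x) * Re kap) * (P + 2 * (N * Q a)).
    apply: le_trans (ler_wpM2l (expR_ge0 _) f1) _.
    rewrite !mulrDr; apply: lerD.
      rewrite mulrA -expRD; apply: ler_wpM2r => //; rewrite ler_expR.
      rewrite -mulNr -mulrDl; apply: ler_wpM2r => //; lra.
    rewrite le_eqVlt; apply/orP; left; apply/eqP.
    have -> : (a - x) * Re kap = x * Re kap + (a - 2 * x) * Re kap by ring.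
    by rewrite expRD; ring.
  have e3 : expR (- (x * Re kap)) * normc (bwd kap u du x) <=
     expR ((a - x) * Re kap) * (M' + 2 * (N * Q a)).
    apply: le_trans (ler_wpM2l (expR_ge0 _) f2) _.
    rewrite le_eqVlt; apply/orP; left; apply/eqP.
    have -> : (a - x) * Re kap = - (x * Re kap) + a * Re kap by ring.
    by rewrite expRD -/M'; ring.
  have e4 : 2 * normc kap * normc (u x) <= expR ((a - x) * Re kap) * (P + M' + 4 * (N * Q a)).
    apply: le_trans e1 _; apply: le_trans (lerD e2 e3) _.
    by rewrite le_eqVlt; apply/orP; left; apply/eqP; ring.
  by rewrite expRN mulrA ler_pdivrMr ?expR_gt0 // [leRHS]mulrC.
have Nk : N <= (P + M' + 4 * (N * Q a)) / (2 * normc kap).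
  by apply: Nle => x xa; rewrite ler_pdivlMr ?mulr_gt0 // mulrC; exact: step.
move: Nk; rewrite ler_pdivlMr ?mulr_gt0 // => Nk.
have : 4 * Q a * N <= normc kap * N by rewrite ler_wpM2r.
exact: arith0.
Qed.

(** With [d = w - kap v], the imaginary part of [d conj v] is at least [- Im kap |v|^2] by the sign
    hypothesis, so [|v|] is at most [|d| / (s |kap|)]. The claim follows from
    [w + kap v = d + 2 kap v]. *)
Let herglotz_bound (kap w v : R[i]) (s : R) : 0 < s -> 0 < normc kap ->
  s * normc kap <= - Im kap -> 0 <= Im (w * conjc v) ->
  normc (w + kap * v) <= (1 + 2 / s) * normc (w - kap * v).
Proof.
move=> s0 k0 sk h.
set d := w - kap * v.
have e0 : 0 < - Im kap by apply: lt_le_trans sk; rewrite mulr_gt0.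
have h1 : - Im kap * normc v ^+ 2 <= normc d * normc v.
  have -> : normc d * normc v = normc (d * conjc v) by rewrite normcM normc_conjc.
  apply: le_trans (normc_ge_absIm _); apply: le_trans (ler_norm _).
  have -> : Im (d * conjc v) = Im (w * conjc v) - Im kap * normc v ^+ 2.
    by rewrite normc_sqr /d !cparts; ring.
  by rewrite mulNr lerDr.
have h2 : - Im kap * normc v <= normc d.
  have [->|vn0] := eqVneq (normc v) 0; first by rewrite mulr0 normc_ge0.
  have v0 : 0 < normc v by rewrite lt_neqAle eq_sym vn0 normc_ge0.
  by rewrite -(ler_pM2r v0) -mulrA -expr2.
have h3 : s * (normc kap * normc v) <= normc d.
  by rewrite mulrA; apply: le_trans h2; rewrite ler_wpM2r ?normc_ge0.
have -> : w + kap * v = d + 2 * (kap * v) by rewrite /d; ring.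
apply: le_trans (le_normcD _ _) _; rewrite !normcM normc2 [leRHS]mulrDl mul1r lerD2l.
by rewrite -[leRHS]mulrA ler_pM2l // ler_pdivlMl.
Qed.

Let amp_exp kap x := (amplitude mq qi x)%:C * cexp (- (2 * x)%:C * kap).

Let reorder (A B C : R[i]) : C + A = A - B + C + B.
Proof. by ring. Qed.

Let remainder_eq kap a u du : 0 <= a -> sol q (- kap ^+ 2) 0 a u du ->
  du 0 + kap * u 0 + u 0 * cintegral `[0, a] (amp_exp kap) =
  fwd kap u du a +
  2 * cintegral `[0, a] (fun y => (goursat mq qi a y)%:C * cexp (- (2 * y)%:C * kap) * fwd kap u du (a - y)).
Proof.
move=> a0 h; have hF := cac_fwd h; have [h1 _] := h.
pose G x := cexp (x%:C * - kap) * u x.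
have hG : cac 0 a G (fun x => fwd kap u du x - 2 * kap * G x).
  apply: (cac_eq (cacM (cac_cexp 0 a (- kap)) h1)) => // x _.
  by rewrite /G /fwd; ring.
have e1 := amplitude_identity mq qi a0 hF hG.
have e2 := cac_sub hF (lexx 0) a0 (lexx a).
have G0 : G 0 = u 0 by rewrite /G mul0r cexp0 mul1r.
have F0 : fwd kap u du 0 = du 0 + kap * u 0 by rewrite /fwd mul0r cexp0 mul1r.
rewrite -[cexp _ * _]/(G 0) G0 in e1; rewrite F0 in e2.
have {e1} e1 := etrans e2 e1.
have -> : fwd kap u du a = (fwd kap u du a - (du 0 + kap * u 0)) + (du 0 + kap * u 0) by rewrite subrK.
by rewrite e1; exact: reorder.
Qed.

(** The weight of the exponential at [y] and the decay of [F] at [a - y] multiply to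
    [exp (- 2 a Re kap)] for every [y], so the integrand has a constant bound. *)
Let kernel_int_le kap a (F : R -> R[i]) F' B : 0 <= a -> cac 0 a F F' -> 0 <= B ->
  (forall x, 0 <= x <= a -> normc (F x) <= B * expR (- (2 * x * Re kap))) ->
  normc (cintegral `[0, a] (fun y => (goursat mq qi a y)%:C * cexp (- (2 * y)%:C * kap) * F (a - y))) <=
  2 * (goursat_bound q a * B * expR (- (2 * a * Re kap)) * a).
Proof.
move=> a0 hF B0 FB.
have C0 := goursat_bound_ge0 q a.
have hFr : cac 0 a (fun y => F (a - y)) (fun y => - F' (a - y)).
  by apply: cac_reflect; rewrite subrr subr0.
have ki : mu.-integrable `[0, a] (EFin \o (fun y => goursat mq qi a y)).
  have kb : exists M, forall x, 0 <= x <= a -> `|goursat mq qi a x| <= M.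
    by exists (goursat_bound q a) => x /andP[x0 xa]; exact: goursat_le.
  have := bounded_integrableM (measurable_funTS (measurable_goursat2 mq qi a)) kb (cst_integrable 1 0 a).
  by apply: eq_integrable => // x _; rewrite /= mulr1.
have i1 := cac_integrableM (cacM (cac_scaled_cexp 0 a kap) hFr) (cintegrable_real ki).
have i2 : cintegrable `[0, a] (fun y => (goursat mq qi a y)%:C * cexp (- (2 * y)%:C * kap) * F (a - y)).
  apply: eq_cintegrable i1; first exact: mitv.
  by move=> x _; rewrite mulrC mulrA.
have b y : 0 <= y <= a ->
    normc ((goursat mq qi a y)%:C * cexp (- (2 * y)%:C * kap) * F (a - y)) <=
    goursat_bound q a * B * expR (- (2 * a * Re kap)).
  move=> /andP[y0 ya].
  have -> : expR (- (2 * a * Re kap)) = expR (- (2 * y * Re kap)) * expR (- (2 * (a - y) * Re kap)).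
    by rewrite -expRD; congr expR; ring.
  have -> : goursat_bound q a * B * (expR (- (2 * y * Re kap)) * expR (- (2 * (a - y) * Re kap))) =
    goursat_bound q a * expR (- (2 * y * Re kap)) * (B * expR (- (2 * (a - y) * Re kap))).
    by ring.
  rewrite normcM; apply: ler_pM; rewrite ?normc_ge0 //; last first.
    by apply: FB; rewrite subr_ge0 ya gerBl.
  rewrite normcM normcC normc_cexp; apply: ler_pM; rewrite ?expR_ge0 //.
    exact: goursat_le.
  by rewrite !cparts oppr0 mul0r subr0 mulNr.
apply: le_trans (normc_cintegral_le (mitv _) i2 (cst_integrable _ 0 a) _) _.
  by move=> y /=; rewrite in_itv /=; exact: b.
by rewrite Rintegral_itv_cst // subr0.
Qed.

Let arith1 (c k n p m q1 : R) : 0 < 1 + c -> 0 <= n -> 16 * q1 * (1 + c) <= k -> p <= c * m ->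
  k * n <= p + m -> 16 * (n * q1) <= m.
Proof.
move=> c0 n0 h1 h2 h3; rewrite -(ler_pM2l c0).
apply: le_trans (_ : k * n <= _); last by lra.
by apply: le_trans (ler_wpM2r n0 h1); rewrite le_eqVlt; apply/orP; left; apply/eqP; ring.
Qed.

(** Here [e] and [e'] are [exp (a Re kap)] and its inverse. At 0, [bwd] retains at least 7/8 of
    [e m], while [fwd] is at most 1/4 plus 1/8 of it; so [2 kap u 0] is at least half of [e m]. *)
Let arith2 (c e e' m p nq x f g : R) : 0 <= e -> 0 <= m -> 16 * nq <= m -> p <= c * m -> 0 <= e' ->
  4 * c * e' <= e -> g - f <= x -> f <= e' * p + 2 * (e * nq) -> e * m - 2 * (e * nq) <= g ->
  e * m <= 2 * x.
Proof.
move=> e0 m0 h1 h2 e'0 h3 h4 h5 h6.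
have i1 : e' * p <= e' * (c * m) by rewrite ler_wpM2l.
have i2 : 4 * c * e' * m <= e * m by rewrite ler_wpM2r.
have i3 : e * (16 * nq) <= e * m by rewrite ler_wpM2l.
by lra.
Qed.

(* The values at [a] of [du - kap u] and [du + kap u] control the solution on
   [[0, a]] by its growing exponential alone, since positivity of the Wronskian
   at [a] bounds the second one by the first. *)
Lemma weyl_estimate a s : 0 < a -> 0 < s ->
  exists K C0 : R, [/\ 0 <= K, 0 < C0 & forall kap u du, C0 <= normc kap ->
    s * normc kap <= Re kap -> s * normc kap <= - Im kap ->
    sol q (- kap ^+ 2) 0 a u du -> 0 <= wronsk u du a ->
    (forall x, 0 <= x <= a -> normc (u x) <= K * normc (u 0)) /\
    normc (du 0 + kap * u 0 + u 0 * cintegral `[0, a] (amp_exp kap)) <=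
      K * (1 + normc kap) * normc (u 0) * expR (- (2 * a * Re kap))].
Proof.
move=> a0 s0.
pose c := 1 + 2 / s.
have c0 : 0 < c by rewrite addr_gt0 // divr_gt0.
have c1 : 0 < 1 + c by rewrite addr_gt0.
have Q0 := absq_int_ge0 q a.
have G0 := goursat_bound_ge0 q a.
pose C4 := 4 * (1 + c).
have C40 : 0 <= C4 by rewrite mulr_ge0 // ltW.
pose K1 := C4 * (1 + 2 * Q a).
have K10 : 0 <= K1 by rewrite mulr_ge0 // addr_ge0 // mulr_ge0.
pose K2 := K1 * (1 + 4 * (goursat_bound q a * a)).
have K20 : 0 <= K2 by rewrite mulr_ge0 // addr_ge0 // mulr_ge0 // mulr_ge0 // ltW.
(* [C4] bounds [u] and [K2] the remainder. In the threshold for [|kap|], 1 ensures positivity,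
   [16 * Q a * (1 + c)] makes the integral terms at most 1/16 of the data, and [2 * c / (a * s)]
   makes the growing exponential beat the decaying one by the factor [4 * c]. *)
exists (C4 + K2), (1 + 16 * Q a * (1 + c) + 2 * c / (a * s)); split.
- by rewrite addr_ge0.
- rewrite -addrA ltr_pwDl // addr_ge0 // !mulr_ge0 ?invr_ge0 ?mulr_ge0 // ?ltW //.
move=> kap u du kC rk ik h W.
have k1 : 1 <= normc kap.
  apply: le_trans kC; rewrite -addrA lerDl addr_ge0 // !mulr_ge0 ?invr_ge0 ?mulr_ge0 // ?ltW //.
have k16 : 16 * Q a * (1 + c) <= normc kap.
  apply: le_trans kC; rewrite addrAC lerDr addr_ge0 // !mulr_ge0 ?invr_ge0 ?mulr_ge0 // ?ltW //.
have kc : 2 * c / (a * s) <= normc kap.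
  apply: le_trans kC; rewrite lerDr addr_ge0 // !mulr_ge0 // ltW //.
have k0 : 0 < normc kap := lt_le_trans ltr01 k1.
have r0 : 0 <= Re kap by apply: le_trans rk; rewrite mulr_ge0 ?ltW.
have k4 : 4 * Q a <= normc kap.
  apply: le_trans k16; rewrite mulrAC; apply: ler_wpM2r => //.
  by rewrite -[leLHS]mulr1; apply: ler_pM => //; [lra|rewrite lerDl ltW].
have [N [N0 uN kN]] := sup_bound (ltW a0) h r0 k4.
have PM := herglotz_bound s0 k0 ik W.
rewrite -/c in PM.
set P := normc (du a + _) in PM kN; set M := normc (du a - _) in PM kN.
have P0 : 0 <= P := normc_ge0 _.
have M0 : 0 <= M := normc_ge0 _.
have NQ := arith1 c1 N0 k16 PM kN.
have E0 : 0 < expR (a * Re kap) := expR_gt0 _.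
have E'0 : 0 < expR (- (a * Re kap)) := expR_gt0 _.
have EE' : expR (a * Re kap) * expR (- (a * Re kap)) = 1 by rewrite -expRD subrr expR0.
have cE : 4 * c * expR (- (a * Re kap)) <= expR (a * Re kap).
  rewrite expRN ler_pdivrMr // -expRD.
  apply: le_trans (expR_ge1Dx _).
  move: kc; rewrite ler_pdivrMr ?mulr_gt0 // => kc.
  have : a * (s * normc kap) <= a * Re kap by rewrite ler_wpM2l // ltW.
  have -> : a * (s * normc kap) = normc kap * (a * s) by ring.
  by lra.
have x0 : 0 <= (0 : R) <= a by rewrite lexx ltW.
have F0 := fwd_le h r0 (lexx 0) (ltW a0) N0 uN.
rewrite mulr0 subr0 -/P -(mulrA (expR _)) in F0.
have B0 := bwd_increment h (lexx 0) (ltW a0) N0 uN.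
rewrite -(mulrA (expR _)) in B0.
have Ba : normc (bwd kap u du a) = expR (a * Re kap) * M by rewrite normcM norm_e.
have B1 : expR (a * Re kap) * M - 2 * (expR (a * Re kap) * (N * Q a)) <= normc (bwd kap u du 0).
  by rewrite lerBlDr -Ba addrC -lerBlDr; apply: le_trans (ler_subnormc _ _) _.
have U0 : normc (bwd kap u du 0) - normc (fwd kap u du 0) <= 2 * normc kap * normc (u 0).
  have <- : normc (2 * kap * u 0) = 2 * normc kap * normc (u 0) by rewrite !normcM normc2.
  rewrite (fwd_bwd kap u du) !mul0r cexp0 !mul1r.
  by apply: le_trans (ler_subnormc _ _) _; rewrite -normcN opprB.
have EM := arith2 (ltW E0) M0 NQ PM (ltW E'0) cE U0 F0 B1.
have u00 := normc_ge0 (u 0).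
have EN : expR (a * Re kap) * N <= C4 * normc (u 0).
  rewrite -(ler_pM2l k0).
  have i1 : expR (a * Re kap) * (normc kap * N) <= expR (a * Re kap) * (P + M) by rewrite ler_pM2l.
  have i2 : expR (a * Re kap) * (P + M) <= expR (a * Re kap) * ((1 + c) * M).
    by rewrite ler_pM2l // addrC mulrDl mul1r lerD2l.
  have i3 : (1 + c) * (expR (a * Re kap) * M) <= (1 + c) * (2 * (2 * normc kap * normc (u 0))).
    by rewrite ler_pM2l.
  have e1 : normc kap * (expR (a * Re kap) * N) = expR (a * Re kap) * (normc kap * N) by ring.
  have e2 : expR (a * Re kap) * ((1 + c) * M) = (1 + c) * (expR (a * Re kap) * M) by ring.
  have e3 : (1 + c) * (2 * (2 * normc kap * normc (u 0))) = normc kap * (C4 * normc (u 0)).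
    by rewrite /C4; ring.
  by rewrite e1 -e3; apply: le_trans i1 _; apply: le_trans i2 _; rewrite e2.
split.
  move=> x /andP[x1 x2]; apply: le_trans (_ : C4 * normc (u 0) <= _); last first.
    by rewrite ler_wpM2r // lerDl.
  apply: le_trans EN; rewrite mulrC -ler_pdivrMr // -expRN.
  apply: le_trans (uN x _); last by rewrite x1.
  rewrite ler_wpM2l ?normc_ge0 // ler_expR lerN2 ler_wpM2r //; lra.
(* The bound is needed at every [x], not only at [a], because the kernel integral evaluates [fwd] at
   all points [a - y]. *)
have FB x : 0 <= x <= a -> normc (fwd kap u du x) <=
    K1 * (1 + normc kap) * normc (u 0) * expR (- (2 * x * Re kap)).
  move=> /andP[x1 x2]; apply: le_trans (fwd_le h r0 x1 x2 N0 uN) _; rewrite -/P.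
  have -> : (a - 2 * x) * Re kap = a * Re kap - 2 * x * Re kap by ring.
  rewrite expRD.
  set e := expR (- (2 * x * Re kap)); have e0 : 0 <= e := expR_ge0 _.
  have j1 : expR (- (a * Re kap)) * P <= e * (C4 * normc kap * normc (u 0)).
    have t1 : expR (- (a * Re kap)) * P <= expR (- (a * Re kap)) * (c * M) by rewrite ler_pM2l.
    have t2 : expR (- (a * Re kap)) * (c * M) =
      expR (- (a * Re kap)) * expR (- (a * Re kap)) * (c * (expR (a * Re kap) * M)).
      have -> : expR (- (a * Re kap)) * expR (- (a * Re kap)) * (c * (expR (a * Re kap) * M)) =
         (expR (a * Re kap) * expR (- (a * Re kap))) * (expR (- (a * Re kap)) * (c * M)) by ring.
      by rewrite EE' mul1r.
    apply: le_trans t1 _; rewrite t2.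
    have t3 : expR (- (a * Re kap)) * expR (- (a * Re kap)) <= e.
      rewrite -expRD ler_expR -opprD lerN2 -mulrDl ler_wpM2r //; lra.
    apply: ler_pM => //.
      by apply: mulr_ge0; [exact: ltW|apply: mulr_ge0 => //; exact: ltW].
    apply: le_trans (_ : c * (2 * (2 * normc kap * normc (u 0))) <= _).
      by rewrite ler_pM2l.
    have -> : c * (2 * (2 * normc kap * normc (u 0))) = 4 * c * (normc kap * normc (u 0)) by ring.
    rewrite /C4 -(mulrA (4 * _)); apply: ler_wpM2r; first by rewrite mulr_ge0 // ltW.
    by rewrite ler_pM2l // lerDr.
  have j2 : 2 * (expR (a * Re kap) * e * N * Q a) <= e * (2 * Q a * C4 * normc (u 0)).
    have -> : 2 * (expR (a * Re kap) * e * N * Q a) = e * (2 * Q a) * (expR (a * Re kap) * N) by ring.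
    have -> : e * (2 * Q a * C4 * normc (u 0)) = e * (2 * Q a) * (C4 * normc (u 0)) by ring.
    by rewrite ler_wpM2l // mulr_ge0 // mulr_ge0.
  apply: le_trans (lerD j1 j2) _; rewrite -mulrDr [leRHS]mulrC; apply: ler_wpM2l => //.
  rewrite /K1; set k := normc kap in k0 *; set v := normc (u 0) in u00 *.
  have t1 : 0 <= C4 * v by rewrite mulr_ge0.
  have t2 : 0 <= C4 * v * Q a by rewrite mulr_ge0.
  have t3 : 0 <= C4 * v * Q a * k by rewrite mulr_ge0 // ltW.
  have -> : C4 * (1 + 2 * Q a) * (1 + k) * v =
    C4 * k * v + 2 * Q a * C4 * v + (C4 * v + 2 * (C4 * v * Q a * k)) by ring.
  by rewrite lerDl addr_ge0 // mulr_ge0.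
have b0 : 0 <= K1 * (1 + normc kap) * normc (u 0).
  by apply: mulr_ge0 => //; apply: mulr_ge0 => //; apply: addr_ge0 => //; exact: ltW.
rewrite remainder_eq ?(ltW a0) //.
have l1 := FB a; rewrite (ltW a0) lexx in l1; have {}l1 := l1 isT.
have l2 := kernel_int_le (ltW a0) (cac_fwd h) b0 FB.
apply: le_trans (le_normcD _ _) _; rewrite (normcM 2) normc2.
apply: le_trans (lerD l1 (ler_wpM2l (ler0n _ 2) l2)) _.
set e := expR _; set v := normc (u 0) in u00 b0 *; set k := normc kap in b0 *.
have -> : K1 * (1 + k) * v * e + 2 * (2 * (goursat_bound q a * (K1 * (1 + k) * v) * e * a)) =
  K2 * ((1 + k) * v * e) by rewrite /K2; ring.
have -> : (C4 + K2) * (1 + k) * v * e = (C4 + K2) * ((1 + k) * v * e) by ring.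
apply: ler_wpM2r; last by rewrite lerDr.
by rewrite mulr_ge0 ?expR_ge0 // mulr_ge0 // addr_ge0 // ltW.
Qed.

End Remainder.

(** * Uniqueness, and return to the pointwise notion of solution *)

Section GlobalSolutions.
Context {R : realType}.
Notation mu := (@lebesgue_measure R).

Lemma rac_continuous_in a b (f f' : R -> R) x : rac a b f f' -> a < x -> x < b ->
  {for x, continuous f}.
Proof.
move=> h ax xb; have ab := lt_trans ax xb.
have [c _ _] := (continuous_within_itvP _ ab).1 (rac_continuous (ltW ab) h).
by apply: c; rewrite in_itv /= ax.
Qed.

Lemma sol_cderiv q z a b (u du : R -> R[i]) x : sol q z a b u du -> a < x -> x < b ->
  cderivable u x /\ cderiv u x = du x.
Proof.
move=> [[h1 h2] [h3 h4]] ax xb.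
have d1 := rac_derivable h1 ax xb (rac_continuous_in h3 ax xb).
have d2 := rac_derivable h2 ax xb (rac_continuous_in h4 ax xb).
split; first by split; [case: d1|case: d2].
apply: complexP; rewrite /cderiv /= derive1E.
  by have [_] := d1.
by have [_] := d2.
Qed.

Lemma near_itv (a b x : R) : a < x -> x < b -> \forall t \near x, a < t < b.
Proof.
move=> ax xb; near=> t; apply/andP; split; near: t; [exact: lt_nbhsr|exact: lt_nbhsl].
Unshelve. all: by end_near. Qed.

Lemma eq_cderiv a b (f g : R -> R[i]) x : (forall t, a < t < b -> f t = g t) ->
  a < x -> x < b -> cderiv f x = cderiv g x.
Proof.
move=> fg ax xb; apply: complexP; rewrite /cderiv /= !derive1E; apply: near_eq_derive;
  by near=> t; rewrite fg //; near: t; exact: near_itv.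
Unshelve. all: by end_near. Qed.

Lemma sol_lin q z a b (u du v dv : R -> R[i]) k : sol q z a b u du -> sol q z a b v dv ->
  sol q z a b (fun x => v x - k * u x) (fun x => dv x - k * du x).
Proof.
move=> [h1 h2] [h3 h4]; split; first exact: cacB h3 (cacZ k h1).
by apply: (cac_eq (cacB h4 (cacZ k h2))) => // x _; ring.
Qed.

(** On short intervals [sol_small_interval] bounds all values by those at one point, so zero data
    stay zero. Steps of length [d / 2] carry this from [c] to any point. *)
Lemma sol_zero q z x y c (u du : R -> R[i]) : sol q z x y u du ->
  mu.-integrable `[x, y] (EFin \o q) -> x <= c <= y -> u c = 0 -> du c = 0 ->
  forall s, x <= s <= y -> u s = 0.
Proof.
move=> h qi cxy uc duc.
have oi := ode_size_integrable z qi.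
have e4 : (0 : R) < 4^-1 by rewrite invr_gt0.
have [d d0 hd] := integral_small oi e4.
have o0 t : 0 <= ode_size q z t by rewrite /ode_size !addr_ge0 ?normc_ge0.
have d2 : 0 < d / 2 by rewrite divr_gt0.
have d2d : d / 2 < d by apply: half_lt.
have step p r s s' : x <= p -> p <= r -> r <= y -> r - p <= d / 2 -> p <= s <= r -> p <= s' <= r ->
    normc (u s) + normc (du s) = 0 -> normc (u s') + normc (du s') = 0.
  move=> xp pr ry rpd hs hs' h0.
  have := @sol_small_interval R q z p r s u du s' (solW h xp ry) (integrable_itvS qi xp ry).
  rewrite h0 mulr0 => H; apply: le_anti; rewrite addr_ge0 ?normc_ge0 // andbT.
  apply: H => //.
  apply: le_trans (ltW (hd p r xp pr ry (le_lt_trans rpd d2d))).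
  rewrite le_eqVlt; apply/orP; left; apply/eqP; apply: eq_Rintegral => t _.
  by rewrite ger0_norm.
(* [n] is the number of steps allowed between [c] and [s]. *)
have all0 n s : x <= s <= y -> `|s - c| <= n%:R * (d / 2) -> normc (u s) + normc (du s) = 0.
  elim: n s => [|n IH] s sxy.
    rewrite mul0r normr_le0 subr_eq0 => /eqP ->.
    by rewrite uc duc normc0 addr0.
  move=> sc; case/andP: cxy => xc cy; case/andP: sxy => xs sy.
  have nd : 0 <= n%:R * (d / 2) by rewrite mulr_ge0 // ltW.
  have nS : n.+1%:R * (d / 2) = n%:R * (d / 2) + d / 2 by rewrite -natr1 mulrDl mul1r.
  rewrite nS in sc; case: (leP c s) => cs.
    rewrite ger0_norm ?subr_ge0 // in sc.
    pose s' := Num.max c (s - d / 2).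
    have cs' : c <= s' by rewrite /s' le_max lexx.
    have s's : s' <= s by rewrite /s' ge_max cs gerBl ltW.
    have sd : s - s' <= d / 2 by rewrite lerBlDr -lerBlDl /s' le_max lexx orbT.
    apply: (step s' s s' s) => //; rewrite ?lexx ?s's // ?(le_trans xc) //.
    apply: IH; first by rewrite (le_trans xc) // (le_trans s's).
    rewrite ger0_norm ?subr_ge0 // lerBlDr /s' ge_max lerDr nd /=.
    by move: sc; rewrite lerBlDr; lra.
  rewrite ltr0_norm ?subr_lt0 // opprB in sc.
  pose s' := Num.min c (s + d / 2).
  have cs' : s' <= c by rewrite /s' ge_min lexx.
  have s's : s <= s' by rewrite /s' le_min (ltW cs) lerDl ltW.
  have sd : s' - s <= d / 2 by rewrite lerBlDl /s' ge_min lexx orbT.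
  apply: (step s s' s' s) => //; rewrite ?lexx ?s's // ?(le_trans cs') //.
  apply: IH; first by rewrite (le_trans xs) // (le_trans cs').
  rewrite ler0_norm ?subr_le0 // opprB lerBlDl -lerBlDr /s' le_min.
  by apply/andP; split; lra.
move=> s sxy; have s0 : normc (u s) + normc (du s) = 0.
  apply: (all0 (Num.bound (`|s - c| / (d / 2)))) => //.
  rewrite -ler_pdivrMr //; apply: ltW; apply: archi_boundP.
  by rewrite divr_ge0 // ltW.
apply: contra_eq s0; rewrite -normc_gt0 => u0.
by rewrite gt_eqF // ltr_pwDl // normc_ge0.
Qed.

Lemma integral_tail (c : R) (v : R -> R) : mu.-integrable `]c, +oo[ (EFin \o v) ->
  (forall x, 0 <= v x) -> forall e, 0 < e ->
  exists X, forall x y, X <= x -> x <= y -> \int[mu]_(t in `[x, y]) v t <= e.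
Proof.
move=> vi v0 e e0; pose d := c + 1.
have cd : c < d by rewrite ltrDl.
have vi' y : mu.-integrable `[d, y] (EFin \o v).
  apply: integrableS vi => //.
  by move=> t /=; rewrite !in_itv /= andbT => /andP[dt _]; exact: lt_le_trans dt.
pose F y := \int[mu]_(t in `[d, y]) v t.
have FM y : F y <= \int[mu]_(t in `]c, +oo[) v t.
  apply: fine_le; [exact: integrable_fin_num|exact: integrable_fin_num|].
  apply: ge0_subset_integral => //; first exact: measurable_int vi.
    by move=> t _; rewrite lee_fin.
  by move=> t /=; rewrite !in_itv /= andbT => /andP[dt _]; exact: lt_le_trans dt.
pose A := [set F y | y in `[d, +oo[].
have As : has_sup A.
  split; first by exists (F d), d => //=; rewrite in_itv /= lexx.
  by exists (\int[mu]_(t in `]c, +oo[) v t) => _ [t _ <-]; exact: FM.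
have [_ [X + <-] FX] := sup_adherent e0 As.
rewrite /= in_itv /= andbT => dX.
have Fcat x y : d <= x -> x <= y -> F y = F x + \int[mu]_(t in `[x, y]) v t.
  by move=> dx xy; exact: Rintegral_itv_cat.
exists X => x y Xx xy; have dx := le_trans dX Xx.
have h1 := Fcat x y dx xy.
have h2 := Fcat X x dX Xx.
have h3 : F y <= sup A.
  by apply: sup_upper_bound => //; exists y => //=; rewrite in_itv /= andbT (le_trans dx).
have h4 : 0 <= \int[mu]_(t in `[X, x]) v t by apply: Rintegral_ge0.
have h5 : \int[mu]_(t in `[x, y]) v t = F y - F x by rewrite h1 addrC addKr.
rewrite h5; have h6 : F X <= F x by rewrite h2 lerDl.
by rewrite lerBlDr; apply: le_trans h3 _; rewrite -lerBlDl; apply: le_trans (ltW FX) h6.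
Qed.

(** The converse of [schroedinger_sol]. It is needed to apply the uniqueness contained in
    [limit_point_at_infinity] to combinations of solutions. *)
Lemma sol_schroedinger (q : R -> R) (b : \bar R) z (u du : R -> R[i]) :
  (forall x y : R, 0 < x -> x <= y -> (y%:E < b)%E -> sol q z x y u du) ->
  schroedinger_solution q b z u /\
  forall x : R, 0 < x -> (x%:E < b)%E -> cderiv u x = du x.
Proof.
move=> h.
have dE x : 0 < x -> (x%:E < b)%E -> cderivable u x /\ cderiv u x = du x.
  move=> x0 xb.
  have [y [xy yb]] : exists y : R, x < y /\ (y%:E < b)%E.
    move: b xb {h} => [r xr|_|]; last by [].
      exists ((x + r) / 2); rewrite !lte_fin in xr *.
      by rewrite ltr_pdivlMr // ltr_pdivrMr //; split; lra.
    by exists (x + 1); rewrite ltrDl; split => //; rewrite ltry.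
  have x2 : x / 2 < x by apply: half_lt.
  have x20 : 0 < x / 2 by rewrite divr_gt0.
  exact: sol_cderiv (h (x / 2) y x20 (ltW (lt_trans x2 xy)) yb) x2 xy.
split; last by move=> x x0 xb; have [] := dE x x0 xb.
split; first by move=> x x0 xb; have [] := dE x x0 xb.
exists (fun x => ((q x)%:C - z) * u x).
  move=> x y x0 xy yb; have [_ h2] := h x y x0 (ltW xy) yb.
  have xb : (x%:E < b)%E by apply: lt_trans yb; rewrite lte_fin.
  split; first exact: cac_integrable h2.
  have [_ ->] := dE y (lt_trans x0 xy) yb; have [_ ->] := dE x x0 xb.
  exact: cac_sub h2 (lexx _) (ltW xy) (lexx _).
by apply: aeW => x x0 xb; ring.
Qed.

End GlobalSolutions.

(** * Positivity of the Wronskian *)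

Section Herglotz.
Context {R : realType}.
Notation mu := (@lebesgue_measure R).
Implicit Types (q : R -> R) (z : R[i]) (u du : R -> R[i]).

Lemma integrable_itv_co (a b : R) (f : R -> R) : mu.-integrable `[a, b[ (EFin \o f) ->
  mu.-integrable `[a, b] (EFin \o f).
Proof.
move=> /integrableP[mf fi]; apply/integrableP; split.
  exact/emeasurable_fun_itv_bndo_bndcP.
by rewrite -integral_itv_bndo_bndc //; exact: measurableT_comp.
Qed.

Lemma ccvg_left_reflect (f : R -> R[i]) b l :
  ccvg (0 : R)^'+ (fun t => f (b - t)) l -> ccvg b^'- f l.
Proof.
move=> /ccvgP h; apply/ccvgP => e e0.
by apply/nbhs_left0P; exact: h.
Qed.

(** Reflection at [b] moves the regular end to 0, where [sol_extend0] provides boundary values. The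
    condition is real, so the Wronskian vanishes there, and by monotonicity it is nonnegative before
    [b]. *)
Lemma wronsk_regular_end q (b : R) z u du (h : option R) x : 0 <= Im z ->
  (forall x y : R, 0 < x -> x <= y -> y < b -> sol q z x y u du) ->
  mu.-integrable `]0, b[ (EFin \o q) ->
  (forall l l', ccvg b^'- u l -> ccvg b^'- du l' ->
    if h is Some h' then l' + h'%:C * l = 0 else l = 0) ->
  0 < x -> x < b -> 0 <= wronsk u du x.
Proof.
move=> z0 hs qi bc x0 xb.
pose a := b - x.
have a0 : 0 < a by rewrite subr_gt0.
have bx : 0 < b := lt_trans x0 xb.
have qi' : mu.-integrable `[0, a] (EFin \o (fun t => q (b - t))).
  apply: integrable_itv_reflect; rewrite subr0 /a subKr.
  apply: integrable_itv_co; apply: integrableS qi => //.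
  by move=> t /=; rewrite !in_itv /= => /andP[xt ->]; rewrite (lt_le_trans x0 xt).
have hr t : 0 < t -> t <= a ->
    sol (fun t => q (b - t)) z t a (fun t => u (b - t)) (fun t => - du (b - t)).
  move=> t0 ta.
  have [h1 h2] : sol q z (b - a) (b - t) u du.
    by apply: hs; rewrite /a ?subKr // ?ltrBlDr ?ltrDl //; move: ta; rewrite /a; lra.
  split; first exact: cac_reflect h1.
  apply: (cac_eq (cacN (cac_reflect h2))) => // s _ /=.
  by rewrite opprK.
have [l [l' [c1 c2 hx]]] := sol_extend0 a0 qi' hr.
have {c1} c1 := ccvg_left_reflect c1.
have {c2} c2 : ccvg b^'- du (- l').
  apply: ccvg_left_reflect; move/ccvgP: c2 => c2; apply/ccvgP => e e0.
  apply: filterS (c2 e e0) => t; rewrite -normcN.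
  by congr (normc _ < _); ring.
have := bc l (- l') c1 c2 => {}bc.
(* [l'] belongs to the reflected solution, so [du] tends to [- l'], and the condition reads
   [l' = h l] with [h] real, or [l = 0]. *)
have W0 : Im (l' * conjc l) = 0.
  case: h bc => [h' /eqP|->]; last by rewrite conjc0 mulr0.
  rewrite addrC subr_eq0 => /eqP <-; rewrite !cparts; ring.
have := wronsk_noninc z0 hx (lexx 0) (ltW a0) (lexx a).
by rewrite /wronsk eqxx gt_eqF // W0 /a subKr mulNr cImN oppr_le0.
Qed.

Lemma normc_neq0_wronsk u du x : wronsk u du x < 0 -> u x != 0.
Proof. by apply: contraTneq => ux; rewrite /wronsk ux conjc0 mulr0 ltxx. Qed.

Lemma L2_tail u : L2_at_infinity u -> forall e : R, 0 < e ->
  exists X, forall x y, X <= x -> x <= y -> \int[mu]_(t in `[x, y]) normc (u t) ^+ 2 <= e.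
Proof.
by move=> [c c0 ui]; apply: (integral_tail ui) => x; exact: sqr_ge0.
Qed.

Let amgm (s p r : R) : 0 < s -> 2 * (p * r) <= s * p ^+ 2 + s^-1 * r ^+ 2.
Proof.
move=> s0; rewrite -subr_ge0.
have -> : s * p ^+ 2 + s^-1 * r ^+ 2 - 2 * (p * r) = s^-1 * (s * p - r) ^+ 2.
  by field; rewrite gt_eqF.
by rewrite mulr_ge0 ?sqr_ge0 // invr_ge0 ltW.
Qed.

(** By the inequality of arithmetic and geometric means the left side of the hypothesis is at least
    [2 sqrt (l d) p r]. *)
Let disc (l d w p r : R) : 0 < p -> 0 < r -> 0 <= l -> 0 <= d -> 0 <= w ->
  l * p ^+ 2 + d * r ^+ 2 <= w * (p * r) -> 4 * (l * d) <= w ^+ 2.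
Proof.
move=> p0 r0 l0 d0 w0 h.
have pr : 0 < (p * r) ^+ 2 by rewrite exprn_gt0 // mulr_gt0.
rewrite -(ler_pM2r pr) -exprMn.
apply: le_trans (_ : (l * p ^+ 2 + d * r ^+ 2) ^+ 2 <= _); last first.
  by rewrite ler_sqr ?nnegrE // ?addr_ge0 ?mulr_ge0 ?sqr_ge0 // ltW.
rewrite -subr_ge0.
have -> : (l * p ^+ 2 + d * r ^+ 2) ^+ 2 - 4 * (l * d) * (p * r) ^+ 2 = (l * p ^+ 2 - d * r ^+ 2) ^+ 2 by ring.
exact: sqr_ge0.
Qed.

(** Suppose the Wronskian of [u] is at most [- d < 0] from [c] on. Let [w] be the Wronskian of [u0]
    and [u], and [L > 0] that of [u0], at a far point [x]. Then
    [L |u|^2 + d |u0|^2 <= |w| |u| |u0|], so [4 L d <= |w|^2]. But [|w|^2] is at most a constant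
    times [L] times the tail of [|u|^2], which is as small as desired. *)
Lemma wronsk_limit_circle q z u du u0 du0 (l : R) : 0 < Im z ->
  (forall s t : R, 0 < s -> mu.-integrable `[s, t] (EFin \o q)) ->
  (forall x y, 0 < x -> x <= y -> sol q 'i%C x y u0 du0) ->
  (forall x y, 0 < x -> x <= y -> sol q z x y u du) ->
  (exists2 x, 0 < x & u0 x != 0) -> L2_at_infinity u ->
  wronsk u0 du0 x @[x --> +oo] --> l -> 0 <= l ->
  ccvg (+oo : set_system R) (fun x => u0 x * du x - du0 x * u x) 0 ->
  forall x, 0 < x -> 0 <= wronsk u du x.
Proof.
move=> z0 qi h0 h u0n uL Wl l0 wl c c0; rewrite leNgt; apply/negP => Wc.
have i1 : Im ('i%C : R[i]) = 1 by [].
have W0ge x : 0 < x -> 0 <= wronsk u0 du0 x.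
  move=> x0; apply: le_trans l0 _; apply: (cvgr_to_le Wl).
  near=> y; apply: (@wronsk_noninc R q 'i%C x y) => //.
    by apply: h0 => //; near: y; exact: nbhs_pinfty_ge.
have W0int x y : 0 < x -> x <= y ->
    \int[mu]_(t in `[x, y]) normc (u0 t) ^+ 2 <= wronsk u0 du0 x.
  move=> x0 xy; have := wronsk_sub (h0 x y x0 xy) (lexx _) xy (lexx _).
  rewrite i1 mul1r => <-; rewrite gerBl; apply: W0ge.
  exact: lt_le_trans xy.
(* Were it 0 at [x], the integral of [|u0|^2] beyond [x] would be 0; then [u0] vanishes beyond [x],
   and by uniqueness everywhere. *)
have W0gt x : 0 < x -> 0 < wronsk u0 du0 x.
  move=> x0; rewrite lt_neqAle W0ge // andbT; apply/negP => /eqP W00.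
  case: u0n => y y0 /negP; apply; apply/eqP.
  have u0x t : x < t -> u0 t = 0.
    move=> xt; apply/eqP; rewrite -[_ == _]negbK -normc_gt0; apply/negP => ut.
    have x1t : t < t + 1 by rewrite ltrDl.
    have hh := h0 x (t + 1) x0 (ltW (lt_trans xt x1t)).
    have c1 := rac_continuous_in (rac_normc_sqr hh) xt x1t.
    have [d d0 hd] : exists2 d, 0 < d & forall s, `|t - s| < d -> normc (u0 t) ^+ 2 / 2 < normc (u0 s) ^+ 2.
      have v0 : 0 < normc (u0 t) ^+ 2 / 2 by rewrite divr_gt0 // exprn_gt0.
      move/cvgrPdist_lt : c1 => /(_ _ v0) /nbhs_ballP[d d0 hd]; exists d => // s sd.
      have := hd s sd; rewrite /= ltr_norml => /andP[_ +].
      by move: (normc (u0 t) ^+ 2) (normc (u0 s) ^+ 2) => p r; lra.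
    pose d' := d / 2.
    have d'0 : 0 < d' by rewrite divr_gt0.
    have d'd : d' < d by apply: half_lt.
    have td : t <= t + d' by rewrite lerDl ltW.
    have t0 := lt_trans x0 xt.
    have sol1 := h0 t (t + d') t0 td.
    have i2 := normc_sqr_integrable sol1.
    have : \int[mu]_(s in `[t, t + d']) (normc (u0 t) ^+ 2 / 2) <= 0.
      apply: le_trans (_ : \int[mu]_(s in `[t, t + d']) normc (u0 s) ^+ 2 <= _).
        apply: le_Rintegral => //.
          exact: cst_integrable.
        move=> s /=; rewrite in_itv /= => /andP[ts sd]; apply: ltW; apply: hd.
        by rewrite ler0_norm ?subr_le0 // opprB; lra.
      apply: le_trans (W0int t (t + d') t0 td) _; rewrite W00.
      have i0 : 0 <= Im ('i%C : R[i]) by rewrite i1.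
      exact: wronsk_noninc i0 hh (lexx _) (ltW xt) (ltW x1t).
    rewrite Rintegral_itv_cst // addrAC subrr add0r leNgt => /negP; apply.
    by rewrite mulr_gt0 // divr_gt0 // exprn_gt0.
  pose p := Num.min (x / 2) (y / 2); pose r := Num.max (x + 2) y.
  have p0 : 0 < p by rewrite lt_min !divr_gt0.
  have px : p < x by rewrite /p gt_min ltr_pdivrMr // ltr_pMr // ltr1n.
  have py : p < y by rewrite /p gt_min orbC ltr_pdivrMr // ltr_pMr // ltr1n.
  have xr : x + 2 <= r by rewrite /r le_max lexx.
  have yr : y <= r by rewrite /r le_max lexx orbT.
  have pr : p <= r by apply: le_trans (ltW py) yr.
  have hpr := h0 p r p0 pr.
  apply: (@sol_zero R q 'i%C p r (x + 1) u0 du0) => //.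
  - exact: qi.
  - by apply/andP; split; lra.
  - by apply: u0x; rewrite ltrDl.
  - have px1 : p < x + 1 by apply: lt_trans px _; rewrite ltrDl.
    have x1r : x + 1 < r by apply: lt_le_trans xr; rewrite ltrD2l ltr1n.
    have [_ <-] := sol_cderiv hpr px1 x1r.
    rewrite (@eq_cderiv R x (x + 2) u0 (fun=> 0)); first last.
    + by lra.
    + by lra.
    + by move=> t /andP[xt _]; exact: u0x.
    by apply: complexP; rewrite /cderiv /= derive1_cst.
  by rewrite (ltW py).
pose d := - wronsk u du c.
have d0 : 0 < d by rewrite oppr_gt0.
have Wd x : c <= x -> wronsk u du x <= - d.
  move=> cx; rewrite opprK.
  exact: wronsk_noninc (ltW z0) (h c x c0 cx) (lexx _) cx (lexx _).
pose C := normc ('i%C - z) + 1.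
have C0 : 0 < C by rewrite ltr_wpDl // normc_ge0.
(* Chosen so that the final inequality becomes [4 L d <= 4 L (d / 2)]. *)
pose e := d / (2 * C ^+ 2).
have e0 : 0 < e by rewrite divr_gt0 // mulr_gt0 // exprn_gt0.
have [X hX] := L2_tail uL e0.
pose x := Num.max X c.
have cx : c <= x by rewrite /x le_max lexx orbT.
have Xx : X <= x by rewrite /x le_max lexx.
have x0 := lt_le_trans c0 cx.
pose w t := u0 t * du t - du0 t * u t.
pose L := wronsk u0 du0 x.
have L0 : 0 < L := W0gt x x0.
(* Since [w' = (i - z) u0 u] and [w] tends to 0, [w x] is bounded by the tail of [|u0 u|]. The
   weighted mean inequality splits it; [L] bounds the tail of [|u0|^2] and [e] that of [|u|^2]. *)
have wle t : 0 < t -> normc (w x) <= C * (t * L + t^-1 * e).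
  move=> t0; apply/ler_addgt0Pl => r r0.
  have [y [xy wy]] : exists y, x <= y /\ normc (w y) < r.
    move/ccvgP : wl => /(_ _ r0) wl.
    have [y [xy wy]] := filter_ex (filterI (nbhs_pinfty_ge (num_real x)) wl).
    by exists y; split => //; move: wy; rewrite sub0r normcN.
  have [a1 a2] := h0 x y x0 xy; have [a3 a4] := h x y x0 xy.
  have hw : cac x y w (fun s => ('i%C - z) * (u0 s * u s)).
    by apply: (cac_eq (cacB (cacM a1 a4) (cacM a2 a3))) => // s _; ring.
  have i2 := normc_sqr_integrable (h0 x y x0 xy).
  have i3 := normc_sqr_integrable (h x y x0 xy).
  have wi : mu.-integrable `[x, y] (EFin \o (fun s => t * normc (u0 s) ^+ 2 + t^-1 * normc (u s) ^+ 2)).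
    have := integrableD (mitv _) (integrableZl (mitv _) t i2) (integrableZl (mitv _) t^-1 i3).
    by apply: eq_integrable => // s _; rewrite /= EFinD !EFinM.
  have C20 : 0 <= C / 2 by rewrite divr_ge0 // ltW.
  have H := cac_increment_le hw (lexx x) xy (lexx y) wi _ C20.
  have {}H : normc (w y - w x) <= 2 * (C / 2 *
      \int[mu]_(s in `[x, y]) (t * normc (u0 s) ^+ 2 + t^-1 * normc (u s) ^+ 2)).
    apply: H => [s|s _].
      by rewrite addr_ge0 // mulr_ge0 ?sqr_ge0 // ?invr_ge0 ltW.
    rewrite !normcM -mulrA; apply: ler_pM; rewrite ?normc_ge0 ?mulr_ge0 ?normc_ge0 //.
      by rewrite /C lerDl.
    by rewrite -ler_pdivrMl ?invr_gt0 // invrK; exact: amgm.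
  have i2' : mu.-integrable `[x, y] (EFin \o (fun s => t * normc (u0 s) ^+ 2)).
    by have := integrableZl (mitv _) t i2; apply: eq_integrable => // s _; rewrite /= EFinM.
  have i3' : mu.-integrable `[x, y] (EFin \o (fun s => t^-1 * normc (u s) ^+ 2)).
    by have := integrableZl (mitv _) t^-1 i3; apply: eq_integrable => // s _; rewrite /= EFinM.
  rewrite RintegralD // !RintegralZl // in H.
  have H2 : t * \int[mu]_(s in `[x, y]) normc (u0 s) ^+ 2 + t^-1 * \int[mu]_(s in `[x, y]) normc (u s) ^+ 2 <=
      t * L + t^-1 * e.
    apply: lerD; first by rewrite ler_pM2l //; exact: W0int.
    by rewrite ler_pM2l ?invr_gt0 //; exact: hX.
  have H3 : normc (w y - w x) <= C * (t * L + t^-1 * e).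
    apply: le_trans H _; rewrite mulrA mulrCA divff ?mulr1 //; by rewrite ler_pM2l.
  have := ler_subnormc (w x) (w y).
  rewrite -(normcN (w x - w y)) opprB => H4.
  have H5 : normc (w x) <= normc (w y - w x) + normc (w y) by rewrite -lerBlDr.
  apply: le_trans H5 _; rewrite addrC; apply: lerD H3; exact: ltW.
(* The weight [t = s / r] minimises [t L + e / t], with minimum [2 sqrt (L e)]. *)
pose s := Num.sqrt e; pose r := Num.sqrt L.
have s0 : 0 < s by rewrite sqrtr_gt0.
have r0 : 0 < r by rewrite sqrtr_gt0.
have se : s ^+ 2 = e by rewrite sqr_sqrtr // ltW.
have rL : r ^+ 2 = L by rewrite sqr_sqrtr // ltW.
have wx : normc (w x) <= C * (2 * (s * r)).
  have := wle (s / r) (divr_gt0 s0 r0); rewrite -se -rL.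
  have -> // : s / r * r ^+ 2 + (s / r)^-1 * s ^+ 2 = 2 * (s * r).
  by field; rewrite !gt_eqF.
have Wx := Wd x cx.
have ux : 0 < normc (u x).
  by rewrite normc_gt0; apply: (@normc_neq0_wronsk _ du); apply: le_lt_trans Wx _; rewrite oppr_lt0.
have u0x : 0 < normc (u0 x).
  rewrite normc_gt0; apply: contraTneq L0 => u00.
  by rewrite /L /wronsk u00 conjc0 mulr0 ltxx.
(* An algebraic identity linking the three Wronskians; it transfers the two signs into a lower bound
   for [|w|]. *)
have key : normc (u0 x) ^+ 2 * wronsk u du x =
    Im (w x * conjc (u0 x * u x)) + L * normc (u x) ^+ 2.
  by rewrite /L /w /wronsk !normc_sqr !cparts; ring.
have q1 : L * normc (u x) ^+ 2 + d * normc (u0 x) ^+ 2 <= normc (w x) * (normc (u x) * normc (u0 x)).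
  have g1 : - normc (w x) * (normc (u x) * normc (u0 x)) <= Im (w x * conjc (u0 x * u x)).
    have -> : - normc (w x) * (normc (u x) * normc (u0 x)) = - normc (w x * conjc (u0 x * u x)).
      by rewrite (normcM (w x)) normc_conjc normcM mulNr (mulrC (normc (u x))).
    by rewrite lerNl; apply: le_trans (ler_norm _) _; rewrite normrN normc_ge_absIm.
  have g2 : normc (u0 x) ^+ 2 * wronsk u du x <= normc (u0 x) ^+ 2 * - d.
    by rewrite ler_pM2l // exprn_gt0.
  by rewrite key in g2; move: g1 g2; lra.
have q2 := disc ux u0x (ltW L0) (ltW d0) (normc_ge0 _) q1.
have q3 : normc (w x) ^+ 2 <= (C * (2 * (s * r))) ^+ 2.
  by rewrite ler_sqr ?nnegrE ?normc_ge0 // !mulr_ge0 // ltW.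
have q4 : (C * (2 * (s * r))) ^+ 2 = 4 * (L * (C ^+ 2 * e)) by rewrite -se -rL; ring.
have q5 : C ^+ 2 * e = d / 2 by rewrite /e; field; rewrite gt_eqF.
have := le_trans q2 q3; rewrite q4 q5 !ler_pM2l //.
by move: d0; lra.
Unshelve. all: by end_near. Qed.

End Herglotz.

(** * Positivity when the negative part of [q] is bounded *)

Section BoundedNegativePart.
Context {R : realType}.
Notation mu := (@lebesgue_measure R).
Variables (q : R -> R) (z : R[i]) (u du : R -> R[i]) (P : R).
Hypothesis z0 : 0 < Im z.
Hypothesis qi : forall s t : R, 0 < s -> mu.-integrable `[s, t] (EFin \o q).
Hypothesis qP : forall a : R, 0 < a -> \int[mu]_(t in `[a, a + 1]) Num.max (- q t) 0 <= P.
Hypothesis hs : forall x y, 0 < x -> x <= y -> sol q z x y u du.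
Hypothesis uL : L2_at_infinity u.
Variables (c : R).
Hypotheses (c0 : 0 < c) (Wc : wronsk u du c < 0).

Let w := - wronsk u du c.
Let w0 : 0 < w. Proof. by rewrite oppr_gt0. Qed.

Let v t := normc (u t) ^+ 2.
Let g t := 2 * Re (du t * conjc (u t)).
Let g' t := 2 * (normc (du t) ^+ 2 + (q t - Re z) * v t).
Let p t := Num.max (- q t) 0 + `|Re z|.
(** Bounds the integral of [p] over intervals of length at most 3, the largest that occur: the final
    argument runs between a point of [[n, n + 1]] and one of [[n + 2, n + 3]]. *)
Let B := 3 * (P + `|Re z|).

Let v_ge0 t : 0 <= v t. Proof. exact: sqr_ge0. Qed.

Let p_ge0 t : 0 <= p t.
Proof. by rewrite addr_ge0 // le_max lexx orbT. Qed.

Let rac_v x y : 0 < x -> x <= y -> rac x y v g.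
Proof. by move=> x0 xy; exact: rac_normc_sqr (hs x0 xy). Qed.

Let rac_g x y : 0 < x -> x <= y -> rac x y g g'.
Proof.
move=> x0 xy; have [h1 h2] := hs x0 xy; have [h _] := cacM h2 (cacJ h1).
apply: (rac_eq (racZ 2 h)) => // t _.
by rewrite /g' /v !normc_sqr !cparts; ring.
Qed.

Let p_integrable x y : 0 < x -> mu.-integrable `[x, y] (EFin \o p).
Proof.
move=> x0; have i1 := qi y x0.
have i2 : mu.-integrable `[x, y] (EFin \o (fun t => Num.max (- q t) 0)).
  apply: (le_integrable _ _ _ i1) => //.
    apply/measurable_EFinP; apply: measurable_maxr => //.
    by apply: measurableT_comp => //; apply/measurable_EFinP; exact: measurable_int i1.
  move=> t _; rewrite /= lee_fin ger0_norm ?le_max ?lexx ?orbT // ge_max normr_ge0 andbT.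
  by rewrite -normrN ler_norm.
have := integrableD (mitv _) i2 (cst_integrable `|Re z| x y).
by apply: eq_integrable => // t _; rewrite /= EFinD.
Qed.

Let p_int1 x : 0 < x -> \int[mu]_(t in `[x, x + 1]) p t <= P + `|Re z|.
Proof.
move=> x0; have i1 := qi (x + 1) x0.
have i2 : mu.-integrable `[x, x + 1] (EFin \o (fun t => Num.max (- q t) 0)).
  have := integrableB (mitv _) (p_integrable (x + 1) x0) (cst_integrable `|Re z| x (x + 1)).
  by apply: eq_integrable => // t _; rewrite /= /p EFinD addeK.
rewrite /p RintegralD //; last exact: cst_integrable.
rewrite Rintegral_itv_cst ?lerDl // (addrAC x) subrr add0r mulr1 lerD2r.
exact: qP.
Qed.

Let p_int x y : 0 < x -> x <= y -> y - x <= 3 -> \int[mu]_(t in `[x, y]) p t <= B.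
Proof.
move=> x0 xy yx.
have i3 := p_integrable (x + 3) x0.
have x1 : x <= x + 1 by rewrite lerDl.
have x2 : x + 1 <= x + 1 + 1 by rewrite lerDl.
have x3 : x + 1 + 1 <= x + 3 by lra.
have e3 : x + 3 = x + 1 + 1 + 1 by ring.
have l1 : \int[mu]_(t in `[x, y]) p t <= \int[mu]_(t in `[x, x + 3]) p t.
  apply: fine_le; [exact: integrable_fin_num (p_integrable y x0)|exact: integrable_fin_num i3|].
  apply: ge0_subset_integral => //; first exact: measurable_int i3.
    by move=> t _; rewrite lee_fin.
  by apply: subset_itv; rewrite bnd_simp // -lerBlDl.
apply: le_trans l1 _.
rewrite (Rintegral_itv_cat i3 x1 (le_trans x2 x3)).
rewrite (Rintegral_itv_cat (integrable_itvS i3 x1 (lexx _)) x2 x3) e3.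
have j1 := p_int1 x0.
have j2 := p_int1 (lt_le_trans x0 x1).
have j3 := p_int1 (lt_le_trans x0 (le_trans x1 x2)).
have -> : B = (P + `|Re z|) + ((P + `|Re z|) + (P + `|Re z|)) by rewrite /B; ring.
exact: lerD j1 (lerD j2 j3).
Qed.

Let B0 : 0 <= B.
Proof.
apply: le_trans (p_int c0 (lexx c) _); last by rewrite subrr.
exact: Rintegral_ge0.
Qed.

Let W_le t : c <= t -> w ^+ 2 <= normc (du t) ^+ 2 * v t.
Proof.
move=> ct.
have Wt : wronsk u du t <= - w.
  rewrite opprK; exact: wronsk_noninc (ltW z0) (hs c0 ct) (lexx _) ct (lexx _).
rewrite /v -exprMn ler_sqr ?nnegrE ?mulr_ge0 ?normc_ge0 ?(ltW w0) //.
rewrite -(normc_conjc (u t)) -normcM; apply: le_trans (normc_ge_absIm _).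
rewrite -normrN; apply: le_trans (ler_norm _); by rewrite lerNr.
Qed.

Let v_gt0 t : c <= t -> 0 < v t.
Proof.
move=> /W_le; rewrite lt_neqAle v_ge0 andbT; apply: contraTneq => <-.
by rewrite mulr0 -ltNge exprn_gt0.
Qed.

(** By [W_le], [|u'|^2 >= w^2 / v]. Hence [v'' >= 2 w^2 / M - 2 M p] wherever [v <= M]: a small
    solution is strongly convex, up to a controlled loss from the negative part of [q]. *)
Let g_incr s t M : c <= s -> s <= t -> t - s <= 3 -> 0 < M ->
  (forall r, s <= r <= t -> v r <= M) ->
  2 * w ^+ 2 / M * (t - s) - 2 * M * B <= g t - g s.
Proof.
move=> cs st ts M0 vM; have s0 := lt_le_trans c0 cs.
have hg := rac_g s0 st; have [gi _] := hg.
rewrite (rac_sub hg (lexx _) st (lexx _)).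
have pi := p_integrable t s0.
have pMi : mu.-integrable `[s, t] (EFin \o (fun r => 2 * M * p r)).
  by have := integrableZl (mitv _) (2 * M) pi; apply: eq_integrable => // r _; rewrite /= EFinM.
have ci := cst_integrable (2 * w ^+ 2 / M) s t.
have di : mu.-integrable `[s, t] (EFin \o (fun r => 2 * w ^+ 2 / M - 2 * M * p r)).
  have := integrableB (mitv _) ci pMi; by apply: eq_integrable.
apply: le_trans (_ : \int[mu]_(r in `[s, t]) (2 * w ^+ 2 / M - 2 * M * p r) <= _); last first.
  apply: le_Rintegral => // r /=; rewrite in_itv /= => /andP[sr rt].
  have vr : v r <= M by apply: vM; rewrite sr.
  have Wr := W_le (le_trans cs sr).
  have d1 : w ^+ 2 / M <= normc (du r) ^+ 2.
    rewrite ler_pdivrMr //; apply: le_trans Wr _.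
    by rewrite ler_wpM2l ?sqr_ge0.
  have d2 : - (M * p r) <= (q r - Re z) * v r.
    apply: le_trans (_ : - p r * v r <= _).
      by rewrite mulNr lerN2 mulrC; apply: ler_wpM2r.
    apply: ler_wpM2r => //; rewrite /p opprD; apply: lerD.
      by rewrite lerNl le_max lexx.
    by rewrite lerN2 ler_norm.
  have -> : 2 * w ^+ 2 / M - 2 * M * p r = 2 * (w ^+ 2 / M - M * p r) by ring.
  by rewrite /g' ler_pM2l //; apply: lerD.
rewrite RintegralB // Rintegral_itv_cst // RintegralZl // lerD2l lerN2 ler_pM2l ?mulr_gt0 //.
exact: p_int.
Qed.

Let g_cvg (x : R) : 0 < x -> {for x, continuous g}.
Proof.
move=> x0; have x2 : x / 2 < x by apply: half_lt.
have x1 : x < x + 1 by rewrite ltrDl.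
have x20 : 0 < x / 2 by rewrite divr_gt0.
exact: rac_continuous_in (rac_g x20 (ltW (lt_trans x2 x1))) x2 x1.
Qed.

Let v_derive (x : R) : 0 < x -> is_derive x 1 v (g x).
Proof.
move=> x0; have x2 : x / 2 < x by apply: half_lt.
have x1 : x < x + 1 by rewrite ltrDl.
have x20 : 0 < x / 2 by rewrite divr_gt0.
exact: rac_derivable (rac_v x20 (ltW (lt_trans x2 x1))) x2 x1 (g_cvg x0).
Qed.

Let v_continuous x y : 0 < x -> x <= y -> {within `[x, y], continuous v}.
Proof. by move=> x0 xy; exact: rac_continuous xy (rac_v x0 xy). Qed.

Let mean_value x y M : c <= x -> x < y -> 0 <= M -> (forall r, x <= r <= y -> v r <= M) ->
  exists2 xi, x < xi < y & `|g xi| * (y - x) <= M.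
Proof.
move=> cx xy M0 vM; have x0 := lt_le_trans c0 cx.
have [||xi xixy e] := @MVT R v g x y xy.
- by move=> t; rewrite in_itv /= => /andP[xt _]; apply: v_derive; exact: lt_trans xt.
- exact: v_continuous (ltW xy).
exists xi; first by rewrite in_itv /= in xixy.
rewrite -[y - x]ger0_norm ?subr_ge0 ?(ltW xy) // -normrM -e ler_norml.
have vx : v x <= M by apply: vM; rewrite lexx ltW.
have vy : v y <= M by apply: vM; rewrite lexx ltW.
have := v_ge0 x; have := v_ge0 y.
by move: (v x) (v y) vx vy => a b h1 h2 h3 h4; apply/andP; split; lra.
Qed.

(** The argument in [sup_ge] yields [w^2 <= (9 + 3 B) M^2]. Since [M < m0 <= 1] there, [M^2] may be
    replaced by [M], which spares a square root. *)
Let m0 := Num.min 1 (w ^+ 2 / (9 + 3 * B)).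

Let B9 : 0 < 9 + 3 * B. Proof. by rewrite ltr_pwDl // mulr_ge0. Qed.

Let m0_gt0 : 0 < m0.
Proof. by rewrite lt_min ltr01 divr_gt0 // exprn_gt0. Qed.

Let arith1 (a b d M : R) : 0 < M -> a <= 3 * M -> - (3 * M) <= b -> d <= a - b -> d <= 6 * M.
Proof. by lra. Qed.

(** The mean value theorem gives points in the two outer thirds of the interval where the slope is
    at most [3 * M]. They are at least 1/3 apart, and by [g_incr] the slope would have to grow more
    than that between them if [M] were small. *)
Let sup_ge y M : c <= y -> 0 < M -> (forall r, y <= r <= y + 1 -> v r <= M) -> m0 <= M.
Proof.
move=> cy M0 vM; rewrite leNgt; apply/negP => Mm.
have t3 : (0 : R) < 3^-1 by rewrite invr_gt0.
have e3 : (3 : R)^-1 + 3^-1 + 3^-1 = 1 by field.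
have [a /andP[a1 a2] ga] : exists2 xi, y < xi < y + 3^-1 & `|g xi| * (y + 3^-1 - y) <= M.
  apply: mean_value => //; [by rewrite ltrDl|exact: ltW|].
  by move=> r /andP[r1 r2]; apply: vM; rewrite r1; lra.
have [b /andP[b1 b2] gb] : exists2 xi, y + 3^-1 + 3^-1 < xi < y + 1 & `|g xi| * (y + 1 - (y + 3^-1 + 3^-1)) <= M.
  apply: mean_value; [lra|lra|exact: ltW|].
  by move=> r /andP[r1 r2]; apply: vM; rewrite r2 andbT; lra.
have ca : c <= a by apply: le_trans cy (ltW a1).
have ab : a + 3^-1 <= b by lra.
have [ab' ba3] : a <= b /\ b - a <= 3 by split; lra.
have vab r : a <= r <= b -> v r <= M.
  by move=> /andP[r1 r2]; apply: vM; rewrite (le_trans (ltW a1) r1); lra.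
have h := g_incr ca ab' ba3 M0 vab.
have l1 : y + 3^-1 - y = 3^-1 by rewrite addrAC subrr add0r.
have l2 : y + 1 - (y + 3^-1 + 3^-1) = 3^-1 by lra.
rewrite l1 in ga; rewrite l2 in gb.
have {}ga : `|g a| <= 3 * M by rewrite -ler_pdivrMl // mulrC.
have {}gb : `|g b| <= 3 * M by rewrite -ler_pdivrMl // mulrC.
move: ga gb; rewrite !ler_norml => /andP[ga _] /andP[_ gb].
have h6 : 2 * w ^+ 2 / M * (b - a) - 2 * M * B <= 6 * M.
  exact: (@arith1 (g b) (g a)).
have h7 : 2 * w ^+ 2 / M * 3^-1 <= 2 * w ^+ 2 / M * (b - a).
  have k0 : 0 <= 2 * w ^+ 2 / M by rewrite divr_ge0 ?(ltW M0) // mulr_ge0 // sqr_ge0.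
  by apply: ler_wpM2l => //; rewrite lerBrDl.
have h8 : 2 * w ^+ 2 / M * 3^-1 <= 6 * M + 2 * M * B by rewrite -lerBlDr; apply: le_trans h6; rewrite lerD2r.
have h9 : w ^+ 2 <= (9 + 3 * B) * M ^+ 2.
  have : 2 * w ^+ 2 / M * 3^-1 * (3 / 2 * M) <= (6 * M + 2 * M * B) * (3 / 2 * M).
    by rewrite ler_wpM2r // mulr_ge0 ?divr_ge0 // ltW.
  have -> : 2 * w ^+ 2 / M * 3^-1 * (3 / 2 * M) = w ^+ 2 by field; rewrite gt_eqF.
  by have -> : (6 * M + 2 * M * B) * (3 / 2 * M) = (9 + 3 * B) * M ^+ 2 by field.
move: Mm; rewrite lt_min => /andP[M1]; rewrite ltr_pdivlMr // mulrC ltNge => /negP; apply.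
apply: le_trans h9 _; rewrite ler_pM2l // expr2 ler_piMr ?ltW //.
Qed.

(** With slope at least [- (2 * v x0 * B)], the loss over length [dl] is less than half of
    [v x0]. *)
Let dl := (4 * B + 4)^-1.

Let dl0 : 0 < dl. Proof. by rewrite invr_gt0 ltr_wpDl // mulr_ge0. Qed.

Let small_point e x : 0 < x -> 0 < e -> \int[mu]_(t in `[x, x + 1]) v t <= e ->
  exists2 t, x <= t <= x + 1 & v t <= 2 * e.
Proof.
move=> x0 e0 ve; apply: contrapT => nh.
have h t : x <= t <= x + 1 -> 2 * e <= v t.
  move=> txx; rewrite leNgt; apply/negP => vt; apply: nh; exists t => //; exact: ltW.
have x1 : x <= x + 1 by rewrite lerDl.
have : 2 * e * (x + 1 - x) <= e.
  apply: le_trans ve; rewrite -Rintegral_itv_cst //; apply: le_Rintegral => //.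
  - exact: cst_integrable.
  - exact: normc_sqr_integrable (hs x0 x1).
by rewrite (addrAC x) subrr add0r mulr1; move: e0; lra.
Qed.

(** Since [u] is L2, far out there are points [x1], [x2] with [v] small, separated by a full unit
    interval, on which [sup_ge] forces a value of at least [m0]. So the maximum of [v] between them
    is interior and [v' = 0] there. To its right [v] decreases so slowly that it stays above half
    the maximum for length [dl], which gives the tail more mass than it has. *)
Lemma wronsk_bounded_negative_absurd : False.
Proof.
(* The first bound makes the values at [x1] and [x2] at most [m0 / 2]; the second puts the tail
   below [dl * m0 / 2], the mass near the maximum. *)
pose e := Num.min (m0 / 4) (dl * m0 / 4).
have e0 : 0 < e by rewrite lt_min !divr_gt0 // mulr_gt0.
have e1 : 2 * e <= m0 / 2.
  have : e <= m0 / 4 by rewrite /e ge_min lexx.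
  by lra.
have e2 : e < dl * m0 / 2.
  have : e <= dl * m0 / 4 by rewrite /e ge_min lexx orbT.
  have : 0 < dl * m0 by rewrite mulr_gt0.
  by move: (dl * m0) => k; lra.
have [X hX] := L2_tail uL e0.
pose n := Num.max X c.
have cn : c <= n by rewrite /n le_max lexx orbT.
have Xn : X <= n by rewrite /n le_max lexx.
have n0 := lt_le_trans c0 cn.
have n20 : 0 < n + 2 by rewrite addr_gt0.
have [x1 /andP[nx1 x1n] vx1] : exists2 t, n <= t <= n + 1 & v t <= 2 * e.
  by apply: small_point => //; apply: hX => //; rewrite lerDl.
have [x2 /andP[nx2 x2n] vx2] : exists2 t, n + 2 <= t <= n + 2 + 1 & v t <= 2 * e.
  apply: small_point => //; apply: hX; last by rewrite lerDl.
  by apply: le_trans Xn _; rewrite lerDl.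
have x10 := lt_le_trans n0 nx1.
have cx1 := le_trans cn nx1.
have x12 : x1 < x2 by lra.
have [x0 + vmax] := EVT_max (ltW x12) (v_continuous x10 (ltW x12)).
rewrite in_itv /= => /andP[x10' x02'].
have vM r : x1 <= r <= x2 -> v r <= v x0 by move=> h; apply: vmax; rewrite in_itv.
have n1 : x1 <= n + 1 by lra.
have cx0 : c <= x0 by lra.
have vx0 := v_gt0 cx0.
have M0 : m0 <= v x0.
  apply: (@sup_ge (n + 1)) => //; first by lra.
  by move=> r /andP[r1 r2]; apply: vM; apply/andP; split; lra.
have e3 : 2 * e < v x0 by apply: le_lt_trans e1 _; apply: lt_le_trans M0; rewrite ltr_pdivrMr // ltr_pMr // ltr1n.
have x1x0 : x1 < x0.
  by rewrite lt_neqAle x10' andbT; apply/eqP => xe; move: e3; rewrite -xe ltNge vx1.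
have x0x2 : x0 < x2.
  by rewrite lt_neqAle x02' andbT; apply/eqP => xe; move: e3; rewrite xe ltNge vx2.
have x00 := lt_trans x10 x1x0.
have g0 : g x0 = 0.
  have h1 : is_derive x0 1 v 0.
    apply: (@derive1_at_max R v x1 x2) => //; first exact: ltW.
    - move=> t; rewrite in_itv /= => /andP[t1 _].
      by have [] := v_derive (lt_trans x10 t1).
    - by rewrite in_itv /= x1x0.
    - by move=> t; rewrite in_itv /= => /andP[t1 t2]; apply: vM; rewrite !ltW.
  have [_ <-] := v_derive x00; by have [_] := h1.
have g_ge t : x0 <= t -> t <= x2 -> - (2 * v x0 * B) <= g t.
  move=> t1 t2; have vMt r : x0 <= r <= t -> v r <= v x0.
    by move=> /andP[r1 r2]; apply: vM; apply/andP; split; lra.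
  have t3 : t - x0 <= 3 by lra.
  have := g_incr cx0 t1 t3 vx0 vMt; rewrite g0 subr0; apply: le_trans.
  have k0 : 0 <= 2 * w ^+ 2 / v x0 by rewrite divr_ge0 // mulr_ge0 // sqr_ge0.
  by rewrite lerDr; apply: mulr_ge0 => //; rewrite subr_ge0.
have v_ge t : x0 <= t -> t <= x2 -> t - x0 <= dl -> v x0 / 2 < v t.
  move=> t1 t2 t3; have hv := rac_v x00 t1; have [gi _] := hv.
  have : - (2 * v x0 * B) * (t - x0) <= v t - v x0.
    rewrite (rac_sub hv (lexx _) t1 (lexx _)) -Rintegral_itv_cst //.
    apply: le_Rintegral => //; first exact: cst_integrable.
    by move=> r /=; rewrite in_itv /= => /andP[r1 r2]; apply: g_ge => //; exact: le_trans t2.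
  have : 2 * v x0 * B * (t - x0) <= 2 * v x0 * B * dl.
    apply: ler_wpM2l => //; exact: mulr_ge0 (mulr_ge0 (ler0n _ 2) (v_ge0 x0)) B0.
  have : 2 * v x0 * B * dl < v x0 / 2.
    rewrite /dl ltr_pdivrMr; last by rewrite ltr_wpDl // mulr_ge0.
    have -> : v x0 / 2 * (4 * B + 4) = 2 * v x0 * B + 2 * v x0 by field.
    by rewrite ltrDl mulr_gt0.
  move: (v t) (v x0) (2 * v x0 * B * dl) => vt vx k h1 h2 h3.
  by move: h2 h3; rewrite mulNr; lra.
have x2d : x0 + dl < x2.
  rewrite ltNge; apply/negP => x2d.
  have : v x0 / 2 < v x2 by apply: v_ge => //; rewrite lerBlDl.
  have h1 : m0 / 2 <= v x0 / 2 by lra.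
  by rewrite ltNge => /negP; apply; apply: le_trans vx2 _; apply: le_trans e1 h1.
have xd : x0 <= x0 + dl by rewrite lerDl ltW.
have : dl * m0 / 2 <= e.
  apply: le_trans (_ : \int[mu]_(t in `[x0, x0 + dl]) v t <= _); last first.
    by apply: hX => //; apply: le_trans Xn _; lra.
  apply: le_trans (_ : \int[mu]_(t in `[x0, x0 + dl]) (v x0 / 2) <= _).
    rewrite Rintegral_itv_cst // (addrAC x0) subrr add0r -mulrA mulrC.
    by rewrite ler_pM2r // ler_pM2r.
  apply: le_Rintegral => //.
  - exact: cst_integrable.
  - exact: normc_sqr_integrable (hs x00 xd).
  move=> t /=; rewrite in_itv /= => /andP[t1 t2]; apply: ltW; apply: v_ge => //.
    exact: le_trans t2 (ltW x2d).
  by rewrite lerBlDl.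
by rewrite leNgt e2.
Qed.

End BoundedNegativePart.

(** * Existence for linear systems with integrable coefficients *)

Section LinearSystem.
Context {R : realType}.
Notation mu := (@lebesgue_measure R).
Variables (I : finType) (c : I -> I -> R -> R) (p : R -> R) (f0 : I -> R).
Hypotheses (mc : forall i j, measurable_fun setT (c i j)) (mp : measurable_fun setT p).
Hypothesis pi : forall a, mu.-integrable `[0, a] (EFin \o p).
Hypothesis cp : forall i j y, `|c i j y| <= p y.
Hypothesis f01 : forall i, `|f0 i| <= 1.

(** Summing over the components costs the factor [#|I|]; with it inside [kp], the majorants are
    simply [P ^+ n / n!]. *)
Let kp y := #|I|%:R * `|p y|.
Let P := absq_int kp.

Let mkp : measurable_fun setT kp.
Proof. by apply: measurable_funM => //; exact: measurableT_comp. Qed.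

Let kpi a : mu.-integrable `[0, a] (EFin \o kp).
Proof.
have := integrableZl (mitv _) #|I|%:R (integrable_norm (pi a)).
by apply: eq_integrable => // t _; rewrite /= EFinM.
Qed.

Let kp_ge0 y : 0 <= kp y. Proof. by rewrite mulr_ge0. Qed.

Let rac_P a : rac 0 a P kp.
Proof.
split => // x _; rewrite /P /absq_int set_itv1 Rintegral_set1 add0r.
by apply: eq_Rintegral => t _; rewrite ger0_norm.
Qed.

Let N i j (xy : R * R) := c i j xy.2 * (lei 0 xy.2 * lei xy.2 xy.1).
Let M n x := P x ^+ n / n`!%:R.

Let P_ge0 x : 0 <= P x. Proof. exact: absq_int_ge0. Qed.

Let P0 : P 0 = 0. Proof. by rewrite /P /absq_int set_itv1 Rintegral_set1. Qed.

Let M_ge0 n x : 0 <= M n x.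
Proof. by rewrite divr_ge0 // exprn_ge0. Qed.

Let mP : measurable_fun setT P.
Proof. exact: (measurable_absq_int mkp kpi). Qed.

Let mM n : measurable_fun setT (M n).
Proof. by apply: measurable_funM => //; exact: measurable_funX. Qed.

(** [P] is a primitive of [kp], so [P^(n+1) / (n+1)!] is one of [kp P^n / n!], by the power rule for
    absolutely continuous functions. *)
Let kpM_integral n x : 0 <= x ->
  mu.-integrable `[0, x] (EFin \o (fun y => kp y * M n y)) /\
  \int[mu]_(y in `[0, x]) (kp y * M n y) = M n.+1 x.
Proof.
move=> x0; have h := racZ (n.+1`!%:R^-1) (rac_X n (rac_P x)).
have {}h : rac 0 x (M n.+1) (fun y => kp y * M n y).
  apply: (rac_eq h) => y _; first by rewrite /M mulrC.
  have n1 : n.+1%:R != 0 :> R by rewrite pnatr_eq0.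
  have n2 : n`!%:R != 0 :> R by rewrite pnatr_eq0 -lt0n fact_gt0.
  rewrite /M factS natrM; field.
  by rewrite n2 /= nat1r n1.
split; first by case: h.
rewrite -(rac_sub h (lexx _) x0 (lexx _)) {2}/M P0 expr0n /= mul0r subr0 //.
Qed.

Let NM n i x :
  (\sum_j \int[mu]_y (`|N i j (x, y)| * M n y)%:E <= (M n.+1 x)%:E)%E.
Proof.
have step j : (\int[mu]_y (`|N i j (x, y)| * M n y)%:E <= \int[mu]_(y in `[0%R, x]) (`|p y| * M n y)%:E)%E.
  rewrite -integral_lei; apply: ge0_le_integral => //.
  - by move=> y _; rewrite lee_fin mulr_ge0.
  - apply/measurable_EFinP; apply: measurable_funM; last exact: mM.
    have mN : measurable_fun setT (fun y => N i j (x, y)).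
      have -> : (fun y => N i j (x, y)) = fun y => c i j y * (lei 0 y * lei y x) by [].
      by apply: measurable_funM => //; apply: measurable_funM; exact: measurable_ler_ind.
    exact: measurableT_comp mN.
  - apply/measurable_EFinP; apply: measurable_funM.
      by apply: measurable_funM; [exact: measurableT_comp mp|exact: mM].
    by apply: measurable_funM; exact: measurable_ler_ind.
  move=> y _; rewrite lee_fin /N /= !normrM !lei_norm mulrAC.
  rewrite ler_wpM2r ?mulr_ge0 ?lei_ge0 // ler_wpM2r //.
  by apply: le_trans (cp i j y) _; exact: ler_norm.
apply: le_trans (lee_sum _ (fun j _ => step j)) _.
case: (leP 0 x) => x0; last first.
  rewrite set_itv_ge ?bnd_simp -?ltNge //.
  by rewrite big1 ?lee_fin // => j _; rewrite integral_set0.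
have [i1 e1] := kpM_integral n x0.
rewrite -ge0_integral_sum //; last 2 first.
- by move=> j; apply/measurable_EFinP; apply: measurable_funTS;
    apply: measurable_funM; [exact: measurableT_comp mp|exact: mM].
- by move=> j y _; rewrite lee_fin mulr_ge0.
rewrite -e1 /Rintegral fineK ?integrable_fin_num //.
rewrite le_eqVlt; apply/orP; left; apply/eqP; apply: eq_integral => y _.
rewrite sumEFin sumr_const /kp -mulrA mulr_natl; congr (_ *+ _)%:E.
Qed.

Let M_summable x : cvgn (series (fun n => M n x)).
Proof. exact: is_cvg_series_exp_coeff. Qed.

Lemma linear_system : exists f : I -> R -> R, (forall i, f i 0 = f0 i) /\
  forall i a, rac 0 a (f i) (fun y => \sum_j c i j y * f j y).
Proof.
have [] := @picard _ (measurableTypeR R) R mu _ I N (fun i _ => f0 i) M.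
- by move=> h mh; exact: measurable_Rintegral_param.
- move=> i j; apply: measurable_funM; first exact: measurableT_comp (mc i j) measurable_snd.
  by apply: measurable_funM; exact: measurable_ler_ind.
- by move=> i; exact: measurable_cst.
- exact: mM.
- exact: M_ge0.
- by move=> i x; rewrite /M expr0 fact0 divr1.
- by move=> n i x; exact: NM.
- exact: M_summable.
move=> f [mf _ fi fE].
have fi' i j a : mu.-integrable `[0, a] (EFin \o (fun y => c i j y * f j y)).
  apply/integrable_lei; have := fi i j a; apply: eq_integrable => // y _.
  by rewrite /N /=; congr EFin; ring.
have fE' i x : f i x = f0 i + \sum_j \int[mu]_(y in `[0, x]) (c i j y * f j y).
  rewrite fE; congr (_ + _); apply: eq_bigr => j _; rewrite -Rintegral_lei.
  by apply: eq_Rintegral => y _; rewrite /N /=; ring.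
have f00 i : f i 0 = f0 i.
  by rewrite fE' big1 ?addr0 // => j _; rewrite set_itv1 Rintegral_set1.
exists f; split => // i a; split.
  have := @integrable_sum _ _ _ mu _ (mitv `[0, a]) I (index_enum I) xpredT _ (fun j _ => fi' i j a).
  by apply: eq_integrable => // y _; rewrite /= sumEFin.
move=> x _; rewrite f00 fE'; congr (_ + _).
have fin j : (\int[mu]_(y in `[0%R, x]) (c i j y * f j y)%:E =
    (\int[mu]_(y in `[0, x]) (c i j y * f j y))%:E)%E.
  by rewrite /Rintegral fineK // integrable_fin_num //; exact: fi'.
apply: EFin_inj; rewrite -sumEFin (eq_bigr _ (fun j _ => esym (fin j))).
rewrite -integral_sum //; last by move=> j; exact: fi'.
rewrite [in RHS]/Rintegral fineK.
  by apply: eq_integral => y _; rewrite sumEFin.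
apply: integrable_fin_num => //.
have := @integrable_sum _ _ _ mu _ (mitv `[0, x]) I (index_enum I) xpredT _ (fun j _ => fi' i j x).
by apply: eq_integrable => // y _; rewrite /= sumEFin.
Qed.

End LinearSystem.

Section InitialValueProblem.
Context {R : realType}.
Notation mu := (@lebesgue_measure R).
Variables (q : R -> R) (z : R[i]).
Hypothesis (mq : measurable_fun setT q).
Hypothesis (qi : forall a, mu.-integrable `[0, a] (EFin \o q)).

(* The unknowns are indexed by a pair telling the derivative from the function
   and the real part from the imaginary part. *)
Let coeff (i j : bool * bool) (y : R) : R :=
  match i, j with
  | (false, r), (true, s) => (r == s)%:R
  | (true, true), (false, true) | (true, false), (false, false) => q y - Re z
  | (true, true), (false, false) => Im z
  | (true, false), (false, true) => - Im z
  | _, _ => 0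
  end.

Let bound (y : R) := 1 + (`|q y| + normc z).

Let sum4 (F : bool * bool -> R) :
  \sum_j F j = F (true, true) + F (true, false) + (F (false, true) + F (false, false)).
Proof.
rewrite (eq_bigr (fun j => F (j.1, j.2))); last by case.
by rewrite -(pair_bigA _ (fun a b => F (a, b))) /= !big_bool.
Qed.

(** Data of norm at most 1 fit the initial majorant, which is 1, and are enough for the fundamental
    system with data [(1, 0)] and [(0, 1)]. *)
Lemma initial_value_problem (al be : R[i]) : normc al <= 1 -> normc be <= 1 ->
  exists u du : R -> R[i], [/\ u 0 = al, du 0 = be & forall a, sol q z 0 a u du].
Proof.
move=> al1 be1.
pose f0 (i : bool * bool) : R := match i with
  | (false, true) => Re al | (false, false) => Im al
  | (true, true) => Re be | (true, false) => Im be end.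
have [] := @linear_system R _ coeff bound f0.
- move=> [[] []] [[] []] /=; try exact: measurable_cst; exact: measurable_funB.
- apply: measurable_funD => //; apply: measurable_funD => //; exact: measurableT_comp.
- by move=> a; exact: ode_size_integrable.
- have b1 y : 1 <= bound y by rewrite lerDl addr_ge0 ?normc_ge0.
  have b0 y : 0 <= bound y by exact: le_trans (b1 y).
  have bi y : `|Im z| <= bound y.
    apply: le_trans (normc_ge_absIm _) _.
    by rewrite /bound; have := normr_ge0 (q y); lra.
  have br y : `|q y - Re z| <= bound y.
    apply: le_trans (ler_normB _ _) _; rewrite /bound addrCA lerD2l.
    by apply: le_trans (normc_ge_absRe _) _; rewrite lerDr.
  by move=> [[] []] [[] []] y /=; rewrite ?normr0 ?normr1 ?normrN.
- move=> [[] []] /=;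
    [apply: le_trans (normc_ge_absRe _) be1|apply: le_trans (normc_ge_absIm _) be1
    |apply: le_trans (normc_ge_absRe _) al1|apply: le_trans (normc_ge_absIm _) al1].
move=> f [f00 hf].
exists (fun x => f (false, true) x +i* f (false, false) x), (fun x => f (true, true) x +i* f (true, false) x).
split; [by apply: complexP; rewrite /= f00|by apply: complexP; rewrite /= f00|].
by move=> a; split; split; (apply: (rac_eq (hf _ a)) => // y _; rewrite sum4 /= ?cparts /=; ring).
Qed.

End InitialValueProblem.

(** * Positivity in the limit point case *)

Section LimitPoint.
Context {R : realType}.
Notation mu := (@lebesgue_measure R).

Lemma integrable_ray (c M : R) (v : R -> R) : (forall x, 0 <= v x) ->
  (forall y, mu.-integrable `[c, y] (EFin \o v)) ->
  (forall y, \int[mu]_(t in `[c, y]) v t <= M) ->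
  mu.-integrable `]c, +oo[ (EFin \o v).
Proof.
move=> v0 vi vM.
pose F (n : nat) := [set` `[c, c + n%:R]] : set R.
have bF : [set` `[c, +oo[] = \bigcup_n F n.
  apply/seteqP; split => x /=; rewrite in_itv /=.
    rewrite andbT => cx; exists (Num.bound (x - c)) => //; rewrite /F /= in_itv /= cx /=.
    by rewrite -lerBlDl; apply: ltW; apply: archi_boundP; rewrite subr_ge0.
  by move=> [n _]; rewrite /F /= in_itv /= => /andP[->].
have mv : measurable_fun `[c, +oo[ (EFin \o v).
  rewrite bF; apply/measurable_fun_bigcup; first by move=> n; exact: mitv.
  by move=> n; exact: measurable_int (vi _).
apply: (@integrableS _ _ _ mu `[c, +oo[) => //.
  by move=> x /=; rewrite !in_itv /= !andbT; exact: ltW.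
apply/integrableP; split => //.
have h : (\int[mu]_(x in F n) (v x)%:E @[n --> \oo] --> \int[mu]_(x in \bigcup_n F n) (v x)%:E)%E.
  apply: ge0_nondecreasing_set_cvg_integral.
  - move=> m n mn; rewrite subsetEset; apply: subset_itv; rewrite bnd_simp //.
    by rewrite lerD2l ler_nat.
  - by move=> n; exact: mitv.
  - by move=> n; exact: measurable_int (vi _).
  - by move=> n x _; rewrite lee_fin.
apply: le_lt_trans (ltry M); rewrite bF.
under eq_integral => x _ do rewrite /= ger0_norm //.
rewrite -(cvg_lim _ h) //; apply: lime_le; first by apply/cvg_ex; eexists; exact: h.
near=> n.
have -> : (\int[mu]_(x in F n) (v x)%:E = (\int[mu]_(x in F n) v x)%:E)%E.
  have fi := integrable_fin_num (mitv _) (vi (c + n%:R)).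
  by rewrite /Rintegral fineK.
by rewrite lee_fin; exact: vM.
Unshelve. all: by end_near. Qed.

Let cval (p : R * R) : R[i] := p.1 +i* p.2.

(** As a function of the coefficient [p], the Wronskian of [v - p u] is a real quadratic polynomial
    with leading part [|p|^2 wronsk u]. If [wronsk u] is negative, the set where it is nonnegative
    is bounded: this is the equation of the disc. *)
Let wronsk_cross (u du v dv : R -> R[i]) x (p : R * R) :
  wronsk (fun x => v x - cval p * u x) (fun x => dv x - cval p * du x) x =
  wronsk v dv x + p.1 * - (Im (dv x * conjc (u x)) + Im (du x * conjc (v x))) +
  p.2 * (Re (dv x * conjc (u x)) - Re (du x * conjc (v x))) +
  (p.1 ^+ 2 + p.2 ^+ 2) * wronsk u du x.
Proof. by rewrite /wronsk !cparts /=; ring. Qed.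

Let closed_wronsk (u du v dv : R -> R[i]) x : closed [set p : R * R |
  0 <= wronsk (fun x => v x - cval p * u x) (fun x => dv x - cval p * du x) x].
Proof.
under eq_set => p do rewrite wronsk_cross.
apply: (preimage_closed _ (@closed_ge R 0)) => p _.
have c1 : (r.1 @[r --> p]) --> p.1 by exact: cvg_fst.
have c2 : (r.2 @[r --> p]) --> p.2 by exact: cvg_snd.
apply: cvgD.
  by apply: cvgD; [apply: cvgD; [exact: cvg_cst|exact: cvgMl]|exact: cvgMl].
apply: cvgMl; apply: cvgD; rewrite expr2; exact: cvgM.
Qed.

(** For the maximum [s] of [|x|] and [|y|], the quadratic term is at least [w s^2] and the others at
    most [K s]. The 1 added to [K / w] ensures [s > 1], so that the constant term too is at most
    [|W| s]. *)
Let quadratic_bound (a b w x y : R) (W : R) : 0 < w ->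
  0 <= W + x * a + y * b + (x ^+ 2 + y ^+ 2) * - w ->
  `|x| <= (`|W| + `|a| + `|b|) / w + 1 /\ `|y| <= (`|W| + `|a| + `|b|) / w + 1.
Proof.
move=> w0 h; set K := `|W| + _ + _; pose s := Num.max `|x| `|y|.
have K0 : 0 <= K by rewrite !addr_ge0.
suff sK : s <= K / w + 1.
  by split; apply: le_trans sK; rewrite /s le_max lexx ?orbT.
rewrite leNgt; apply/negP => sK.
have s1 : 1 < s by apply: le_lt_trans sK; rewrite lerDr divr_ge0 // ltW.
have s0 : 0 < s := lt_trans ltr01 s1.
have xs : `|x| <= s by rewrite /s le_max lexx.
have ys : `|y| <= s by rewrite /s le_max lexx orbT.
have h1 : W <= `|W| * s by apply: le_trans (ler_norm _) _; rewrite ler_peMr // ltW.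
have h2 : x * a <= `|a| * s.
  by apply: le_trans (ler_norm _) _; rewrite normrM mulrC ler_wpM2l.
have h3 : y * b <= `|b| * s.
  by apply: le_trans (ler_norm _) _; rewrite normrM mulrC ler_wpM2l.
have h4 : s ^+ 2 <= x ^+ 2 + y ^+ 2.
  rewrite -(real_normK (num_real x)) -(real_normK (num_real y)) /s maxElt.
  by case: ifP => _; rewrite ?lerDl ?lerDr sqr_ge0.
have h5 : w * s ^+ 2 <= K * s.
  apply: le_trans (_ : w * (x ^+ 2 + y ^+ 2) <= _); first by rewrite ler_pM2l.
  have -> : K * s = `|W| * s + `|a| * s + `|b| * s by rewrite /K !mulrDl.
  by rewrite mulrN mulrC in h; lra.
have h6 : w * s <= K by rewrite -(ler_pM2r s0) -mulrA -expr2.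
have h7 : s <= K / w by rewrite ler_pdivlMr // mulrC.
by move: sK; rewrite ltNge => /negP; apply; apply: le_trans h7 _; rewrite lerDl.
Qed.

Variables (q : R -> R) (z : R[i]).
Hypothesis z0 : 0 < Im z.
Hypothesis (mq : measurable_fun setT q).
Hypothesis (qi : forall a, mu.-integrable `[0, a] (EFin \o q)).

Let gsol (u du : R -> R[i]) := forall x y, 0 < x -> x <= y -> sol q z x y u du.

(* If the Wronskian of [u] is negative at [c], then the coefficients [t] for
   which [v - t u] has nonnegative Wronskian at [x] form a disc (Weyl's), for
   all [x >= c]. The discs are nested; a common point gives an L2 solution. *)
Let weyl_disc u du v dv c : gsol u du -> gsol v dv -> 0 < c -> wronsk u du c < 0 ->
  exists t, L2_at_infinity (fun x => v x - t * u x).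
Proof.
move=> hu hv c0 Wc.
pose f p x := v x - cval p * u x; pose df p x := dv x - cval p * du x.
have hf p : gsol (f p) (df p).
  by move=> x y x0 xy; apply: sol_lin; [exact: hu|exact: hv].
have f_noninc p x y : 0 < x -> x <= y -> wronsk (f p) (df p) y <= wronsk (f p) (df p) x.
  by move=> x0 xy; exact: wronsk_noninc (ltW z0) (hf p x y x0 xy) (lexx _) xy (lexx _).
have Wx x : c <= x -> wronsk u du x < 0.
  move=> cx; apply: le_lt_trans Wc.
  exact: wronsk_noninc (ltW z0) (hu c x c0 cx) (lexx _) cx (lexx _).
pose T := (`|wronsk v dv c| + `|- (Im (dv c * conjc (u c)) + Im (du c * conjc (v c)))| +
  `|Re (dv c * conjc (u c)) - Re (du c * conjc (v c))|) / - wronsk u du c + 1.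
have DT p : 0 <= wronsk (f p) (df p) c -> `|p.1| <= T /\ `|p.2| <= T.
  rewrite wronsk_cross -{1}(opprK (wronsk u du c)) => h.
  by apply: quadratic_bound h; rewrite oppr_gt0.
(* The coefficient for which [v - t u] vanishes at [c + n]. Its Wronskian is 0 there, hence
   nonnegative on [[c, c + n]]. *)
pose t (n : nat) : R * R := let w := v (c + n%:R) / u (c + n%:R) in (Re w, Im w).
have tD n x : c <= x -> x <= c + n%:R -> 0 <= wronsk (f (t n)) (df (t n)) x.
  move=> cx xn; apply: le_trans (f_noninc _ _ _ (lt_le_trans c0 cx) xn).
  have un : u (c + n%:R) != 0.
    by apply: (@normc_neq0_wronsk _ _ du); apply: Wx; rewrite lerDl.
  have -> : wronsk (f (t n)) (df (t n)) (c + n%:R) = 0; last by [].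
  rewrite /wronsk /f.
  have -> : cval (t n) = v (c + n%:R) / u (c + n%:R) by apply: complexP.
  by rewrite divfK // subrr conjc0 mulr0.
(* All [t n] lie in the disc at [c], hence in a compact square. The disc at each [x] is closed and
   contains almost all of them, so a cluster point lies in every disc. *)
pose K := [set` `[- T, T]] `*` [set` `[- T, T]] : set (R * R).
have cK : compact K by apply: compact_setX; exact: segment_compact.
have tK : \forall n \near \oo, K (t n).
  near=> n; have cn : c <= c + n%:R by rewrite lerDl.
  have [h1 h2] := DT (t n) (tD n c (lexx c) cn).
  by rewrite /K /= !in_itv /= -!ler_norml; split.
have [p [_ clp]] := cK (t n @[n --> \oo]) _ tK.
have pD x : c <= x -> 0 <= wronsk (f p) (df p) x.
  move=> cx.
  have cl := @closed_wronsk u du v dv x.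
  have ev : \forall n \near \oo, 0 <= wronsk (f (t n)) (df (t n)) x.
    near=> n; apply: tD => //; rewrite -lerBlDl; near: n.
    exists (Num.bound (x - c)) => // n /= nx; apply: ltW.
    apply: lt_le_trans (archi_boundP _) _; first by rewrite subr_ge0.
    by rewrite ler_nat.
  by apply: (cl p) => B nB; exact: clp ev nB.
exists (cval p), c => //.
(* [Im z] times the integral of [|f|^2] over [[c, y]] is the decrease of the Wronskian, which is at
   most its value at [c] because it stays nonnegative. *)
apply: (@integrable_ray c (wronsk (f p) (df p) c / Im z)).
- by move=> x; exact: sqr_ge0.
- move=> y; case: (leP c y) => cy; first exact: normc_sqr_integrable (hf p c y c0 cy).
  by rewrite set_itv_ge ?bnd_simp -?ltNge //; exact: integrable_set0.
move=> y; case: (leP c y) => cy; last first.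
  rewrite set_itv_ge ?bnd_simp -?ltNge // Rintegral_set0.
  by rewrite divr_ge0 ?(ltW z0) //; exact: pD.
rewrite ler_pdivlMr // mulrC -(wronsk_sub (hf p c y c0 cy)) //.
by rewrite gerBl; exact: pD.
Unshelve. all: by end_near. Qed.

(** If the Wronskian of [u] were negative somewhere, [weyl_disc] would make every solution the sum
    of a multiple of [u] and an L2 solution. By uniqueness both are multiples of [u1], so all
    solutions would be proportional, which a fundamental system refutes. *)
Lemma wronsk_limit_point u du : limit_point_at_infinity q ->
  gsol u du -> L2_at_infinity u -> forall x, 0 < x -> 0 <= wronsk u du x.
Proof.
move=> lp hu uL c c0; rewrite leNgt; apply/negP => Wc.
have [u1 [s1 _ _ uniq]] := lp z z0.
have qi' s t : 0 < s -> mu.-integrable `[s, t] (EFin \o q).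
  by move=> s0; exact: integrable_itvS (qi t) (ltW s0) (lexx t).
have h1 : gsol u1 (cderiv u1).
  move=> x y x0 xy; apply: (schroedinger_sol s1) => //; last exact: ltry.
  by move=> s t s0 _; exact: qi'.
have sch v dv : gsol v dv -> schroedinger_solution q +oo%E z v.
  by move=> hv; have [] := @sol_schroedinger R q +oo%E z v dv (fun x y x0 xy _ => hv x y x0 xy).
have [k2 uk2] := uniq u (sch _ _ hu) uL.
have mult v dv : gsol v dv -> exists k, forall x, 0 < x -> v x = k * u1 x /\ dv x = k * cderiv u1 x.
  move=> hv; have [t tL] := weyl_disc hu hv c0 Wc.
  have hf : gsol (fun x => v x - t * u x) (fun x => dv x - t * du x).
    by move=> x y x0 xy; apply: sol_lin; [exact: hu|exact: hv].
  have [k1 fk1] := uniq _ (sch _ _ hf) tL.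
  have vk x : 0 < x -> v x = (k1 + t * k2) * u1 x.
    by move=> x0; rewrite mulrDl -mulrA -uk2 // -fk1 // subrK.
  exists (k1 + t * k2) => x x0; split; first exact: vk.
  have x2 : x / 2 < x by apply: half_lt.
  have x1 : x < x + 1 by rewrite ltrDl.
  have x20 : 0 < x / 2 by rewrite divr_gt0.
  have x21 := ltW (lt_trans x2 x1).
  have [_ <-] := sol_cderiv (hv _ _ x20 x21) x2 x1.
  have [a1 a2] := h1 _ _ x20 x21.
  have hk : sol q z (x / 2) (x + 1) (fun y => (k1 + t * k2) * u1 y) (fun y => (k1 + t * k2) * cderiv u1 y).
    split; first exact: cacZ.
    by apply: (cac_eq (cacZ _ a2)) => // y _; ring.
  have [_ <-] := sol_cderiv hk x2 x1.
  apply: (@eq_cderiv _ (x / 2) (x + 1)) => // y /andP[y1 _].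
  by apply: vk; exact: lt_trans y1.
have n1 : normc (1 : R[i]) <= 1 by rewrite normc1.
have n0 : normc (0 : R[i]) <= 1 by rewrite normc0.
have [th [dth [th0 dth0 hth]]] := initial_value_problem z mq qi n1 n0.
have [ph [dph [ph0 dph0 hph]]] := initial_value_problem z mq qi n0 n1.
have [al hal] : exists k, forall x, 0 < x -> th x = k * u1 x /\ dth x = k * cderiv u1 x.
  by apply: mult => x y x0 xy; exact: solW (hth y) (ltW x0) (lexx _).
have [be hbe] : exists k, forall x, 0 < x -> ph x = k * u1 x /\ dph x = k * cderiv u1 x.
  by apply: mult => x y x0 xy; exact: solW (hph y) (ltW x0) (lexx _).
(* The Wronskian of [th] and [ph] is constant and equal to 1 at 0; proportionality to [u1] makes it
   0 at 1. *)
have [b1 b2] := hth 1; have [b3 b4] := hph 1.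
have hD : cac 0 1 (fun x => th x * dph x - dth x * ph x) (fun=> 0).
  by apply: (cac_eq (cacB (cacM b1 b4) (cacM b2 b3))) => // x _; ring.
have := cac_sub hD (lexx _) ler01 (lexx _).
rewrite th0 dth0 ph0 dph0 /cintegral !Rintegral_cst // !mul0r.
have [-> ->] := hal 1 ltr01; have [-> ->] := hbe 1 ltr01.
have -> : al * u1 1 * (be * cderiv u1 1) - al * cderiv u1 1 * (be * u1 1) = 0 by ring.
rewrite mulr1 subr0 sub0r => /(congr1 (@Re R)); rewrite cReN /= => /eqP.
by rewrite oppr_eq0 oner_eq0.
Qed.

End LimitPoint.

(** * The asymptotics *)

Section Sector.
Context {R : realType}.

(** For [kap = r exp (i theta)] in the sector, [cos theta] and [- sin theta] are both at least
    [sin eps]. *)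
Lemma sector_lower_bound (eps : R) : 0 < eps -> exists2 s : R, 0 < s &
  forall kap, sector eps kap ->
    s * normc kap <= Re kap /\ s * normc kap <= - Im kap.
Proof.
move=> e0; case: (ltP eps (pi / 2)) => e2; last first.
  (* For [eps >= pi / 2] the sector is empty. *)
  exists 1 => // kap [r [th [r0 th1 th2 _]]]; exfalso.
  have := lt_trans th1 th2; have := @pi_gt0 R; lra.
exists (sin eps); first by apply: sin_gt0_pihalf; rewrite e0.
move=> kap [r [th [r0 th1 th2 ->]]].
have sin_le x : eps < x -> x < pi / 2 - eps -> sin eps <= sin x.
  move=> ex x2; apply: ltW; rewrite ltr_sin // in_itv /=; apply/andP; split; lra.
have nr : normc (r%:C * cexp (0 +i* th)) = r.
  by rewrite normcM normcC normc_cexp /= expR0 mulr1 ger0_norm // ltW.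
rewrite nr cReM cImM cReC cImC /= expR0 !mul0r subr0 addr0 !mul1r.
rewrite -mulrN (mulrC (sin eps)) !ler_pM2l //; split.
  by rewrite -sinDpihalf; apply: sin_le; lra.
by rewrite -sinN; apply: sin_le; lra.
Qed.

Lemma infinity_inP (S P : set R[i]) : infinity_in S P <->
  exists M : R, forall kap, M < normc kap -> S kap -> P kap.
Proof.
split; first by move=> [M _ h]; exists M => kap Mk Sk; exact: h.
by move=> [M h]; exists M => // kap /= Mk Sk; exact: h.
Qed.

#[local] Instance infinity_in_filter (S : set R[i]) : Filter (infinity_in S).
Proof.
apply: within_filter; apply: filter_from_filter; first by exists 0.
move=> M N _ _; exists (Num.max M N) => // kap /=.
by rewrite gt_max => /andP[].
Qed.

(** From [expR (c t) >= (c t / 2)^2], the square of [expR x >= 1 + x] at half the argument, and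
    [K (1 + t) <= 2 K t]; comparing the two gives the threshold for [t]. *)
Let exp_decay (c e K t : R) : 0 < c -> 0 < e -> 0 <= K -> 1 <= t -> 8 * K / (c ^+ 2 * e) < t ->
  K * (1 + t) * expR (- (c * t)) < e.
Proof.
move=> c0 e0 K0 t1; have t0 : 0 < t := lt_le_trans ltr01 t1.
rewrite ltr_pdivrMr ?mulr_gt0 ?exprn_gt0 // => Kt.
rewrite expRN ltr_pdivrMr ?expR_gt0 //.
have h1 : (c * t / 2) ^+ 2 <= expR (c * t).
  have -> : c * t = c * t / 2 + c * t / 2 by field.
  rewrite expRD -expr2 -splitr ler_sqr ?nnegrE ?expR_ge0 ?divr_ge0 ?mulr_ge0 ?ltW //.
  by apply: lt_le_trans (expR_ge1Dx _); rewrite ltrDr.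
apply: lt_le_trans (_ : e * (c * t / 2) ^+ 2 <= _); last by rewrite ler_pM2l.
apply: le_lt_trans (_ : 2 * K * t < _).
  rewrite -mulrA (mulrC 2) -mulrA ler_wpM2l //; lra.
have -> : e * (c * t / 2) ^+ 2 = (t * (c ^+ 2 * e)) * (t / 4) by field.
have -> : 2 * K * t = 8 * K * (t / 4) by field.
by rewrite ltr_pM2r // divr_gt0.
Qed.

Let normc_exp_weight (a : R) (kap : R[i]) :
  normc (cexp (- (2 * a)%:C * kap)) = expR (- (2 * a * Re kap)).
Proof. by rewrite normc_cexp !cparts oppr0 mul0r subr0 mulNr. Qed.

(** After division by the exponential [g] only [K (1 + |kap|)] is left, and [|g|^eta] decays
    exponentially in [|kap|] on the sector, for every [eta > 0]. *)
Lemma tildeO_exp (eps a K C0 : R) (f : R[i] -> R[i]) : 0 < a -> 0 < eps -> 0 <= K ->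
  (forall kap, sector eps kap -> C0 <= normc kap ->
     normc (f kap) <= K * (1 + normc kap) * expR (- (2 * a * Re kap))) ->
  tildeO (infinity_in (sector eps)) f (fun kap => cexp (- (2 * a)%:C * kap)).
Proof.
move=> a0 eps0 K0 fK; have [s s0 hs] := sector_lower_bound eps0.
(* Taking [1 + K] in place of [K] makes the same estimate control the exponential alone, even when
   [K] is 0. *)
have decay c : 0 < c -> forall e, 0 < e -> exists M, forall kap, M < normc kap -> sector eps kap ->
    C0 <= normc kap /\ (1 + K) * (1 + normc kap) * expR (- (c * Re kap)) < e.
  move=> c0 e e0; exists (Num.max C0 (Num.max 1 (8 * (1 + K) / ((c * s) ^+ 2 * e)))) => kap.
  rewrite !gt_max => /andP[h1 /andP[h2 h3]] /hs [h4 _]; split; first exact: ltW.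
  have K1 : 0 <= 1 + K by rewrite addr_ge0.
  apply: le_lt_trans (exp_decay (mulr_gt0 c0 s0) e0 K1 (ltW h2) h3).
  rewrite ler_wpM2l ?mulr_ge0 ?addr_ge0 ?normc_ge0 // ler_expR lerN2.
  by rewrite -mulrA ler_pM2l.
split.
  apply/ccvgP => e e0; apply/infinity_inP.
  have [M hM] := decay (2 * a) (mulr_gt0 (ltr0n _ 2) a0) e e0.
  exists M => kap Mk Sk; have [_ h] := hM kap Mk Sk.
  rewrite sub0r normcN normc_exp_weight; apply: le_lt_trans h.
  rewrite ler_peMl ?expR_ge0 // -[leLHS]mulr1; apply: ler_pM => //.
    by rewrite lerDl.
  by rewrite lerDl normc_ge0.
move=> eta eta0; apply/ccvgP => e e0; apply/infinity_inP.
have c0 : 0 < 2 * a * eta by rewrite !mulr_gt0.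
have [M hM] := decay _ c0 e e0.
exists M => kap Mk Sk; have [kC h] := hM kap Mk Sk.
rewrite sub0r normcN; apply: le_lt_trans h.
have w0 := expR_gt0 (- (2 * a * Re kap)).
rewrite !normcM normcC normcV normc_exp_weight (ger0_norm (powR_ge0 _ _)).
have -> : expR (- (2 * a * Re kap)) `^ eta = expR (- (2 * a * eta * Re kap)).
  by rewrite -expRM; congr expR; ring.
apply: ler_wpM2r; first exact: expR_ge0.
rewrite ler_pdivrMr //; apply: le_trans (fK kap Sk kC) _.
rewrite ler_wpM2r ?(ltW w0) // ler_wpM2r ?addr_ge0 ?normc_ge0 //.
by rewrite lerDr.
Qed.

End Sector.

(** * Extension of the potential by zero *)

Section ZeroExtension.
Context {R : realType}.
Notation mu := (@lebesgue_measure R).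
Implicit Types (q : R -> R) (e : endpoint R).

Definition domain_itv e : interval R :=
  if e is RegularEnd b _ then `]0, b[ else `]0, +oo[.

Lemma in_domain_itv e x : (x \in domain_itv e) = (0 < x) && (x%:E < end_of e)%E.
Proof. by case: e => [b h|||u0] /=; rewrite in_itv /= ?lte_fin ?ltry. Qed.

Lemma locally_integrableW q s t : locally_integrable_potential q -> 0 < s ->
  mu.-integrable `[s, t] (EFin \o q).
Proof.
move=> qi s0; have t1 : 0 < `|t| + 1 by rewrite ltr_wpDl.
apply: integrableS (qi _ t1) => // x /=; rewrite !in_itv /= => /andP[sx xt].
by rewrite (lt_le_trans s0 sx) (le_lt_trans xt) // ltr_pwDr // ler_norm.
Qed.

Lemma admissible_integrable q e s t : admissible q e -> 0 < s -> (t%:E < end_of e)%E ->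
  mu.-integrable `[s, t] (EFin \o q).
Proof.
case: e => [b h [b0 qi]|[qi _]|[qi _ _]|u0 [qi _ _ _ _]] /= s0 tb;
  try exact: locally_integrableW.
apply: integrableS qi => // x /=; rewrite !in_itv /= => /andP[sx xt].
by rewrite (lt_le_trans s0 sx) (le_lt_trans xt).
Qed.

(** [admissible] says nothing about [q] outside the open interval, not even measurability. The
    extension is measurable on the line and integrable on every [[0, a]], also for [a] beyond a
    finite [b], as the kernel construction requires. *)
Definition zero_extension e q : R -> R := q \_ [set` domain_itv e].

Lemma zero_extensionE e q x : 0 < x -> (x%:E < end_of e)%E -> zero_extension e q x = q x.
Proof. by move=> x0 xb; rewrite /zero_extension patchE mem_set //= in_domain_itv x0. Qed.

Let measurable_ray q : locally_integrable_potential q -> measurable_fun `](0 : R), +oo[ q.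
Proof.
move=> qi.
have -> : [set` `]0, +oo[] = \bigcup_n [set` `]0, n.+1%:R[] :> set R.
  apply/seteqP; split => x /=; rewrite in_itv /=.
    rewrite andbT => x0; exists (Num.bound x) => //=; rewrite in_itv /= x0 /=.
    apply: lt_le_trans (archi_boundP (ltW x0)) _; by rewrite ler_nat.
  by move=> [n _ /=]; rewrite in_itv /= => /andP[->].
apply/measurable_fun_bigcup; first by move=> n; exact: measurable_itv.
by move=> n; apply/measurable_EFinP; exact: measurable_int (qi _ (ltr0Sn _ n)).
Qed.

Lemma measurable_zero_extension q e : admissible q e ->
  measurable_fun setT (zero_extension e q).
Proof.
move=> hq; apply/(measurable_restrictT q); first exact: measurable_itv.
case: e hq => [b h [b0 qi]|[qi _]|[qi _ _]|u0 [qi _ _ _ _]] /=;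
  try exact: measurable_ray.
by apply/measurable_EFinP; exact: measurable_int qi.
Qed.

Lemma zero_extension_integrable q e : admissible q e ->
  forall a, mu.-integrable `[0, a] (EFin \o zero_extension e q).
Proof.
move=> hq a; case: (leP a 0) => a0.
  apply: (@integrableS _ _ _ mu `[0, 0]) => //.
    by apply: subset_itvl; rewrite bnd_simp.
  rewrite set_itv1; apply/integrableP; split; first exact: measurable_fun_set1.
  by rewrite integral_set1.
apply: integrable_itv_oc.
have ray : locally_integrable_potential q -> domain_itv e = `]0, +oo[ ->
    mu.-integrable `]0, a] (EFin \o zero_extension e q).
  move=> qi de; have a1 : 0 < a + 1 by rewrite addr_gt0.
  have qi' : mu.-integrable `]0, a] (EFin \o q).
    apply: integrableS (qi _ a1) => // x /=; rewrite !in_itv /= => /andP[-> xa] /=.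
    by rewrite (le_lt_trans xa) // ltrDl.
  apply: eq_integrable qi' => // x; rewrite inE /= in_itv /= => /andP[x0 _].
  by rewrite /zero_extension patchE mem_set //= de in_itv /= x0.
case: e hq ray => [b h [b0 qi] _|[qi _]|[qi _ _]|u0 [qi _ _ _ _]] /=; try by apply.
apply: (@integrableS _ _ _ mu setT) => //.
have -> : EFin \o zero_extension (RegularEnd b h) q = (EFin \o q) \_ `]0, b[ by rewrite restrict_EFin.
exact: (integrable_mkcond _ (mitv `]0, b[)).1.
Qed.

End ZeroExtension.

(** * From the estimates to the expansion of [m] *)

Section Assembly.
Context {R : realType}.
Notation mu := (@lebesgue_measure R).
Implicit Types (q : R -> R) (e : endpoint R).

Lemma sol_potential q q1 z a b (u du : R -> R[i]) : (forall x, a <= x <= b -> q x = q1 x) ->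
  sol q z a b u du -> sol q1 z a b u du.
Proof.
move=> qq [h1 h2]; split => //.
by apply: (cac_eq h2) => // x xab; rewrite qq.
Qed.

Lemma schroedinger_potential q q1 b z (u : R -> R[i]) :
  (forall x, 0 < x -> (x%:E < b)%E -> q x = q1 x) ->
  schroedinger_solution q b z u -> schroedinger_solution q1 b z u.
Proof.
move=> qq [h1 [ddu h2 h3]]; split => //; exists ddu => //.
move: h3; apply: filterS; first exact: (ae_filter_ringOfSetsType mu).
by move=> x h x0 xb; rewrite -qq //; exact: h.
Qed.

Lemma limit_point_potential q q1 : (forall x, 0 < x -> q x = q1 x) ->
  limit_point_at_infinity q -> limit_point_at_infinity q1.
Proof.
move=> qq lp z z0; have [u [h1 h2 h3 h4]] := lp z z0.
exists u; split => //; first by apply: schroedinger_potential h1 => x x0 _; exact: qq.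
move=> v hv; apply: h4; apply: schroedinger_potential hv => x x0 _; exact/esym/qq.
Qed.

Lemma bounded_negative_part_real q : locally_integrable_potential q ->
  bounded_negative_part q ->
  exists P : R, forall a, 0 < a -> \int[mu]_(t in `[a, a + 1]) Num.max (- q t) 0 <= P.
Proof.
move=> qi; rewrite /bounded_negative_part.
set S := ereal_sup _ => Soo.
have ub (a : R) : 0 < a -> (\int[mu]_(x in `]a, (a + 1)%R[) (Num.max (- q x) 0)%:E <= S)%E.
  by move=> a0; apply: ereal_sup_ubound; exists a.
have S0 : (0 <= S)%E.
  apply: le_trans (ub 1 ltr01); apply: integral_ge0 => x _.
  by rewrite lee_fin le_max lexx orbT.
have Sfin : S \is a fin_num by rewrite ge0_fin_numE.
exists (fine S) => a a0.
have ai := locally_integrableW (a + 1) qi a0.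
have mn : measurable_fun `[a, a + 1] (fun x => Num.max (- q x) 0).
  apply: measurable_maxr => //.
  by apply: measurableT_comp => //; apply/measurable_EFinP; exact: measurable_int ai.
have -> : \int[mu]_(t in `[a, a + 1]) Num.max (- q t) 0 =
    fine (\int[mu]_(x in `]a, (a + 1)%R[) (Num.max (- q x) 0)%:E)%E.
  rewrite /Rintegral; congr fine; apply/esym.
  rewrite integral_itv_obnd_cbnd; last first.
    apply/measurable_EFinP; apply: measurable_funS mn; first exact: measurable_itv.
    exact: subset_itv_oo_cc.
  rewrite integral_itv_bndo_bndc //.
  apply/measurable_EFinP; apply: measurable_funS mn; first exact: measurable_itv.
  exact: subset_itv_co_cc.
apply: fine_le => //; last exact: ub.
rewrite ge0_fin_numE; first exact: le_lt_trans (ub a a0) Soo.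
by apply: integral_ge0 => x _; rewrite lee_fin le_max lexx orbT.
Qed.

Lemma weyl_wronsk_ge0 q e z u : admissible q e -> 0 < Im z -> weyl_solution q e z u ->
  forall x, 0 < x -> (x%:E < end_of e)%E -> 0 <= wronsk u (cderiv u) x.
Proof.
move=> hq z0 [su nu bc].
have hs x y : 0 < x -> x <= y -> (y%:E < end_of e)%E -> sol q z x y u (cderiv u).
  by move=> x0 xy yb; apply: (schroedinger_sol su) => // s t s0 tb; exact: admissible_integrable hq _ _.
have mq := measurable_zero_extension hq.
have qi := zero_extension_integrable hq.
case: e hq su nu bc hs mq qi =>
  [b h [b0 qi]|[qi bn]|[qi nbn lp]|u0 [qi lc s0 n0 [l l0 hl]]] /= su nu bc hs mq qti x x0 xb.
- rewrite lte_fin in xb.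
  apply: (@wronsk_regular_end R q b z u (cderiv u) h x) => //; first exact: ltW.
  move=> k k' ck ck'; case: h bc {mq qti} => [h|]; by rewrite ?(lim_leftE ck) ?(lim_leftE ck').
- have [P hP] := bounded_negative_part_real qi bn.
  rewrite leNgt; apply/negP => W.
  apply: (@wronsk_bounded_negative_absurd R q z u (cderiv u) P _ _ _ _ _ x) => //.
  + by move=> s t s0; exact: locally_integrableW.
  + by move=> s t s0 st; apply: hs => //; exact: ltry.
- set q1 := zero_extension _ q in mq qti.
  have qq t : 0 < t -> q t = q1 t by move=> t0; rewrite /q1 zero_extensionE //= ltry.
  apply: (@wronsk_limit_point R q1 z) => //.
    exact: limit_point_potential lp.
  move=> s t s0 st; apply: (@sol_potential q); last by apply: hs => //; exact: ltry.
  by move=> y /andP[sy _]; apply: qq; exact: lt_le_trans sy.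
- apply: (@wronsk_limit_circle R q z u (cderiv u) u0 (cderiv u0) l) => //.
  + by move=> s t s1; exact: locally_integrableW.
  + move=> s t s1 st; apply: (schroedinger_sol s0) => //; last exact: ltry.
    by move=> s' t' s'0 _; exact: locally_integrableW.
  + by move=> s t s1 st; apply: hs => //; exact: ltry.
  + by case: n0 => y [y0 _ uy]; exists y.
  + exact: lc su.
Qed.

(** The value of [u] at 0 itself is arbitrary, while [m] is defined by limits; [v] and [dv] carry
    these limits as values at 0, and so the estimates on [[0, a]] apply to them. *)
Lemma weyl_boundary_values q e z u a : admissible q e -> 0 < Im z -> weyl_solution q e z u ->
  0 < a -> (a%:E < end_of e)%E ->
  exists v dv : R -> R[i], [/\ v 0 = lim_right u 0, dv 0 = lim_right (cderiv u) 0,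
    sol (zero_extension e q) z 0 a v dv &
    forall x, 0 < x -> v x = u x /\ dv x = cderiv u x].
Proof.
move=> hq z0 [su _ _] a0 ab.
have qti := zero_extension_integrable hq.
have hs x : 0 < x -> x <= a -> sol (zero_extension e q) z x a u (cderiv u).
  move=> x0 xa; apply: (@sol_potential q).
    move=> t /andP[xt ta]; rewrite zero_extensionE //; first exact: lt_le_trans xt.
    by apply: le_lt_trans ab; rewrite lee_fin.
  by apply: (schroedinger_sol su) => // s t s0 tb; exact: admissible_integrable hq _ _.
have [l [l' [cl cl' hl]]] := sol_extend0 a0 (qti a) hs.
exists (fun x => if x == 0 then l else u x), (fun x => if x == 0 then l' else cderiv u x).
rewrite eqxx (lim_rightE cl) (lim_rightE cl'); split => // x x0.
by rewrite gt_eqF.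
Qed.

(** Unique continuation: a solution vanishing on []0, a]] has zero data at [a / 2], hence vanishes
    on the whole interval, contrary to [nonzero_on]. *)
Lemma weyl_boundary_neq0 q e z u : admissible q e -> 0 < Im z -> weyl_solution q e z u ->
  forall a, 0 < a -> (a%:E < end_of e)%E -> exists2 x, 0 < x <= a & u x != 0.
Proof.
move=> hq z0 [su [y [y0 yb uy]] _] a a0 ab; apply: contrapT => nu.
have u0 x : 0 < x -> x <= a -> u x = 0.
  move=> x0 xa; apply/eqP; apply: contrapT => /negP ux; apply: nu; exists x => //.
  by rewrite x0.
pose c := a / 2; have c0 : 0 < c by rewrite divr_gt0.
have ca : c < a by apply: half_lt.
pose s := Num.min (c / 2) y; pose t := Num.max a y.
have s0 : 0 < s by rewrite lt_min y0 divr_gt0.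
have sc : s < c by rewrite /s gt_min ltr_pdivrMr // ltr_pMr // ltr1n.
have sy : s <= y by rewrite /s ge_min lexx orbT.
have at' : a <= t by rewrite /t le_max lexx.
have yt : y <= t by rewrite /t le_max lexx orbT.
have tb : (t%:E < end_of e)%E by rewrite /t maxElt; case: ifP.
have ct := lt_le_trans ca at'.
have hs : sol q z s t u (cderiv u).
  by apply: (schroedinger_sol su) => //; [move=> *; exact: admissible_integrable hq _ _|exact: le_trans sy yt].
move/negP: uy; apply; apply/eqP.
apply: (sol_zero hs) (_ : s <= c <= t) _ _ _ _; last by rewrite sy.
- exact: admissible_integrable hq _ _.
- by rewrite !ltW.
- by apply: u0 => //; exact: ltW.
rewrite (@eq_cderiv _ 0 a u (fun=> 0)) //.
  by apply: complexP; rewrite /cderiv /= derive1_cst.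
by move=> x /andP[x0 xa]; apply: u0 => //; exact: ltW.
Qed.

Let add_div (l l' w x : R[i]) : l != 0 -> l' + w * l + l * x = l * (l' / l - (- w - x)).
Proof. by move=> l0; field. Qed.

Lemma m_function_estimate q e m (mq : measurable_fun setT (zero_extension e q))
    (qi : forall a, mu.-integrable `[0, a] (EFin \o zero_extension e q)) a eps :
  admissible q e -> is_m_function q e m -> 0 < a -> (a%:E < end_of e)%E -> 0 < eps ->
  exists K C0 : R, 0 <= K /\ forall kap, sector eps kap -> C0 <= normc kap ->
    normc (m (- kap ^+ 2) - (- kap - cintegral `[0, a]
      (fun x => (amplitude mq qi x)%:C * cexp (- (2 * x)%:C * kap)))) <=
    K * (1 + normc kap) * expR (- (2 * a * Re kap)).
Proof.
move=> hq hm a0 ab eps0.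
have [s s0 hs] := sector_lower_bound eps0.
have [K [C0 [K0 C00 h]]] := weyl_estimate mq qi a0 s0.
exists K, C0; split => // kap Sk kC.
have [sR sI] := hs kap Sk.
have nk : 0 < normc kap := lt_le_trans C00 kC.
have R0 : 0 < Re kap by apply: lt_le_trans sR; rewrite mulr_gt0.
have I0 : 0 < - Im kap by apply: lt_le_trans sI; rewrite mulr_gt0.
have z0 : 0 < Im (- kap ^+ 2).
  have -> : Im (- kap ^+ 2) = 2 * (Re kap * - Im kap) by rewrite expr2 !cparts; ring.
  by rewrite !mulr_gt0.
have [u wu ->] := hm _ z0.
have [v [dv [v0 dv0 hv vu]]] := weyl_boundary_values hq z0 wu a0 ab.
have W : 0 <= wronsk v dv a.
  have [va dva] := vu a a0; rewrite /wronsk va dva.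
  exact: weyl_wronsk_ge0 hq z0 wu a a0 ab.
have [h1 h2] := h kap v dv kC sR sI hv W.
(* The first bound of [weyl_estimate] controls [u] on []0, a]] by [|v 0|], so [v 0 = 0] would make
   [u] vanish there. Hence the quotient defining [m] is a genuine one. *)
have l0 : v 0 != 0.
  have [x /andP[x0 xa] ux] := weyl_boundary_neq0 hq z0 wu a0 ab.
  apply: contraNneq ux => vz; have := h1 x; rewrite vz (ltW x0) xa normc0 mulr0 => /(_ isT).
  have [-> _] := vu x x0; by apply: contraTT; rewrite -normc_gt0 -ltNge.
rewrite -v0 -dv0.
have n0 : 0 < normc (v 0) by rewrite normc_gt0.
rewrite -(ler_pM2l n0) -normcM.
have e1 := add_div (dv 0) kap (cintegral `[0, a] (fun x => (amplitude mq qi x)%:C * cexp (- (2 * x)%:C * kap))) l0.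
rewrite -e1; apply: le_trans h2 _.
by rewrite le_eqVlt; apply/orP; left; apply/eqP; ring.
Qed.

Lemma amplitude_corr_continuous q (D : set R) (mq : measurable_fun setT q)
    (qi : forall a, mu.-integrable `[0, a] (EFin \o q)) : (forall x, D x -> 0 <= x) ->
  {within D, continuous (amplitude_corr mq qi)}.
Proof.
move=> D0; apply/subspace_continuousP => x Dx; apply/cvgrPdist_lt => e e0.
have x0 := D0 x Dx; have x10 : 0 <= x + 1 by rewrite addr_ge0.
have [d d0 hd] := amplitude_corr_unif_continuous mq qi x10 e0.
have d1 : 0 < Num.min d 1 by rewrite lt_min d0 ltr01.
rewrite near_withinE; apply/nbhs_ballP; exists (Num.min d 1) => // y.
rewrite /ball /= lt_min => /andP[xyd xy1] Dy; have y0 := D0 y Dy.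
case: (leP x y) => xy.
  rewrite distrC; rewrite distrC ger0_norm ?subr_ge0 // in xyd xy1.
  by apply: hd => //; rewrite -lerBlDl ltW.
rewrite gtr0_norm ?subr_gt0 // in xyd.
by apply: hd => //; [exact: ltW|rewrite lerDl].
Qed.

Lemma Rintegral_itv_oo (a b : R) (f : R -> R) : mu.-integrable `[a, b] (EFin \o f) ->
  \int[mu]_(x in `]a, b[) f x = \int[mu]_(x in `[a, b]) f x.
Proof.
move=> fi; rewrite Rintegral_itv_bndo_bndc; last first.
  by apply: integrableS fi => //; exact: subset_itv_oo_cc.
rewrite Rintegral_itv_obnd_cbnd //.
by apply: integrableS fi => //; exact: subset_itv_oc_cc.
Qed.

End Assembly.

Theorem theorem1p1 (R : realType) (q : R -> R) (e : endpoint R)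
    (m : R[i] -> R[i]) (hq : admissible q e) (hm : is_m_function q e m) :
  exists A : R -> R,
    [/\ (forall a : R, 0 < a -> (a%:E < end_of e)%E ->
           lebesgue_measure.-integrable `]0, a[ (fun x => (A x)%:E)),
        (forall a eps : R, 0 < a -> (a%:E < end_of e)%E -> 0 < eps ->
           tildeO (infinity_in (sector eps))
             (fun kappa => m (- kappa ^+ 2) -
                (- kappa -
                 cintegral `]0, a[
                   (fun alpha => (A alpha)%:C * cexp (- (2 * alpha)%:C * kappa))))
             (fun kappa => cexp (- (2 * a)%:C * kappa))),
        {within [set alpha : R | 0 <= alpha /\ (alpha%:E < end_of e)%E],
           continuous (fun alpha => A alpha - q alpha)} &
        forall alpha : R, 0 <= alpha -> (alpha%:E < end_of e)%E ->
          let Q := \int[lebesgue_measure]_(x in `]0, alpha[) `|q x| in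
          `|A alpha - q alpha| <= Q ^+ 2 * expR (alpha * Q)].
Proof.
have mq := measurable_zero_extension hq.
have qi := zero_extension_integrable hq.
(* Built on [q] and not on its extension, so that [A - q] equals [amplitude_corr] at every point. At
   0 the two may differ, and continuity is claimed there too. *)
pose A x := q x + amplitude_corr mq qi x.
have AE x : 0 < x -> (x%:E < end_of e)%E -> A x = amplitude mq qi x.
  by move=> x0 xb; rewrite /A /amplitude zero_extensionE.
have Aq x : A x - q x = amplitude_corr mq qi x by rewrite /A addrC addKr.
have oo (a : R) x : (a%:E < end_of e)%E -> x \in `]0, a[ -> 0 < x /\ (x%:E < end_of e)%E.
  move=> ab; rewrite in_itv /= => /andP[x0 xa]; split => //.
  by apply: lt_trans ab; rewrite lte_fin.
exists A; split.
- move=> a a0 ab.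
  have Ai : lebesgue_measure.-integrable `]0, a[ (EFin \o amplitude mq qi).
    apply: integrableS (amplitude_integrable mq qi a) => //.
    exact: subset_itv_oo_cc.
  apply: eq_integrable Ai => // x; rewrite inE /= => xa.
  by have [x0 xb] := oo a x ab xa; rewrite /= AE.
- move=> a eps a0 ab eps0.
  have [K [C0 [K0 h]]] := m_function_estimate mq qi hq hm a0 ab eps0.
  apply: (tildeO_exp a0 eps0 K0 (C0 := C0)) => kap Sk kC.
  suff -> : cintegral `]0, a[ (fun alpha => (A alpha)%:C * cexp (- (2 * alpha)%:C * kap)) =
      cintegral `[0, a] (fun x => (amplitude mq qi x)%:C * cexp (- (2 * x)%:C * kap)).
    exact: h.
  rewrite (eq_cintegral (g := fun x => (amplitude mq qi x)%:C * cexp (- (2 * x)%:C * kap))); last first.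
    by move=> x; rewrite inE /= => xa; have [x0 xb] := oo a x ab xa; rewrite AE.
  have [i1 i2] : cintegrable `[0, a] (fun x => (amplitude mq qi x)%:C * cexp (- (2 * x)%:C * kap)).
    have := cac_integrableM (cac_scaled_cexp 0 a kap) (cintegrable_real (amplitude_integrable mq qi a)).
    by apply: eq_cintegrable; [exact: mitv|move=> x _; exact: mulrC].
  by rewrite /cintegral !Rintegral_itv_oo.
- have -> : (fun alpha => A alpha - q alpha) = amplitude_corr mq qi by apply/funext.
  by apply: amplitude_corr_continuous => x [].
move=> x x0 xb /=; rewrite Aq.
have -> : \int[lebesgue_measure]_(t in `]0, x[) `|q t| = absq_int (zero_extension e q) x.
  rewrite /absq_int -Rintegral_itv_oo; last exact: absq_integrable.
  by apply: eq_Rintegral => t; rewrite inE /= => tx; have [t0 tb] := oo x t xb tx; rewrite zero_extensionE.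
exact: amplitude_corr_bound.
Qed.
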